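(* Let $N$ be a complete $n$-dimensional Riemannian manifold with a pole and with radial sectional curvature bounded above by $K_N\leq -\kappa^{2}<0$, where $\kappa>0$. Let $M\subset N\times\mathbb{R}$ be a closed immersed $H$-hypersurface with mean curvature $H_M$. Then $$|H_M|\;\geq\;\frac{2}{n}\sqrt{\lambda^{\ast}(\mathbb{H}^{n}(-\kappa^{2}))}\;=\;\frac{(n-1)\,\kappa}{n}.$$ In particular, $$h(N\times\mathbb{R})\;\geq\;\frac{(n-1)\,\kappa}{n}.$$
   Context: A pole of a complete Riemannian manifold $N$ is a point $q\in N$ such that $\exp_q:T_qN\to N$ is a diffeomorphism. ''Radial sectional curvature bounded above by $-\kappa^2$'' means that the sectional curvatures along the geodesics emanating from the pole $q$ (i.e. of tangent 2-planes containing the velocity vector of such a geodesic) are at most $-\kappa^2$. $N\times\mathbb{R}$ carries the product metric. Closed means compact without boundary. An $H$-hypersurface is an immersed hypersurface with constant mean curvature. The mean curvature is normalized: if $\alpha$ is the second fundamental form of the $n$-dimensional hypersurface $M$ and $\{e_1,\dots,e_n\}$ is an orthonormal basis of $T_qM$, then $\left|\sum_{i=1}^n\alpha(e_i,e_i)\right| = n\,|H_M|$. For a complete Riemannian manifold $W$, $h(W)=\inf\{|H_M| : M\in\mathscr{F}(W)\}$, where $\mathscr{F}(W)$ is the set of all closed immersed $H$-hypersurfaces of $W$. $\mathbb{H}^n(-\kappa^2)$ is the simply connected hyperbolic space of dimension $n$ and constant sectional curvature $-\kappa^2$. The fundamental tone of a Riemannian manifold $W$ is $\lambda^{\ast}(W)=\inf\left\{\int_W|\nabla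 f|^2\big/\int_W f^2 : f\in H^1_0(W)\setminus\{0\}\right\}$, where $H^1_0(W)$ is the completion of $C^\infty_0(W)$ with respect to the norm $\|\varphi\|^2=\int_W\varphi^2+\int_W|\nabla\varphi|^2$. *)

(* Defs.v *)
From HB Require Import structures.
From mathcomp Require Import all_boot all_order all_algebra.
From mathcomp Require Import all_classical all_reals all_analysis.

Set Implicit Arguments.
Unset Strict Implicit.
Unset Printing Implicit Defensive.

Import Order.TTheory GRing.Theory Num.Theory.
Import numFieldNormedType.Exports.

Local Open Scope classical_set_scope.
Local Open Scope ring_scope.

(* C^infinity on an open set U: all iterated directional derivatives are
   (Frechet) differentiable at every point of U. *)
Definition smooth_on (R : realType) (n : nat) (V : normedModType R)
    (U : set 'rV[R]_n) (f : 'rV[R]_n -> V) : Prop :=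
  forall (s : seq 'rV[R]_n) (x : 'rV[R]_n), U x ->
    differentiable (foldr (fun v g y => 'D_v g y) f s) x.

(* Iterated Lebesgue integral; by Tonelli it is the integral against Lebesgue
   measure on R^n for nonnegative Borel functions, the only ones used below. *)
Fixpoint integral_rV (R : realType) (n : nat) :
    ('rV[R]_n -> \bar R) -> \bar R :=
  match n with
  | 0%N => fun u => u 0
  | m.+1 => fun u => (\int[lebesgue_measure]_(t in [set: R])
              integral_rV (fun y : 'rV[R]_m => u (row_mx (t%:M) y)))%E
  end.

(** * Smooth manifolds *)

(* Raw data of an atlas; [param i] is the inverse of [chart i], and both are
   meaningful only on [dom i] and its image.  [chart_at p] is a preferred chart
   around p, used to identify T_pM with 'rV_n.  The axioms are in
   [is_manifold]; the atlas need not be maximal. *)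
Record manifold (R : realType) (n : nat) := Manifold {
  carrier :> topologicalType ;
  index : Type ;
  dom : index -> set carrier ;
  chart : index -> carrier -> 'rV[R]_n ;
  param : index -> 'rV[R]_n -> carrier ;
  chart_at : carrier -> index }.

Definition codom_chart (R : realType) (n : nat) (M : manifold R n)
    (i : index M) : set 'rV[R]_n := chart i @` dom i.

Definition is_manifold (R : realType) (n : nat) (M : manifold R n) : Prop :=
  [/\ hausdorff_space M, @second_countable M,
      forall p : M, dom (chart_at p) p,
      forall i : index M,
        [/\ open (dom i), open (codom_chart i),
            forall p, dom i p -> param i (chart i p) = p,
            forall p, dom i p -> {for p, continuous (chart i)} &
            forall x, codom_chart i x -> {for x, continuous (param i)}] &
      forall i j : index M,
        smooth_on (chart i @` (dom i `&` dom j)) (chart j \o param i)].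

Definition smooth_map (R : realType) (m n : nat)
    (M : manifold R m) (N : manifold R n) (f : M -> N) : Prop :=
  continuous f /\
  forall (i : index M) (j : index N),
    smooth_on (chart i @` (dom i `&` f @^-1` dom j))
      (chart j \o f \o param i).

Definition smooth_fun (R : realType) (n : nat) (M : manifold R n)
    (f : M -> R) : Prop :=
  forall i : index M, smooth_on (codom_chart i) (f \o param i).

Definition diffeomorphism (R : realType) (m n : nat)
    (M : manifold R m) (N : manifold R n) (f : M -> N) : Prop :=
  smooth_map f /\
  exists g : N -> M, [/\ smooth_map g, cancel f g & cancel g f].

Definition immersion (R : realType) (m n : nat)
    (M : manifold R m) (N : manifold R n) (f : M -> N) : Prop :=
  smooth_map f /\
  forall (p : M) (i : index M) (j : index N), dom i p -> dom j (f p) ->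
    forall v : 'rV[R]_m,
      'D_v (chart j \o f \o param i) (chart i p) = 0 -> v = 0.

(** * Riemannian metrics *)

(* [gram i x] is the matrix (g_ab) of the metric in the chart i, at the point
   with coordinates x. *)
Record riemannian (R : realType) (n : nat) := Riemannian {
  base :> manifold R n ;
  gram : index base -> 'rV[R]_n -> 'M[R]_n }.

Definition bform (R : realType) (n : nat) (A : 'M[R]_n) (v w : 'rV[R]_n) : R :=
  (v *m A *m w^T) 0 0.

Definition is_riemannian (R : realType) (n : nat) (W : riemannian R n) : Prop :=
  [/\ is_manifold W,
      forall i : index W, smooth_on (codom_chart i) (@gram _ _ W i),
      forall (i : index W) x, codom_chart i x -> (gram i x)^T = gram i x,
      forall (i : index W) x, codom_chart i x ->
        forall v, v != 0 -> 0 < bform (gram i x) v v &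
      forall (i j : index W) (p : W), dom i p -> dom j p ->
        forall v w, let tau := chart j \o param i in
          bform (gram i (chart i p)) v w =
          bform (gram j (chart j p))
            ('D_v tau (chart i p)) ('D_w tau (chart i p))].

(* The Christoffel symbols of G as a vector-valued bilinear form, that is
   nabla_v w for constant coordinate fields v, w; by the Koszul formula,
   2 <nabla_v w, e_k> = v<w, e_k> + w<v, e_k> - e_k<v, w>. *)
Definition christoffel (R : realType) (n : nat) (G : 'rV[R]_n -> 'M[R]_n)
    (x v w : 'rV[R]_n) : 'rV[R]_n :=
  (\row_k (2^-1 *
     ('D_v (fun y => bform (G y) w (delta_mx 0 k)) x
      + 'D_w (fun y => bform (G y) v (delta_mx 0 k)) x
      - 'D_(delta_mx 0 k) (fun y => bform (G y) v w) x))) *m invmx (G x).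

(* R(u, v)w = nabla_u nabla_v w - nabla_v nabla_u w, for constant coordinate
   fields u, v, w. *)
Definition curvature (R : realType) (n : nat) (G : 'rV[R]_n -> 'M[R]_n)
    (x u v w : 'rV[R]_n) : 'rV[R]_n :=
  'D_u (fun y => christoffel G y v w) x
  - 'D_v (fun y => christoffel G y u w) x
  + christoffel G x u (christoffel G x v w)
  - christoffel G x v (christoffel G x u w).

Definition sectional_curvature (R : realType) (n : nat)
    (G : 'rV[R]_n -> 'M[R]_n) (x u w : 'rV[R]_n) : R :=
  bform (G x) (curvature G x u w w) u /
  (bform (G x) u u * bform (G x) w w - bform (G x) u w ^+ 2).

(** * Geodesics, completeness, poles *)

Definition velocity (R : realType) (n : nat) (M : manifold R n)
    (i : index M) (gamma : R -> M) (t : R) : 'rV[R]_n :=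
  derive1 (chart i \o gamma) t.

Definition geodesic (R : realType) (n : nat) (W : riemannian R n)
    (gamma : R -> W) : Prop :=
  continuous gamma /\
  forall (i : index W) (t : R), dom i (gamma t) ->
    [/\ derivable (chart i \o gamma) t 1,
        derivable (velocity i gamma) t 1 &
        derive1 (velocity i gamma) t
        + christoffel (@gram _ _ W i) (chart i (gamma t))
            (velocity i gamma t) (velocity i gamma t) = 0].

Definition geodesic_from (R : realType) (n : nat) (W : riemannian R n)
    (p : W) (v : 'rV[R]_n) (gamma : R -> W) : Prop :=
  [/\ geodesic gamma, gamma 0 = p & velocity (chart_at p) gamma 0 = v].

Definition complete_riemannian (R : realType) (n : nat)
    (W : riemannian R n) : Prop :=
  forall (p : W) (v : 'rV[R]_n), exists gamma, geodesic_from p v gamma.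

(* R^n with its global chart and the metric G. *)
Definition coordinate_space (R : realType) (n : nat)
    (G : 'rV[R]_n -> 'M[R]_n) : riemannian R n :=
  @Riemannian R n
    (@Manifold R n 'rV[R]_n unit
       (fun=> setT) (fun=> id) (fun=> id) (fun=> tt))
    (fun=> G).

Definition euclidean (R : realType) (n : nat) : riemannian R n :=
  coordinate_space (fun _ : 'rV[R]_n => 1%:M).

(* E is exp_q : T_qW -> W, with T_qW identified with R^n by [chart_at q]. *)
Definition is_exp (R : realType) (n : nat) (W : riemannian R n) (q : W)
    (E : euclidean R n -> W) : Prop :=
  forall v : 'rV[R]_n, geodesic_from q v (fun t => E (t *: v)).

Definition pole (R : realType) (n : nat) (W : riemannian R n) (q : W) : Prop :=
  exists E : euclidean R n -> W, is_exp q E /\ diffeomorphism E.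

Definition radial_curvature_le (R : realType) (n : nat) (W : riemannian R n)
    (q : W) (K : R) : Prop :=
  forall gamma : R -> W, geodesic gamma -> gamma 0 = q ->
  forall (t : R) (i : index W), dom i (gamma t) ->
  forall w : 'rV[R]_n, row_free (col_mx (velocity i gamma t) w) ->
    sectional_curvature (@gram _ _ W i) (chart i (gamma t))
      (velocity i gamma t) w <= K.

(** * Products *)

Definition real_line (R : realType) : riemannian R 1 :=
  @Riemannian R 1
    (@Manifold R 1 R unit
       (fun=> setT) (fun=> fun t => t%:M) (fun=> fun x => x 0 0) (fun=> tt))
    (fun=> fun=> 1%:M).

Definition prod_riemannian (R : realType) (m n : nat)
    (V : riemannian R m) (W : riemannian R n) : riemannian R (m + n) :=
  @Riemannian R (m + n)
    (@Manifold R (m + n) (V * W)%type (index V * index W)%type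
       (fun ij => dom ij.1 `*` dom ij.2)
       (fun ij p => row_mx (chart ij.1 p.1) (chart ij.2 p.2))
       (fun ij x => (param ij.1 (lsubmx x), param ij.2 (rsubmx x)))
       (fun p => (chart_at p.1, chart_at p.2)))
    (fun ij x => block_mx (gram ij.1 (lsubmx x)) 0 0 (gram ij.2 (rsubmx x))).

(** * Closed hypersurfaces of constant mean curvature *)

Definition closed_hypersurface (R : realType) (n : nat)
    (W : riemannian R (n + 1)) (M : manifold R n) (f : M -> W) : Prop :=
  [/\ is_manifold M, [set: M] !=set0, compact [set: M] & immersion f].

(* Second fundamental form alpha(v, w) along the unit normal nu, for a local
   expression F of the immersion in a chart with metric G, at the coordinates
   x: the normal component of the covariant derivative of dF(w) along v. *)
Definition second_form (R : realType) (m n : nat)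
    (G : 'rV[R]_n -> 'M[R]_n) (F : 'rV[R]_m -> 'rV[R]_n) (x : 'rV[R]_m)
    (nu : 'rV[R]_n) (v w : 'rV[R]_m) : R :=
  bform (G (F x))
    ('D_v (fun y => 'D_w F y) x + christoffel G (F x) ('D_v F x) ('D_w F x)) nu.

(* The immersion has constant mean curvature H (up to sign, which depends on
   the choice of the local unit normal): |sum_a alpha(e_a, e_a)| = n |H|. *)
Definition constant_mean_curvature (R : realType) (n : nat)
    (W : riemannian R (n + 1)) (M : manifold R n) (f : M -> W) (H : R) : Prop :=
  forall (p : M) (i : index M) (j : index W), dom i p -> dom j (f p) ->
  let F := chart j \o f \o param i in
  let x := chart i p in
  let g := bform (gram j (F x)) in
  forall (e : 'I_n -> 'rV[R]_n) (nu : 'rV[R]_(n + 1)),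
    (forall a b, g ('D_(e a) F x) ('D_(e b) F x) = (a == b)%:R) ->
    g nu nu = 1 -> (forall v, g ('D_v F x) nu = 0) ->
    `| \sum_a second_form (@gram _ _ W j) F x nu (e a) (e a) | = n%:R * `|H|.

Definition inf_mean_curvature (R : realType) (n : nat)
    (W : riemannian R (n + 1)) : \bar R :=
  ereal_inf [set c : \bar R |
    exists (M : manifold R n) (f : M -> W) (H : R),
      [/\ closed_hypersurface f, constant_mean_curvature f H &
          c = `|H|%:E]].

(** * Riemannian integration and the fundamental tone *)

Definition chart_integral (R : realType) (n : nat) (W : riemannian R n)
    (i : index W) (h : W -> R) : \bar R :=
  integral_rV (fun x : 'rV[R]_n =>
    (\1_(codom_chart i) x * (h (param i x) * Num.sqrt (\det (gram i x))))%:E).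

Definition closed_support (R : realType) (T : topologicalType)
    (h : T -> R) : set T := closure [set x | h x != 0].

(* Integral of a continuous u >= 0 for the Riemannian volume: supremum over the
   finite families of nonnegative continuous functions h_a, each compactly
   supported in a chart domain, with sum_a h_a <= u (partitions of unity show
   that it is the usual integral). *)
Definition riem_integral (R : realType) (n : nat) (W : riemannian R n)
    (u : W -> R) : \bar R :=
  ereal_sup [set s : \bar R |
    exists (k : nat) (c : 'I_k -> index W) (h : 'I_k -> W -> R),
      [/\ forall a, [/\ continuous (h a), forall p, 0 <= h a p,
                        compact (closed_support (h a)) &
                        closed_support (h a) `<=` dom (c a)],
          forall p, \sum_a h a p <= u p &
          s = (\sum_a chart_integral (c a) (h a))%E]].

(* |grad f|^2 = g^{ab} d_a f d_b f *)
Definition grad_sqnorm (R : realType) (n : nat) (W : riemannian R n)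
    (f : W -> R) (p : W) : R :=
  let i := chart_at p in
  let df := \row_k 'D_(delta_mx 0 k) (f \o param i) (chart i p) in
  bform (invmx (gram i (chart i p))) df df.

Definition test_function (R : realType) (n : nat) (W : riemannian R n)
    (f : W -> R) : Prop :=
  smooth_fun f /\ compact (closed_support f).

Definition mass (R : realType) (n : nat) (W : riemannian R n) (f : W -> R) :=
  riem_integral (fun p => f p ^+ 2).

Definition energy (R : realType) (n : nat) (W : riemannian R n) (f : W -> R) :=
  riem_integral (grad_sqnorm f).

Definition H1_cauchy (R : realType) (n : nat) (W : riemannian R n)
    (phi : nat -> W -> R) : Prop :=
  (forall k, test_function (phi k)) /\
  forall eps : R, 0 < eps -> exists K : nat, forall j k : nat,
    (K <= j)%N -> (K <= k)%N ->
    let d : W -> R := fun p => phi j p - phi k p in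
    (mass d + energy d < eps%:E)%E.

(* An element f of the completion H^1_0(W) is represented by a Cauchy sequence
   of test functions; a and b below are then the integrals of |grad f|^2 and
   f^2, and f is nonzero when its squared norm b + a is. *)
Definition fundamental_tone (R : realType) (n : nat) (W : riemannian R n) :
    \bar R :=
  ereal_inf [set r : \bar R |
    exists (phi : nat -> W -> R) (a b : \bar R),
      [/\ H1_cauchy phi,
          (fun k => energy (phi k)) @ \oo --> a,
          (fun k => mass (phi k)) @ \oo --> b,
          (b + a)%E <> 0%E & r = (a / b)%E]].

(* H^n(-kappa^2): the hyperboloid x_0 = sqrt(kappa^-2 + |x|^2) in Minkowski
   space, in the global coordinates x in R^n; the induced metric is
   |dx|^2 - (dx_0)^2 with dx_0 = <x, dx> / x_0. *)
Definition hyperbolic_space (R : realType) (n : nat) (kappa : R) :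
    riemannian R n :=
  coordinate_space (fun x : 'rV[R]_n =>
    1%:M - (kappa ^- 2 + (x *m x^T) 0 0)^-1 *: (x^T *m x)).

(* Main.v *)
(* Let r be the distance to the pole q in N.  In the parametrization by exp_q the Gauss lemma makes
   the rays orthogonal to the spheres, and for a Jacobi field J = t D_w exp_q along the ray of
   velocity v, with k = kappa |v|, the function (|J|^2)' - 2 k |J|^2 is nondecreasing because the
   radial curvature is at most - kappa^2; hence Hess (r^2 / 2) >= kappa r on the orthogonal of the
   rays.  The function r^2 / 2, extended to be independent of the factor R, has a maximum on the
   compact M; tracing its Hessian there over an orthonormal frame of M, on which the second
   derivatives are nonpositive, yields n |H| >= (n - 1) kappa.

   The fundamental tone of the hyperbolic space is ((n - 1) kappa / 2)^2.  Lower bound: the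
   gradient Y of a Busemann function has norm 1 and divergence (n - 1) kappa = 2 c, so that
   |grad f + c f Y|^2 >= 0 integrates to energy >= c^2 mass, because div (f^2 Y) has integral 0.
   Upper bound: exp (- m l), with m = (n - 1) / 2 and l the logarithm of the height on the
   hyperboloid, times a wide smooth cutoff supported in l >> 0, is a subsolution
   of Delta f + (c^2 + e) f >= 0.

   Riemannian integrals over the hyperbolic space reduce to iterated Lebesgue integrals of
   continuous compactly supported functions, for which the divergence theorem follows one
   variable at a time from the fundamental theorem of calculus. *)
Require Import Defs.
From HB Require Import structures.
From mathcomp Require Import all_boot all_order all_algebra.
From mathcomp Require Import all_classical all_reals all_analysis.
From mathcomp Require Import ring lra.

Set Implicit Arguments.
Unset Strict Implicit.
Unset Printing Implicit Defensive.

Import Order.TTheory GRing.Theory Num.Theory.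
Import numFieldNormedType.Exports.

Local Open Scope classical_set_scope.
Local Open Scope ring_scope.

(** * Calculus in normed spaces *)

(** Everything around the pole is computed on R^n, for the map F = chart o exp_q and vector fields
    along F, so that fields such as ['D_v F] need no extension to N. A vector x of R^n is both a
    base point and the velocity of its own ray at time 1. The constancy of the speed and the
    geodesic equation thus become identities in x valid at every x; differentiating them in x, with
    base point and velocity moving together, yields the Gauss lemma and the Jacobi equation. The
    drop from n to n - 1 is the cost of the vertical unit vector: by Bessel's inequality an
    orthonormal frame of M has total squared vertical part at most 1. At the farthest point the
    normal is radial, hence horizontal. If that point lies over the pole itself, there is no radial
    direction, but then all of M is vertical and n - 1 <= 0. On the hyperbolic side a single chart
    covers the space and only continuous functions of bounded support are integrated. Uniform
    continuity then gives differentiation under the integral sign, and no exchange of integrals is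
    ever made. Smoothness of the test functions rests on a family z^(-k) exp (- 1 / z) that is
    closed under differentiation. *)

Lemma is_derive_line (R : realType) (V W : normedModType R) (f : V -> W)
    (x v : V) (df : W) :
  is_derive x v f df <-> is_derive (0 : R) 1 (fun h : R => f (h *: v + x)) df.
Proof.
have e : 'D_v f x = 'D_1 (fun h : R => f (h *: v + x)) 0.
  rewrite /derive; set g1 := fun h => h^-1 *: _; set g2 := fun h => h^-1 *: _.
  suff -> : g1 = g2 by [].
  by apply/funext => h; rewrite /g1 /g2 /= addr0 scale0r add0r [_%:A]mulr1.
split=> -[d1 d2]; split.
- exact: (derivable1P f x v).1.
- by rewrite -e.
- exact: (derivable1P f x v).2.
- by rewrite e.
Qed.

Lemma is_derive_comp (R : realType) (U V W : normedModType R) (f : U -> V)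
    (g : V -> W) (x v : U) (df : V) :
  is_derive x v f df -> differentiable g (f x) ->
  is_derive x v (g \o f) ('D_df g (f x)).
Proof.
move=> /is_derive_line [d1 d2] dg; apply/is_derive_line.
have e : (g \o f) \o (fun h : R => h *: v + x) = g \o (fun h : R => f (h *: v + x)) by [].
have x0 : f x = f ((0:R) *: v + x) by rewrite scale0r add0r.
rewrite x0 in dg *; move/derivable1_diffP in d1.
have dgf := differentiable_comp d1 dg.
split; first exact: diff_derivable.
rewrite (deriveE _ dgf) (diff_comp d1 dg) /= -(deriveE _ d1) d2.
by rewrite deriveE.
Qed.

Lemma is_derive_linear (R : realType) (U V W : normedModType R) (f : U -> V)
    (g : {linear V -> W}) (x v : U) (df : V) :
  continuous g -> is_derive x v f df -> is_derive x v (fun y => g (f y)) (g df).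
Proof.
move=> cg hf; have dg : differentiable g (f x) by exact: linear_differentiable.
have := is_derive_comp hf dg.
by rewrite deriveE// diff_lin.
Qed.

Lemma is_derive_mx (R : realType) (V : normedModType R) (m n : nat)
    (M : V -> 'M[R]_(m, n)) (x v : V) (dM : 'M[R]_(m, n)) :
  (forall i j, is_derive x v (fun y => M y i j) (dM i j)) <->
  is_derive x v M dM.
Proof.
split=> [h|[d e] i j].
  have d : derivable M x v by apply/derivable_mxP => i j; case: (h i j).
  split=> //; rewrite derive_mx//; apply/matrixP => i j; rewrite mxE.
  by case: (h i j).
split; first by move/derivable_mxP : d.
by rewrite -e derive_mx// mxE.
Qed.

Lemma is_derive_sum_fin (R : realType) (V W : normedModType R) (I : finType)
    (f : I -> V -> W) (x v : V) (df : I -> W) :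
  (forall i, is_derive x v (f i) (df i)) ->
  is_derive x v (fun y => \sum_i f i y) (\sum_i df i).
Proof.
move=> h.
have : is_derive x v (\sum_(k < #|I|) f (enum_val k)) (\sum_(k < #|I|) df (enum_val k)).
  by apply: is_derive_sum => k.
rewrite -!(big_enum_val _ (A := I)) => hh.
rewrite (_ : (fun y => _) = \sum_(i in I) f i)//.
by apply/funext => y; rewrite fct_sumE.
Qed.

Lemma is_derive_mulmx (R : realType) (V : normedModType R) (m n p : nat)
    (A : V -> 'M[R]_(m, n)) (B : V -> 'M[R]_(n, p)) (x v : V) dA dB :
  is_derive x v A dA -> is_derive x v B dB ->
  is_derive x v (fun y => A y *m B y) (dA *m B x + A x *m dB).
Proof.
move=> /is_derive_mx hA /is_derive_mx hB; apply/is_derive_mx => i j.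
rewrite !mxE -big_split/=.
have -> : (fun y => (A y *m B y) i j) = (fun y => \sum_k A y i k * B y k j).
  by apply/funext => y; rewrite mxE.
apply: is_derive_sum_fin => k.
have := is_deriveM (hA i k) (hB k j).
move/is_derive_eq; apply.
by rewrite addrC; congr (_ + _); exact: mulrC.
Qed.

Lemma is_derive_trmx (R : realType) (V : normedModType R) (m n : nat)
    (A : V -> 'M[R]_(m, n)) (x v : V) dA :
  is_derive x v A dA -> is_derive x v (fun y => (A y)^T) (dA^T).
Proof.
move=> /is_derive_mx hA; apply/is_derive_mx => i j; rewrite mxE.
by rewrite (_ : (fun y => _) = fun y => A y j i)//; apply/funext => y; rewrite mxE.
Qed.

Lemma is_derive_bform (R : realType) (V : normedModType R) (n : nat)
    (G : V -> 'M[R]_n) (a b : V -> 'rV[R]_n) (x v : V) dG da db :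
  is_derive x v G dG -> is_derive x v a da -> is_derive x v b db ->
  is_derive x v (fun y => bform (G y) (a y) (b y))
    (bform dG (a x) (b x) + bform (G x) da (b x) + bform (G x) (a x) db).
Proof.
move=> hG ha hb.
have /is_derive_mx/(_ 0 0) := is_derive_mulmx (is_derive_mulmx ha hG) (is_derive_trmx hb).
move/is_derive_eq; apply.
by rewrite /bform !mulmxDl !mxE; congr (_ + _); rewrite addrC.
Qed.

Lemma deriveDv (R : realType) (V W : normedModType R) (f : V -> W) (x u v : V) :
  differentiable f x -> 'D_(u + v) f x = 'D_u f x + 'D_v f x.
Proof. by move=> d; rewrite !deriveE// linearD. Qed.

Lemma deriveZv (R : realType) (V W : normedModType R) (f : V -> W) (x u : V) (a : R) :
  differentiable f x -> 'D_(a *: u) f x = a *: 'D_u f x.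
Proof. by move=> d; rewrite !deriveE// linearZ. Qed.

Lemma differentiable_mx (R : realType) (V : normedModType R) (m n : nat)
    (M : V -> 'M[R]_(m, n)) (x : V) :
  (forall i j, differentiable (fun y => M y i j) x) -> differentiable M x.
Proof.
move=> h.
have -> : M = fun y => \sum_(ij : 'I_m * 'I_n) (M y ij.1 ij.2) *: delta_mx ij.1 ij.2.
  apply/funext => y; rewrite {1}[M y]matrix_sum_delta pair_big/=.
  by [].
have : differentiable (\sum_(k < #|{: 'I_m * 'I_n}|)
  (fun y => M y (enum_val k).1 (enum_val k).2 *: (delta_mx (enum_val k).1 (enum_val k).2 : 'M[R]_(m,n)))) x.
  apply: differentiable_sum => k; apply: differentiableZl; exact: h.
rewrite (_ : (\sum_(k < _) _) = (fun y => \sum_(ij : 'I_m * 'I_n) (M y ij.1 ij.2) *: delta_mx ij.1 ij.2))//.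
apply/funext => y; rewrite fct_sumE.
rewrite [RHS](eq_bigl (fun k => k \in [set: 'I_m * 'I_n]%SET)); last by move=> k; rewrite inE.
rewrite (eq_bigl (mem {: 'I_m * 'I_n}))/=; last by move=> k; rewrite !inE.
by rewrite [RHS]big_enum_val.
Qed.

Lemma differentiable_entry (R : realType) (V : normedModType R) (m n : nat)
    (M : V -> 'M[R]_(m, n)) (x : V) i j :
  differentiable M x -> differentiable (fun y => M y i j) x.
Proof. by move=> d; apply: (differentiable_comp d (differentiable_coord _ _ _)). Qed.

Lemma is_derive_along (R : realType) (V W : normedModType R) (f : V -> W)
    (x v : V) (s : R) (df : W) :
  is_derive (x + s *: v) v f df ->
  is_derive s 1 (fun t : R => f (x + t *: v)) df.
Proof.
move=> /is_derive_line h; apply/is_derive_line.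
rewrite (_ : (fun _ => _) = (fun h : R => f (h *: v + (x + s *: v))))//.
apply/funext => t; congr f; rewrite scalerDl addrCA; congr (_ + _).
by rewrite [t *: 1]mulr1.
Qed.

Lemma mvt_open (R : realType) (f df : R -> R) (a b : R) : a < b ->
  (forall x, a <= x <= b -> is_derive x 1 f (df x)) ->
  exists2 c, a < c < b & f b - f a = df c * (b - a).
Proof.
move=> ab h.
have [||c] := @MVT _ f df a b ab.
- by move=> x; rewrite in_itv/= => /andP[/ltW a1 /ltW a2]; apply: h; rewrite a1.
- apply: derivable_within_continuous => x; rewrite in_itv/= => /h [] //.
by rewrite in_itv/= => hc e; exists c.
Qed.

(** The mean value theorem is applied twice: along [u] to the increment of [f] under the shift by
    [h *: v], then along [v] to [fu]. *)
Lemma second_difference (R : realType) (V : normedModType R) (f fu fuv : V -> R)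
    (x u v : V) (h : R) : 0 < h ->
  (forall s t : R, 0 <= s <= h -> 0 <= t <= h ->
    is_derive (x + s *: u + t *: v) u f (fu (x + s *: u + t *: v)) /\
    is_derive (x + s *: u + t *: v) v fu (fuv (x + s *: u + t *: v))) ->
  exists s t : R, [/\ 0 < s < h, 0 < t < h &
    f (x + h *: u + h *: v) - f (x + h *: u) - (f (x + h *: v) - f x) =
    fuv (x + s *: u + t *: v) * h ^+ 2].
Proof.
move=> h0 d.
have hh : 0 <= h <= h by rewrite (ltW h0) lexx.
have h00 : 0 <= (0:R) <= h by rewrite (ltW h0) lexx.
pose g (s : R) := f (x + h *: v + s *: u) - f (x + s *: u).
have [|s /andP[s0 s1] es] := @mvt_open R g
    (fun s => fu (x + h *: v + s *: u) - fu (x + s *: u)) 0 h h0.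
  move=> s hs; apply: is_deriveB; apply: is_derive_along.
    by have [] := d s h hs hh; rewrite addrAC.
  by have [] := d s 0 hs h00; rewrite scale0r addr0.
have hs : 0 <= s <= h by rewrite !ltW.
have [|t /andP[t0 t1] et] := @mvt_open R (fun t => fu (x + s *: u + t *: v))
    (fun t => fuv (x + s *: u + t *: v)) 0 h h0.
  by move=> t ht; apply: (is_derive_along (f := fu)); case: (d s t hs ht).
exists s, t; split; [by rewrite s0|by rewrite t0|].
move: es et; rewrite /g !scale0r !addr0 !subr0 => es et.
rewrite (addrAC x) -(addrAC x (s *: u)) in es.
by rewrite es et expr2 mulrA.
Qed.

(** The second difference of [second_difference] is symmetric in [u] and [v], so [fuv] and [fvu]
    take equal values at two points arbitrarily close to [x]; continuity at [x] concludes. *)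
Lemma schwarz (R : realType) (V : normedModType R) (f fu fv fuv fvu : V -> R)
    (x u v : V) :
  (\forall y \near x, [/\ is_derive y u f (fu y), is_derive y v f (fv y),
     is_derive y v fu (fuv y) & is_derive y u fv (fvu y)]) ->
  {for x, continuous fuv} -> {for x, continuous fvu} -> fuv x = fvu x.
Proof.
move=> dn c1 c2.
apply/eqP; rewrite -subr_eq0 -normr_le0; apply/ler_addgt0Pl => e e0; rewrite addr0.
have e2 : 0 < e / 2 by rewrite divr_gt0.
have h1 : \forall t \near x, `|fuv x - fuv t| < e / 2 by exact: (cvgrPdist_lt _ _).1 c1 _ e2.
have h2 : \forall t \near x, `|fvu x - fvu t| < e / 2 by exact: (cvgrPdist_lt _ _).1 c2 _ e2.
have [r /= r0 hr] : nbhs_ball x (fun y => [/\ is_derive y u f (fu y), is_derive y v f (fv y),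
     is_derive y v fu (fuv y) & is_derive y u fv (fvu y)] /\
     (`|fuv x - fuv y| < e / 2 /\ `|fvu x - fvu y| < e / 2)).
  by apply/nbhs_ballP; do 2?[apply: filterI => //].
(* Small enough for the parallelogram spanned by [h *: u] and [h *: v] to stay in the ball of radius
   [r]; the summand 1 covers the case of zero vectors. *)
pose h := r / (2 * (`|u| + `|v| + 1)).
have p0 : 0 < `|u| + `|v| + 1 by rewrite ltr_wpDl// addr_ge0.
have h0 : 0 < h by rewrite divr_gt0// mulr_gt0.
have inb (s t : R) : 0 <= s <= h -> 0 <= t <= h -> ball x r (x + s *: u + t *: v).
  move=> /andP[s0 s1] /andP[t0 t1]; rewrite -ball_normE /= opprD opprD !addrA subrr sub0r.
  rewrite -opprD normrN (le_lt_trans (ler_normD _ _))// !normrZ !ger0_norm//.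
  have : s * `|u| + t * `|v| <= h * (`|u| + `|v| + 1).
    by rewrite !mulrDr mulr1 ler_wpDr ?(ltW h0)// lerD// ler_wpM2r.
  move=> /le_lt_trans; apply.
  by rewrite /h invfM mulrA divfK ?gt_eqF// ltr_pdivrMr// ltr_pMr// ltr1n.
have [|s [t [/andP[/ltW s0 /ltW s1] /andP[/ltW t0 /ltW t1] E1]]] := @second_difference R V f fu fuv x u v h h0.
  by move=> s t hs ht; have /hr [[]] := inb s t hs ht.
have [|s' [t' [/andP[/ltW s0' /ltW s1'] /andP[/ltW t0' /ltW t1'] E2]]] := @second_difference R V f fv fvu x v u h h0.
  by move=> s' t' hs ht; have := inb t' s' ht hs; rewrite addrAC => /hr [[]].
have E : fuv (x + s *: u + t *: v) = fvu (x + s' *: v + t' *: u).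
  apply: (mulIf (_ : h ^+ 2 != 0)); first by rewrite expf_neq0// gt_eqF.
  by rewrite -E1 -E2 (addrAC x (h *: v)); ring.
have b1 : ball x r (x + s *: u + t *: v) by apply: inb; rewrite ?s0 ?t0.
have b2 : ball x r (x + s' *: v + t' *: u) by rewrite addrAC; apply: inb; rewrite ?s0' ?t0'.
have [_ [q1 _]] := hr _ b1; have [_ [_ q2]] := hr _ b2.
rewrite -(subrKA (fuv (x + s *: u + t *: v))) {2}E.
rewrite (le_trans (ler_normD _ _))// (splitr e) lerD// ltW//.
by rewrite distrC.
Qed.

Lemma smooth_on_differentiable (R : realType) (n : nat) (V : normedModType R)
    (U : set 'rV[R]_n) (f : 'rV[R]_n -> V) x :
  smooth_on U f -> U x -> differentiable f x.
Proof. by move=> h Ux; exact: (h [::] x Ux). Qed.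

Lemma smooth_on_derive (R : realType) (n : nat) (V : normedModType R)
    (U : set 'rV[R]_n) (f : 'rV[R]_n -> V) v :
  smooth_on U f -> smooth_on U ('D_v f).
Proof.
(* The last entry of the list is the innermost derivative, hence [rcons]. *)
by move=> h s x Ux; have := h (rcons s v) x Ux; rewrite foldr_rcons.
Qed.

Lemma smooth_on_is_derive (R : realType) (n : nat) (V : normedModType R)
    (U : set 'rV[R]_n) (f : 'rV[R]_n -> V) v x :
  smooth_on U f -> U x -> is_derive x v f ('D_v f x).
Proof.
move=> h Ux; apply: derivableP; apply: diff_derivable.
exact: smooth_on_differentiable h Ux.
Qed.

Lemma derive_comm (R : realType) (n m p : nat) (U : set 'rV[R]_n)
    (f : 'rV[R]_n -> 'M[R]_(m, p)) (x u v : 'rV[R]_n) :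
  open U -> smooth_on U f -> U x -> 'D_u ('D_v f) x = 'D_v ('D_u f) x.
Proof.
move=> oU sf Ux; apply/matrixP => i j.
have sD w := @smooth_on_derive _ _ _ _ _ w sf.
have cD a b : {for x, continuous (fun y => 'D_a ('D_b f) y i j)}.
  apply: differentiable_continuous; apply: differentiable_entry.
  exact: smooth_on_differentiable (smooth_on_derive _ (sD b)) Ux.
apply: (@schwarz R _ (fun y => f y i j) (fun y => 'D_v f y i j)
  (fun y => 'D_u f y i j) (fun y => 'D_u ('D_v f) y i j)
  (fun y => 'D_v ('D_u f) y i j) x v u) => //.
apply: filterS (open_nbhs_nbhs (conj oU Ux)) => y Uy.
split; apply: (is_derive_mx _ _ _ _).2; exact: smooth_on_is_derive Uy.
Qed.

(** * Riemannian geometry in a chart *)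

Lemma near_eq_differentiable (R : realType) (V W : normedModType R)
    (f g : V -> W) (x : V) :
  (\forall y \near x, f y = g y) -> differentiable f x -> differentiable g x.
Proof.
move=> fg df.
have fgx : f x = g x by apply: nbhs_singleton fg.
have cdf : continuous ('d f x) by apply: diff_continuous.
have E : g \o shift x = cst (g x) + 'd f x +o_ (0 : V) id.
  apply/eqaddoP => e e0.
  have /diff_locallyP [_ /eqaddoP/(_ e e0)] := df.
  apply: filter_app; near=> h; rewrite -fgx.
  suff -> : (f \o shift x - (cst (f x) + 'd f x)) h =
            (g \o shift x - (cst (f x) + 'd f x)) h by [].
  rewrite -!/(_ - _) /=; congr (_ - _).
  by near: h; move: fg; rewrite (near_shift 0 x) subr0.
by apply/diff_locallyP; rewrite (diff_unique cdf E).
Unshelve. all: by end_near. Qed.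

Lemma differentiable_sum_fin (R : realType) (V W : normedModType R) (I : Type)
    (r : seq I) (P : pred I) (f : I -> V -> W) (x : V) :
  (forall i, P i -> differentiable (f i) x) ->
  differentiable (fun y => \sum_(i <- r | P i) f i y) x.
Proof.
move=> h.
have -> : (fun y => \sum_(i <- r | P i) f i y) = \sum_(i <- r | P i) f i.
  by apply/funext => y; rewrite fct_sumE.
elim/big_ind : _ => [|a b da db|i Pi]; last exact: h.
  exact: (@differentiable_cst _ V W 0 x).
exact: differentiableD.
Qed.

Lemma differentiable_prod (R : realType) (V : normedModType R) (I : Type)
    (r : seq I) (P : pred I) (f : I -> V -> R) (x : V) :
  (forall i, P i -> differentiable (f i) x) ->
  differentiable (fun y => \prod_(i <- r | P i) f i y) x.
Proof.
move=> h.
have -> : (fun y => \prod_(i <- r | P i) f i y) = \prod_(i <- r | P i) f i.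
  by apply/funext => y; rewrite fct_prodE.
elim/big_ind : _ => [|a b da db|i Pi]; last exact: h.
  exact: (@differentiable_cst _ V R 1 x).
exact: differentiableM.
Qed.

Lemma differentiable_mulmx (R : realType) (V : normedModType R) (m n p : nat)
    (A : V -> 'M[R]_(m, n)) (B : V -> 'M[R]_(n, p)) (x : V) :
  differentiable A x -> differentiable B x ->
  differentiable (fun y => A y *m B y) x.
Proof.
move=> dA dB; apply: differentiable_mx => i j.
have -> : (fun y => (A y *m B y) i j) = (fun y => \sum_k A y i k * B y k j).
  by apply/funext => y; rewrite mxE.
apply: differentiable_sum_fin => k _.
by apply: differentiableM; exact: differentiable_entry.
Qed.

Lemma differentiable_det (R : realType) (V : normedModType R) (n : nat)
    (A : V -> 'M[R]_n) (x : V) :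
  (forall i j, differentiable (fun y => A y i j) x) ->
  differentiable (fun y => \det (A y)) x.
Proof.
move=> dA; apply: differentiable_sum_fin => s _.
apply: differentiableM; first exact: differentiable_cst.
by apply: differentiable_prod => i _.
Qed.

(** By Cramer's formula the entries of the inverse are quotients of polynomials in the entries of
    [A]. *)
Lemma differentiable_invmx (R : realType) (V : normedModType R) (n : nat)
    (A : V -> 'M[R]_n) (x : V) :
  (\forall y \near x, A y \in unitmx) -> differentiable A x ->
  differentiable (fun y => invmx (A y)) x.
Proof.
move=> uA dA.
have dAij i j : differentiable (fun y => A y i j) x by exact: differentiable_entry.
apply: (@near_eq_differentiable _ _ _ (fun y => (\det (A y))^-1 *: \adj (A y))).
  by near=> y; rewrite /invmx ifT//; near: y.
apply: differentiable_mx => i j.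
have -> : (fun y => ((\det (A y))^-1 *: \adj (A y)) i j) =
          (fun y => (\det (A y))^-1 * ((-1) ^+ (j + i) * \det (row' j (col' i (A y))))).
  by apply/funext => y; rewrite !mxE.
apply: differentiableM.
  apply: differentiableV; first exact: differentiable_det.
  by rewrite -unitfE -unitmxE; apply: nbhs_singleton uA.
apply: differentiableM; first exact: differentiable_cst.
apply: differentiable_det => k l.
rewrite (_ : (fun y => _) = (fun y => A y (lift j k) (lift i l)))//.
by apply/funext => y; rewrite !mxE.
Unshelve. all: by end_near. Qed.

(* An opaque copy of [bform]: comparing two of its instances up to conversion
   would unfold matrix products, which diverges in practice. *)
Fact inner_sig (R : realType) (n : nat) : {f | f = @bform R n}.
Proof. by exists (@bform R n). Qed.
Definition inner (R : realType) (n : nat) : 'M[R]_n -> 'rV[R]_n -> 'rV[R]_n -> R :=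
  sval (inner_sig R n).
Lemma innerE (R : realType) (n : nat) : @inner R n = @bform R n.
Proof. exact: svalP (inner_sig R n). Qed.

Section inner_theory.
Variables (R : realType) (n : nat).
Implicit Types (A B : 'M[R]_n) (u v w z : 'rV[R]_n) (a : R).

Lemma inner_def A v w : inner A v w = (v *m A *m w^T) 0 0.
Proof. by rewrite innerE. Qed.
Lemma innerDl A u v w : inner A (u + v) w = inner A u w + inner A v w.
Proof. by rewrite !inner_def !mulmxDl mxE. Qed.
Lemma innerDr A u v w : inner A w (u + v) = inner A w u + inner A w v.
Proof. by rewrite !inner_def linearD mulmxDr mxE. Qed.
Lemma innerZl A a u w : inner A (a *: u) w = a * inner A u w.
Proof. by rewrite !inner_def -!scalemxAl mxE. Qed.
Lemma innerZr A a u w : inner A w (a *: u) = a * inner A w u.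
Proof. by rewrite !inner_def linearZ -scalemxAr mxE. Qed.
Lemma innerNl A u w : inner A (- u) w = - inner A u w.
Proof. by rewrite -scaleN1r innerZl mulN1r. Qed.
Lemma innerNr A u w : inner A w (- u) = - inner A w u.
Proof. by rewrite -scaleN1r innerZr mulN1r. Qed.
Lemma innerBl A u v w : inner A (u - v) w = inner A u w - inner A v w.
Proof. by rewrite innerDl innerNl. Qed.
Lemma innerBr A u v w : inner A w (u - v) = inner A w u - inner A w v.
Proof. by rewrite innerDr innerNr. Qed.
Lemma inner0l A w : inner A 0 w = 0.
Proof. by rewrite inner_def !mul0mx mxE. Qed.
Lemma inner0r A w : inner A w 0 = 0.
Proof. by rewrite inner_def trmx0 mulmx0 mxE. Qed.
Lemma innerDm A B v w : inner (A + B) v w = inner A v w + inner B v w.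
Proof. by rewrite !inner_def mulmxDr mulmxDl mxE. Qed.
Lemma innerZm A a v w : inner (a *: A) v w = a * inner A v w.
Proof. by rewrite !inner_def -scalemxAr -scalemxAl mxE. Qed.
Lemma inner_sym A v w : A^T = A -> inner A v w = inner A w v.
Proof.
move=> sA; rewrite !inner_def.
have -> : (v *m A *m w^T) 0 0 = ((v *m A *m w^T)^T) 0 0 by rewrite [RHS]mxE.
by rewrite !trmx_mul trmxK sA mulmxA.
Qed.
Lemma inner_sumr A v (I : Type) (r : seq I) (P : pred I) (f : I -> 'rV[R]_n) :
  inner A v (\sum_(i <- r | P i) f i) = \sum_(i <- r | P i) inner A v (f i).
Proof.
elim/big_rec2 : _ => [|i a b _ <-]; first by rewrite inner0r.
by rewrite innerDr.
Qed.
Lemma inner_delta A v w : inner A v w = \sum_k w 0 k * inner A v (delta_mx 0 k).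
Proof.
rewrite {1}(row_sum_delta w) inner_sumr; apply: eq_bigr => k _.
by rewrite innerZr.
Qed.
Lemma is_derive_inner_mx (V : normedModType R) (G : V -> 'M[R]_n) (a b : V -> 'rV[R]_n)
    (x v : V) dG da db :
  is_derive x v G dG -> is_derive x v a da -> is_derive x v b db ->
  is_derive x v (fun y => inner (G y) (a y) (b y))
    (inner dG (a x) (b x) + inner (G x) da (b x) + inner (G x) (a x) db).
Proof. by rewrite innerE; exact: is_derive_bform. Qed.
Lemma differentiable_inner (V : normedModType R) (G : V -> 'M[R]_n)
    (a b : V -> 'rV[R]_n) (x : V) :
  differentiable G x -> differentiable a x -> differentiable b x ->
  differentiable (fun y => inner (G y) (a y) (b y)) x.
Proof.
move=> dG da db; rewrite innerE; apply: differentiable_entry.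
apply: differentiable_mulmx; first exact: differentiable_mulmx.
apply: differentiable_mx => i j.
rewrite (_ : (fun y => _) = (fun y => b y j i)); first exact: differentiable_entry.
by apply/funext => y; rewrite mxE.
Qed.
End inner_theory.

Section posdef.
Variables (R : realType) (n : nat) (A : 'M[R]_n).
Hypothesis pA : forall v : 'rV[R]_n, v != 0 -> 0 < inner A v v.

Lemma posdef_ge0 v : 0 <= inner A v v.
Proof. by have [->|/pA/ltW//] := eqVneq v 0; rewrite inner0l. Qed.

Lemma posdef_eq0 v : inner A v v = 0 -> v = 0.
Proof. by have [//|/pA h e] := eqVneq v 0; rewrite e ltxx in h. Qed.

Lemma posdef_unit : A \in unitmx.
Proof.
rewrite unitmxE unitfE; apply/det0P => -[v /pA v0 vA].
by move: v0; rewrite inner_def vA mul0mx mxE ltxx.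
Qed.

Lemma posdef_inj a b : (forall z, inner A a z = inner A b z) -> a = b.
Proof.
move=> h; apply/eqP; rewrite -subr_eq0; apply/eqP/posdef_eq0.
by rewrite innerBl h subrr.
Qed.
End posdef.

(* Algebra of the Levi-Civita connection at a point: [D v] stands for the
   derivative of the metric along [v], and [c] for the Christoffel symbols. *)
Section levi_civita.
Variables (R : realType) (n : nat) (A : 'M[R]_n) (D : 'rV[R]_n -> 'M[R]_n).
Variable (c : 'rV[R]_n -> 'rV[R]_n -> 'rV[R]_n).
Hypothesis symA : A^T = A.
Hypothesis posA : forall v : 'rV[R]_n, v != 0 -> 0 < inner A v v.
Hypothesis symD : forall v, (D v)^T = D v.
Hypothesis DD : forall v w, D (v + w) = D v + D w.
Hypothesis DZ : forall a v, D (a *: v) = a *: D v.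
Hypothesis koszul : forall v w z, inner A (c v w) z =
  2^-1 * (inner (D v) w z + inner (D w) v z - inner (D z) v w).
Implicit Types (u v w z : 'rV[R]_n).

Lemma lcC v w : c v w = c w v.
Proof.
apply: (posdef_inj posA) => z; rewrite !koszul (inner_sym v w (symD z)).
by congr (_ * (_ - _)); exact: addrC.
Qed.

Lemma lcDr v w z : c v (w + z) = c v w + c v z.
Proof.
apply: (posdef_inj posA) => y; rewrite innerDl !koszul.
by rewrite DD innerDm innerDl innerDr; ring.
Qed.

Lemma lcZr a v w : c v (a *: w) = a *: c v w.
Proof.
apply: (posdef_inj posA) => y; rewrite innerZl !koszul.
by rewrite DZ innerZm innerZl innerZr; ring.
Qed.

Lemma lcDl v w z : c (w + z) v = c w v + c z v.
Proof. by rewrite lcC lcDr !(lcC v). Qed.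

Lemma lcZl a v w : c (a *: w) v = a *: c w v.
Proof. by rewrite lcC lcZr lcC. Qed.

Lemma lc_delta v w : c v w =
  \sum_(ij : 'I_n * 'I_n) (v 0 ij.1 * w 0 ij.2) *:
     c (delta_mx 0 ij.1) (delta_mx 0 ij.2).
Proof.
have c0 y : c y 0 = 0 by have := lcZr 0 y 0; rewrite !scale0r.
have chsr y z : c y z = \sum_j z 0 j *: c y (delta_mx 0 j).
  rewrite {1}(row_sum_delta z); elim/big_rec2 : _ => [|j a b _ <-]; first exact: c0.
  by rewrite lcDr lcZr.
rewrite chsr -(pair_bigA _ (fun i j => (v 0 i * w 0 j) *:
     c (delta_mx 0 i) (delta_mx 0 j)))/= exchange_big/=.
apply: eq_bigr => j _; rewrite lcC chsr scaler_sumr; apply: eq_bigr => i _.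
by rewrite scalerA mulrC lcC.
Qed.

Lemma lc_compat u v w : inner (D u) v w = inner A (c u v) w + inner A v (c u w).
Proof.
rewrite (inner_sym v _ symA) !koszul (inner_sym v w (symD _)).
by rewrite (inner_sym u w (symD _)) (inner_sym u v (symD _)); field.
Qed.
End levi_civita.


(** This and the later lemmas named [_terms] isolate the algebra of a geometric step over plain
    variables, so that [lra] and [ring] never meet derivatives or Christoffel symbols. *)
Lemma transpose_terms (R : realType) (a b c d a' d' : R) :
  a + b + (c + d) = a' + c + (b + d') -> a - a' = - (d - d').
Proof. by move=> ?; lra. Qed.

Lemma cancel_curvature_terms (R : realType) (n : nat)
    (S A1 A2 B C1 C2 D1 D2 : 'rV[R]_n) :
  S + (A1 + B + C2) + (C1 + D1) - (S + (A2 + B + C1) + (C2 + D2)) =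
  A1 - A2 + D1 - D2.
Proof. by apply/rowP => i; rewrite !mxE; ring. Qed.

(** [christoffel] prescribes pairings with basis vectors only; linearity carries Koszul's formula to
    every [z]. *)
Lemma koszul_vector (R : realType) (n : nat) (D : 'rV[R]_n -> 'M[R]_n) (v w z : 'rV[R]_n) :
  (forall v w, D (v + w) = D v + D w) -> (forall a v, D (a *: v) = a *: D v) ->
  ((\row_k (2^-1 * (inner (D v) w (delta_mx 0 k) + inner (D w) v (delta_mx 0 k)
     - inner (D (delta_mx 0 k)) v w))) *m z^T) 0 0 =
  2^-1 * (inner (D v) w z + inner (D w) v z - inner (D z) v w).
Proof.
move=> DD DZ.
have D0 : D 0 = 0 by have := DZ 0 0; rewrite !scale0r.
rewrite mxE (inner_delta _ w z) (inner_delta _ v z).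
have -> : inner (D z) v w = \sum_k z 0 k * inner (D (delta_mx 0 k)) v w.
  rewrite {1}(row_sum_delta z); elim/big_rec2 : _ => [|j a b _ <-].
    by rewrite D0 inner_def mulmx0 mul0mx mxE.
  by rewrite DD DZ innerDm innerZm.
rewrite -big_split -sumrB mulr_sumr /=; apply: eq_bigr => k _; rewrite !mxE.
by ring.
Qed.

(** An opaque copy of [christoffel], for the same reason as [inner]. *)
Fact Gamma_sig (R : realType) (n : nat) : {f | f = @christoffel R n}.
Proof. by exists (@christoffel R n). Qed.
Definition Gamma (R : realType) (n : nat) :
    ('rV[R]_n -> 'M[R]_n) -> 'rV[R]_n -> 'rV[R]_n -> 'rV[R]_n -> 'rV[R]_n :=
  sval (Gamma_sig R n).
Lemma GammaE (R : realType) (n : nat) : @Gamma R n = @christoffel R n.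
Proof. exact: svalP (Gamma_sig R n). Qed.

(** * Levi-Civita connection and curvature of a metric in a chart *)

Section chart_metric.
Variables (R : realType) (n : nat) (G : 'rV[R]_n -> 'M[R]_n) (U : set 'rV[R]_n).
Hypothesis oU : open U.
Hypothesis sG : smooth_on U G.
Hypothesis symG : forall x, U x -> (G x)^T = G x.
Hypothesis posG : forall x, U x -> forall v, v != 0 -> 0 < inner (G x) v v.
Implicit Types (x u v w z : 'rV[R]_n).

Let nU x : U x -> \forall y \near x, U y.
Proof. by move=> Ux; apply: open_nbhs_nbhs. Qed.

Lemma metric_is_derive x v : U x -> is_derive x v G ('D_v G x).
Proof. by move=> Ux; apply: smooth_on_is_derive sG Ux. Qed.

Lemma is_derive_metric x u v w : U x ->
  is_derive x u (fun y => inner (G y) v w) (inner ('D_u G x) v w).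
Proof.
move=> Ux.
have := is_derive_inner_mx (metric_is_derive u Ux) (is_derive_cst v x u) (is_derive_cst w x u).
by rewrite inner0l inner0r !addr0.
Qed.

Lemma derive_metric_sym x u : U x -> ('D_u G x)^T = 'D_u G x.
Proof.
move=> Ux.
have [_ <-] := is_derive_trmx (metric_is_derive u Ux).
by apply: near_eq_derive; near=> y; apply: symG; near: y; exact: nU.
Unshelve. all: by end_near. Qed.

Lemma derive_metricD x u v : U x -> 'D_(u + v) G x = 'D_u G x + 'D_v G x.
Proof. by move=> Ux; apply: deriveDv; apply: smooth_on_differentiable sG Ux. Qed.

Lemma derive_metricZ x a u : U x -> 'D_(a *: u) G x = a *: 'D_u G x.
Proof. by move=> Ux; apply: deriveZv; apply: smooth_on_differentiable sG Ux. Qed.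


Lemma GammaK x v w : U x -> Gamma G x v w =
  (\row_k (2^-1 * (inner ('D_v G x) w (delta_mx 0 k)
     + inner ('D_w G x) v (delta_mx 0 k)
     - inner ('D_(delta_mx 0 k) G x) v w))) *m invmx (G x).
Proof.
move=> Ux; rewrite GammaE /christoffel; congr (_ *m _); apply/rowP => k; rewrite !mxE.
rewrite -innerE.
have [_ ->] := is_derive_metric v w (delta_mx 0 k) Ux.
have [_ ->] := is_derive_metric w v (delta_mx 0 k) Ux.
by have [_ ->] := is_derive_metric (delta_mx 0 k) v w Ux.
Qed.

Lemma koszul x v w z : U x -> inner (G x) (Gamma G x v w) z =
  2^-1 * (inner ('D_v G x) w z + inner ('D_w G x) v z - inner ('D_z G x) v w).
Proof.
move=> Ux; rewrite GammaK// {1}inner_def mulmxKV; last exact: posdef_unit (posG Ux).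
by apply: (koszul_vector (D := fun v => 'D_v G x)) => *;
  [exact: derive_metricD|exact: derive_metricZ].
Qed.

Section at_point.
Variable x : 'rV[R]_n.
Hypothesis Ux : U x.
Let lc (P : Prop) (h : forall (D : 'rV[R]_n -> 'M[R]_n), (forall v, (D v)^T = D v) ->
  (forall v w, D (v + w) = D v + D w) -> (forall a v, D (a *: v) = a *: D v) ->
  (forall v w z, inner (G x) (Gamma G x v w) z =
     2^-1 * (inner (D v) w z + inner (D w) v z - inner (D z) v w)) -> P) : P.
Proof.
apply: (h (fun v => 'D_v G x)) => *.
- exact: derive_metric_sym.
- exact: derive_metricD.
- exact: derive_metricZ.
- exact: koszul.
Qed.

Lemma GammaC v w : Gamma G x v w = Gamma G x w v.
Proof. by apply: lc => D sD DD DZ k; exact: (lcC (posG Ux) sD k). Qed.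
Lemma GammaDr v w z : Gamma G x v (w + z) = Gamma G x v w + Gamma G x v z.
Proof. by apply: lc => D sD DD DZ k; exact: (lcDr (posG Ux) DD k). Qed.
Lemma GammaZr a v w : Gamma G x v (a *: w) = a *: Gamma G x v w.
Proof. by apply: lc => D sD DD DZ k; exact: (lcZr (posG Ux) DZ k). Qed.
Lemma GammaDl v w z : Gamma G x (w + z) v = Gamma G x w v + Gamma G x z v.
Proof. by apply: lc => D sD DD DZ k; exact: (lcDl (posG Ux) sD DD k). Qed.
Lemma GammaZl a v w : Gamma G x (a *: w) v = a *: Gamma G x w v.
Proof. by apply: lc => D sD DD DZ k; exact: (lcZl (posG Ux) sD DZ k). Qed.
Lemma Gamma_delta v w : Gamma G x v w =
  \sum_(ij : 'I_n * 'I_n) (v 0 ij.1 * w 0 ij.2) *: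
     Gamma G x (delta_mx 0 ij.1) (delta_mx 0 ij.2).
Proof. by apply: lc => D sD DD DZ k; exact: (lc_delta (posG Ux) sD DD DZ k). Qed.
Lemma Gamma_compat u v w : inner ('D_u G x) v w =
  inner (G x) (Gamma G x u v) w + inner (G x) v (Gamma G x u w).
Proof.
by apply: (lc_compat (D := fun v => 'D_v G x) (symG Ux)) => *;
  [exact: derive_metric_sym | exact: koszul].
Qed.
End at_point.

Lemma differentiable_Gamma x v w : U x -> differentiable (fun y => Gamma G y v w) x.
Proof.
move=> Ux.
apply: (@near_eq_differentiable _ _ _ (fun y => (\row_k (2^-1 *
     (inner ('D_v G y) w (delta_mx 0 k) + inner ('D_w G y) v (delta_mx 0 k)
     - inner ('D_(delta_mx 0 k) G y) v w))) *m invmx (G y))).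
  by near=> y; rewrite GammaK//; near: y; exact: nU.
have db u a b : differentiable (fun y => inner ('D_u G y) a b) x.
  apply: differentiable_inner; [|exact: differentiable_cst|exact: differentiable_cst].
  exact: smooth_on_differentiable (smooth_on_derive _ sG) Ux.
apply: differentiable_mulmx.
  apply: differentiable_mx => i k.
  rewrite (_ : (fun y => _) = (fun y => 2^-1 *
     (inner ('D_v G y) w (delta_mx 0 k) + inner ('D_w G y) v (delta_mx 0 k)
     - inner ('D_(delta_mx 0 k) G y) v w))); last by apply/funext => y; rewrite mxE.
  apply: differentiableM; first exact: differentiable_cst.
  by apply: differentiableB => //; exact: differentiableD.
apply: differentiable_invmx; last exact: smooth_on_differentiable sG Ux.
near=> y; apply: posdef_unit; apply: posG; near: y; exact: nU.
Unshelve. all: by end_near. Qed.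



Lemma derive_Gamma_delta x d v w : U x ->
  'D_d (fun y => Gamma G y v w) x = \sum_(ij : 'I_n * 'I_n) (v 0 ij.1 * w 0 ij.2) *:
     'D_d (fun y => Gamma G y (delta_mx 0 ij.1) (delta_mx 0 ij.2)) x.
Proof.
move=> Ux; apply: derive_val.
apply: (near_eq_is_derive (f := fun y => \sum_(ij : 'I_n * 'I_n)
   (v 0 ij.1 * w 0 ij.2) *: Gamma G y (delta_mx 0 ij.1) (delta_mx 0 ij.2))).
  by near=> y; rewrite [RHS]Gamma_delta//; near: y; exact: nU.
apply: is_derive_sum_fin => ij; apply: is_deriveZ.
by apply: derivableP; apply: diff_derivable; exact: differentiable_Gamma.
Unshelve. all: by end_near. Qed.

Lemma is_derive_scaler_fun (V : normedModType R) (f : V -> R) m k (Y : V -> 'M[R]_(m, k)) p a df dY :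
  is_derive p a f df -> is_derive p a Y dY ->
  is_derive p a (fun q => f q *: Y q) (df *: Y p + f p *: dY).
Proof.
move=> hf hY; have hY' := (is_derive_mx _ _ _ _).2 hY.
apply/is_derive_mx => i j; rewrite !mxE.
rewrite (_ : (fun y => _) = (fun q => f q * Y q i j)); last by apply/funext => y; rewrite mxE.
have /is_derive_eq := is_deriveM hf (hY' i j); apply.
by rewrite addrC; congr (_ + _); exact: mulrC.
Qed.

Section along.
Variables (V : normedModType R) (F : V -> 'rV[R]_n).
Implicit Types (Y Z : V -> 'rV[R]_n) (p a b : V).

(** The connection pulled back by [F]: [Y] is a vector field along the map [F], not on its
    target. *)
Definition cov_der a Y p := 'D_a Y p + Gamma G (F p) ('D_a F p) (Y p).

Lemma cov_der_def a Y p :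
  cov_der a Y p = 'D_a Y p + Gamma G (F p) ('D_a F p) (Y p).
Proof. by []. Qed.

Lemma is_derive_inner p a Y Z :
  U (F p) -> derivable F p a -> derivable Y p a -> derivable Z p a ->
  is_derive p a (fun q => inner (G (F q)) (Y q) (Z q))
    (inner (G (F p)) (cov_der a Y p) (Z p) + inner (G (F p)) (Y p) (cov_der a Z p)).
Proof.
move=> UF /derivableP dF /derivableP dY /derivableP dZ.
have dG := is_derive_comp dF (smooth_on_differentiable sG UF).
have /is_derive_eq := is_derive_inner_mx dG dY dZ; apply.
by rewrite Gamma_compat// /cov_der innerDl innerDr; ring.
Qed.

Lemma cov_der_ext a Y Z p : (\forall q \near p, Y q = Z q) ->
  cov_der a Y p = cov_der a Z p.
Proof.
by move=> h; rewrite /cov_der (near_eq_derive _ h) (nbhs_singleton h).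
Qed.


(** Expanding [Y] and [Z] in the basis separates the motion of the base point, seen by [Gamma] with
    fixed arguments, from the motion of the arguments. *)
Lemma is_derive_Gamma p a Y Z :
  (\forall q \near p, U (F q)) -> derivable F p a -> derivable Y p a -> derivable Z p a ->
  is_derive p a (fun q => Gamma G (F q) (Y q) (Z q))
    ('D_('D_a F p) (fun x => Gamma G x (Y p) (Z p)) (F p)
     + Gamma G (F p) ('D_a Y p) (Z p) + Gamma G (F p) (Y p) ('D_a Z p)).
Proof.
move=> nUF dF dY dZ; have UF := nbhs_singleton nUF.
have hY := (is_derive_mx _ _ _ _).2 (derivableP dY).
have hZ := (is_derive_mx _ _ _ _).2 (derivableP dZ).
pose E ij x : 'rV[R]_n := Gamma G x (delta_mx 0 ij.1) (delta_mx 0 ij.2).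
apply: (near_eq_is_derive (f := fun q => \sum_(ij : 'I_n * 'I_n)
   (Y q 0 ij.1 * Z q 0 ij.2) *: E ij (F q))).
  by near=> q; rewrite [RHS]Gamma_delta//; near: q.
have /is_derive_eq : is_derive p a (fun q => \sum_(ij : 'I_n * 'I_n)
   (Y q 0 ij.1 * Z q 0 ij.2) *: E ij (F q)) (\sum_(ij : 'I_n * 'I_n)
   ((Y p 0 ij.1 * 'D_a Z p 0 ij.2 + Z p 0 ij.2 * 'D_a Y p 0 ij.1) *: E ij (F p)
   + (Y p 0 ij.1 * Z p 0 ij.2) *: 'D_('D_a F p) (E ij) (F p))).
  apply: is_derive_sum_fin => ij; apply: is_derive_scaler_fun.
    exact: is_deriveM.
  apply: is_derive_comp; first exact: derivableP.
  exact: differentiable_Gamma.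
apply; rewrite big_split /= -derive_Gamma_delta// addrC -addrA; congr (_ + _).
rewrite (Gamma_delta UF ('D_a Y p)) (Gamma_delta UF (Y p)) -big_split.
apply: eq_bigr => ij _ /=; rewrite -scalerDl /E; congr (_ *: _).
by rewrite addrC mulrC.
Unshelve. all: by end_near. Qed.

Lemma cov_der_torsion a b p : U (F p) -> 'D_a ('D_b F) p = 'D_b ('D_a F) p ->
  cov_der a ('D_b F) p = cov_der b ('D_a F) p.
Proof. by move=> UF e; rewrite !cov_der_def e (GammaC UF ('D_a F p) ('D_b F p)). Qed.

Lemma derivable_cov_der a b Y p :
  (\forall q \near p, U (F q)) -> derivable F p a -> derivable Y p a ->
  derivable ('D_b F) p a -> derivable ('D_b Y) p a -> derivable (cov_der b Y) p a.
Proof.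
move=> nUF dF dY dbF dbY.
have [dG _] := is_derive_Gamma nUF dF dbF dY.
exact: (derivableD dbY dG).
Qed.

(** The second derivatives of [F] and [Y] cancel by the two commutation hypotheses, and the terms of
    first order in [Y] cancel in pairs. *)
Lemma cov_der_curvature a b Y p :
  (\forall q \near p, U (F q)) ->
  (forall c, derivable F p c) -> (forall c, derivable Y p c) ->
  (forall c d, derivable ('D_c F) p d) -> (forall c d, derivable ('D_c Y) p d) ->
  'D_a ('D_b F) p = 'D_b ('D_a F) p -> 'D_a ('D_b Y) p = 'D_b ('D_a Y) p ->
  cov_der a (cov_der b Y) p - cov_der b (cov_der a Y) p =
  curvature G (F p) ('D_a F p) ('D_b F p) (Y p).
Proof.
move=> nUF dF dY ddF ddY eF eY; have UF := nbhs_singleton nUF.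
have E c d : cov_der c (cov_der d Y) p =
  'D_c ('D_d Y) p + ('D_('D_c F p) (fun x => Gamma G x ('D_d F p) (Y p)) (F p)
     + Gamma G (F p) ('D_c ('D_d F) p) (Y p) + Gamma G (F p) ('D_d F p) ('D_c Y p))
  + (Gamma G (F p) ('D_c F p) ('D_d Y p) +
     Gamma G (F p) ('D_c F p) (Gamma G (F p) ('D_d F p) (Y p))).
  have hG := is_derive_Gamma nUF (dF c) (ddF d c) (dY c).
  have [_ DE] : is_derive p c (cov_der d Y) _ := is_deriveD (derivableP (ddY d c)) hG.
  rewrite (cov_der_def c (cov_der d Y)) DE (cov_der_def d Y p).
  by rewrite (GammaDr UF ('D_c F p) ('D_d Y p) (Gamma G (F p) ('D_d F p) (Y p))).
rewrite (E a b) (E b a) eF eY /curvature -GammaE.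
exact: cancel_curvature_terms.
Qed.

End along.

(** For constant fields [w] and [z] along the identity map, the second derivatives of
    [inner (G y) w z] along [u] and [v] commute. Expanding both orders by metric compatibility
    leaves exactly the two curvature terms. *)
Lemma curvature_antisym x u v w z : U x ->
  inner (G x) (curvature G x u v w) z = - inner (G x) w (curvature G x u v z).
Proof.
move=> Ux.
have di : forall c, derivable (id : 'rV[R]_n -> 'rV[R]_n) x c by move=> c; exact: derivable_id.
have Did c : 'D_c (id : 'rV[R]_n -> 'rV[R]_n) = cst c by apply/funext => y; exact: derive_id.
have Dcst (a c : 'rV[R]_n) : 'D_c (cst a : 'rV[R]_n -> 'rV[R]_n) = cst 0.
  by apply/funext => y; exact: derive_cst.
have ddid c d : derivable ('D_c (id : 'rV[R]_n -> 'rV[R]_n)) x d.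
  by rewrite Did; exact: derivable_cst.
have ddcst a c d : derivable ('D_c (cst a : 'rV[R]_n -> 'rV[R]_n)) x d.
  by rewrite Dcst; exact: derivable_cst.
have Eid c d : 'D_c ('D_d (id : 'rV[R]_n -> 'rV[R]_n)) x = 'D_d ('D_c id) x.
  by rewrite !Did !derive_cst.
have Ecst a c d : 'D_c ('D_d (cst a : 'rV[R]_n -> 'rV[R]_n)) x = 'D_d ('D_c (cst a)) x.
  by rewrite !Dcst !derive_cst.
have K a : curvature G x u v a = cov_der id u (cov_der id v (cst a)) x
    - cov_der id v (cov_der id u (cst a)) x.
  have := @cov_der_curvature _ id u v (cst a) x (nU Ux) di (fun c => derivable_cst a x c)
    ddid (ddcst a) (Eid u v) (Ecst a u v).
  by rewrite !derive_id => ->.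
have dcov a c d : derivable (cov_der id c (cst a)) x d.
  exact: (@derivable_cov_der _ id d c (cst a) x (nU Ux) (di d) (derivable_cst a x d) (ddid c d) (ddcst a c d)).
pose P c y := inner (G y) (cov_der id c (cst w) y) z + inner (G y) w (cov_der id c (cst z) y).
have DP c d : is_derive x d (P c)
   (inner (G x) (cov_der id d (cov_der id c (cst w)) x) z
    + inner (G x) (cov_der id c (cst w) x) (cov_der id d (cst z) x)
    + (inner (G x) (cov_der id d (cst w) x) (cov_der id c (cst z) x)
    + inner (G x) w (cov_der id d (cov_der id c (cst z)) x))).
  apply: is_deriveD.
    by apply: (@is_derive_inner _ id x d (cov_der id c (cst w)) (cst z)).
  by apply: (@is_derive_inner _ id x d (cst w) (cov_der id c (cst z))).
have E c d : 'D_d (P c) x = inner ('D_d ('D_c G) x) w z.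
  transitivity ('D_d (fun y => inner ('D_c G y) w z) x).
    apply: near_eq_derive; near=> y; have Uy : U y by near: y; exact: nU.
    rewrite Gamma_compat// /P /cov_der !derive_cst !add0r.
    by rewrite !derive_id.
  have [_ ->] := is_derive_inner_mx
    (smooth_on_is_derive d (smooth_on_derive c sG) Ux) (is_derive_cst w x d) (is_derive_cst z x d).
  by rewrite inner0l inner0r !addr0.
have e := congr1 (fun M => inner M w z) (derive_comm u v oU sG Ux).
have {}e : 'D_u (P v) x = 'D_v (P u) x := etrans (E v u) (etrans e (esym (E u v))).
have [_ d1] := DP v u; have [_ d2] := DP u v.
have {d1 d2}e := etrans (esym d1) (etrans e d2).
rewrite (K w) (K z) innerBl innerBr.
exact: transpose_terms e.
Unshelve. all: by end_near. Qed.
End chart_metric.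

(** * Comparison geometry around a pole *)

Lemma is_derive_ext_unique (R : realType) (V W : normedModType R) (f h : V -> W)
    (x v : V) (a b : W) :
  is_derive x v f a -> is_derive x v h b -> f =1 h -> a = b.
Proof. by move=> [_ <-] [_ <-] /funext ->. Qed.

Lemma is_derive_mul (R : realType) (V : normedModType R) (f h : V -> R) (x v : V) (a b : R) :
  is_derive x v f a -> is_derive x v h b ->
  is_derive x v (fun y => f y * h y) (a * h x + f x * b).
Proof.
move=> hf hh; have /is_derive_eq := is_deriveM hf hh; apply.
by rewrite addrC; congr (_ + _); exact: mulrC.
Qed.

(** The tool for polarising at a moving base point: an expression quadratic in the vector [u + s w],
    evaluated at the point [u + s w], has this shape, and its derivative at [s = 0] combines the
    motion of the point with twice the mixed term. *)
Lemma is_derive_quadratic (R : realType) (A B C : R -> R) (a b c : R) :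
  is_derive (0 : R) 1 A a -> is_derive (0 : R) 1 B b -> is_derive (0 : R) 1 C c ->
  is_derive (0 : R) 1 (fun s => A s + (2 * s) * B s + (s * s) * C s) (a + 2 * B 0).
Proof.
move=> hA hB hC.
have hi : is_derive (0 : R) 1 (id : R -> R) 1 by exact: is_derive_id.
have h2 := is_deriveM (is_deriveM (is_derive_cst (2 : R) (0 : R) 1) hi) hB.
have h3 := is_deriveM (is_deriveM hi hi) hC.
have /is_derive_eq := is_deriveD (is_deriveD hA h2) h3; apply.
by rewrite /= !fctE /cst /GRing.scale /=; ring.
Qed.

Lemma is_derive_quadratic_mx (R : realType) m n (A B C : R -> 'M[R]_(m, n)) a b c :
  is_derive (0 : R) 1 A a -> is_derive (0 : R) 1 B b -> is_derive (0 : R) 1 C c ->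
  is_derive (0 : R) 1 (fun s => A s + (2 * s) *: B s + (s * s) *: C s) (a + 2 *: B 0).
Proof.
move=> /is_derive_mx hA /is_derive_mx hB /is_derive_mx hC.
apply/is_derive_mx => i j; rewrite !mxE.
rewrite (_ : (fun s : R => _) = (fun s => A s i j + (2 * s) * B s i j + (s * s) * C s i j)).
  exact: (is_derive_quadratic (hA i j) (hB i j) (hC i j)).
by apply/funext => s; rewrite !mxE.
Qed.

Lemma is_derive_along_ray (R : realType) (V W : normedModType R) (h : V -> W)
    (v : V) (t : R) (d : W) :
  is_derive (t *: v) v h d -> is_derive t 1 (fun s : R => h (s *: v)) d.
Proof.
rewrite -[t *: v]add0r => /is_derive_along.
by under [X in is_derive _ _ X]eq_fun do rewrite add0r.
Qed.

Lemma expand_terms (R : realType) (n : nat) (s : R) (X P Q P' Q' A B B' C : 'rV[R]_n) :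
  X = s *: P + Q -> P = P' -> Q = Q' -> P' = s *: C + B -> Q' = s *: B' + A ->
  B' = B -> X = A + (2 * s) *: B + (s * s) *: C.
Proof.
by move=> -> -> -> -> -> ->; apply/rowP => i; rewrite !mxE; ring.
Qed.

(** Supplies the linear independence that [radial_curvature_le] asks for. *)
Lemma orthogonal_row_free (R : realType) (n : nat) (A : 'M[R]_n) (X Y : 'rV[R]_n) :
  inner A X X != 0 -> inner A Y Y != 0 -> inner A X Y = 0 -> inner A Y X = 0 ->
  row_free (col_mx X Y).
Proof.
move=> X0 Y0 XY YX; apply: inj_row_free => c; rewrite -[c]hsubmxK mul_row_col.
rewrite (mx11_scalar (lsubmx c)) (mx11_scalar (rsubmx c)) !mul_scalar_mx.
move: (lsubmx c 0 0) (rsubmx c 0 0) => a b e.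
have := congr1 (fun z => inner A z Y) e; have := congr1 (fun z => inner A z X) e.
rewrite !innerDl !innerZl XY YX !inner0l !mulr0 addr0 add0r => /eqP.
rewrite mulf_eq0 (negbTE X0) orbF => /eqP -> /eqP.
by rewrite mulf_eq0 (negbTE Y0) orbF => /eqP ->; rewrite !raddf0 row_mx0.
Qed.

Lemma sectional_curvature_le (R : realType) (n : nat) (G : 'rV[R]_n -> 'M[R]_n)
    (x u w : 'rV[R]_n) (K : R) :
  0 < inner (G x) u u -> 0 < inner (G x) w w -> inner (G x) u w = 0 ->
  sectional_curvature G x u w <= K ->
  inner (G x) (curvature G x u w w) u <= K * (inner (G x) u u * inner (G x) w w).
Proof.
move=> u0 w0 uw; rewrite /sectional_curvature -innerE uw expr0n subr0.
by rewrite ler_pdivrMr// mulr_gt0.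
Qed.

(** With Y = D_w exp_q, J = c Y at time [c] and Y' its covariant derivative along the ray: a =
    |Y|^2, b = <Y', Y>, d = |Y'|^2, e = <Y'', Y>, and [rr] is the curvature term. The hypotheses are
    the Jacobi equation, the curvature bound and |J' - k J|^2 >= 0. The conclusion is the sign of
    the derivative of (|J|^2)' - 2 k |J|^2, which equals 2 |J' - k J|^2 + 2 c^2 (rr - k^2 a). *)
Lemma comparison_terms (R : realType) (a b c d e k rr : R) :
  c * e = - 2 * b + c * rr -> k ^+ 2 * a <= rr ->
  0 <= (1 - k * c) ^+ 2 * a + 2 * (1 - k * c) * c * b + c ^+ 2 * d ->
  0 <= 2 * (a + c * (2 * b)) + ((c + c) * (2 * b) + c * c * (2 * (e + d)))
       - 2 * k * ((c + c) * a + c * c * (2 * b)).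
Proof.
move=> ce hr hq.
rewrite [leRHS](_ : _ = 2 * ((1 - k * c) ^+ 2 * a + 2 * (1 - k * c) * c * b + c ^+ 2 * d)
  + 2 * c ^+ 2 * (rr - k ^+ 2 * a) + 2 * c * (c * e - (- 2 * b + c * rr))); last by ring.
by rewrite ce subrr mulr0 addr0 addr_ge0// mulr_ge0// ?subr_ge0// mulr_ge0// sqr_ge0.
Qed.

Lemma jacobi_terms (R : realType) (n : nat) (A : 'M[R]_n) (c : R) (X C K Z Y : 'rV[R]_n) :
  c *: X = (- 2) *: C -> Z - X = K ->
  c * inner A Z Y = - 2 * inner A C Y + c * inner A K Y.
Proof.
move=> h <-; rewrite -(innerZl A (- 2)) -h innerZl innerBl.
by ring.
Qed.

Lemma hessian_terms (R : realType) (n : nat) (A : 'M[R]_n) (k : R) (Y C D : 'rV[R]_n) :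
  2 * k * inner A Y Y <= 2 * inner A Y Y + 2 * inner A D Y -> D = C ->
  k * inner A Y Y <= inner A (Y + C) Y.
Proof. by move=> h <-; rewrite innerDl; lra. Qed.

Lemma radial_terms (R : realType) (a b b' k r y : R) :
  a = - b -> b = b' -> b' <= - k * (r * y) -> k * r * y <= a.
Proof. by move=> -> ->; rewrite lerNr mulNr mulrA. Qed.

Lemma inner_square_expand (R : realType) (n : nat) (A : 'M[R]_n) (X Y : 'rV[R]_n) (a c : R) :
  A^T = A -> inner A (a *: Y + c *: X) (a *: Y + c *: X) =
  a ^+ 2 * inner A Y Y + 2 * a * c * inner A X Y + c ^+ 2 * inner A X X.
Proof.
by move=> sA; rewrite !innerDl !innerDr !innerZl !innerZr (inner_sym Y X sA); ring.
Qed.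

Section pole_geometry.
Variables (R : realType) (n : nat) (N : riemannian R n) (q : N).
Variables (E : 'rV[R]_n -> N) (L : N -> 'rV[R]_n).
Hypothesis hN : is_riemannian N.
Hypothesis hE : @is_exp R n N q E.
Hypothesis smE : @smooth_map R n n (euclidean R n) N E.
Hypothesis smL : @smooth_map R n n N (euclidean R n) L.
Hypothesis EK : cancel E L.
Hypothesis LK : cancel L E.
Implicit Types (u v w x : 'rV[R]_n) (t s : R) (i j : Defs.index N).

Definition pole_dom j : set 'rV[R]_n := E @^-1` dom j.
Definition pole_chart j : 'rV[R]_n -> 'rV[R]_n := chart j \o E.
Local Notation W := pole_dom.
Local Notation F := pole_chart.
Local Notation U := (@codom_chart R n N).
Local Notation g := (@gram R n N).

Lemma open_codom j : open (U j).
Proof. by have [[_ _ _ /(_ j)[]]] := hN. Qed.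
Lemma open_dom j : open (dom j).
Proof. by have [[_ _ _ /(_ j)[]]] := hN. Qed.
Lemma smooth_gram j : smooth_on (U j) (g j).
Proof. by have [_ h _ _ _] := hN; exact: h. Qed.
Lemma gram_sym j x : U j x -> (g j x)^T = g j x.
Proof. by have [_ _ h _ _] := hN; exact: h. Qed.
Lemma gram_pos j x : U j x -> forall v, v != 0 -> 0 < inner (g j x) v v.
Proof. by have [_ _ _ h _] := hN; rewrite innerE; exact: h. Qed.

Lemma open_pole_dom j : open (W j).
Proof. by apply: open_comp (open_dom j) => x _; exact: smE.1. Qed.

Lemma near_pole_dom j x : W j x -> \forall y \near x, W j y.
Proof. by move=> Wx; apply: open_nbhs_nbhs; split=> //; exact: open_pole_dom. Qed.

Lemma pole_chart_codom j x : W j x -> U j (F j x).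
Proof. by move=> Wx; exists (E x). Qed.

Lemma near_pole_chart_codom j x : W j x -> \forall y \near x, U j (F j y).
Proof. by move=> /near_pole_dom; apply: filterS => y; exact: pole_chart_codom. Qed.

Lemma smooth_pole_chart j : smooth_on (W j) (F j).
Proof.
have := smE.2 tt j; rewrite (_ : (_ @` _) = W j)//.
by rewrite setTI image_id.
Qed.

Lemma dom_chart_at (p : N) : dom (chart_at p) p.
Proof. by have [[_ _ h _ _] _ _ _ _] := hN; exact: h. Qed.

Lemma paramK j p : dom j p -> param j (chart j p) = p.
Proof. by have [[_ _ _ /(_ j)[_ _ h _ _] _] _ _ _ _] := hN; exact: h. Qed.

Lemma smooth_log j : smooth_on (U j) (L \o param j).
Proof.
have := smL.2 j tt; rewrite (_ : (_ @` _) = U j)//.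
by rewrite preimage_setT setIT.
Qed.

Lemma smooth_transition i j :
  smooth_on (chart i @` (dom i `&` dom j)) (chart j \o param i).
Proof. by have [[_ _ _ _ h] _ _ _ _] := hN; exact: h. Qed.

(** Since [L] inverts [E], the composite of [L \o param j] with [F j] is the identity near [x]; its
    derivative along [w] is [w]. *)
Lemma pole_chart_inj j x w : W j x -> 'D_w (F j) x = 0 -> w = 0.
Proof.
move=> Wx Dw.
have dF := smooth_on_is_derive w (@smooth_pole_chart j) Wx.
have dL := smooth_on_differentiable (@smooth_log j) (pole_chart_codom Wx).
have [_] := is_derive_comp dF dL; rewrite Dw derive0 => e.
rewrite -[LHS](derive_id x w) -[RHS]e; apply: near_eq_derive.
by near=> y; rewrite /= /pole_chart /= paramK ?EK//; near: y; exact: near_pole_dom.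
Unshelve. all: by end_near. Qed.

Definition pole_metric_at j x v w : R :=
  inner (g j (F j x)) ('D_v (F j) x) ('D_w (F j) x).

Lemma pole_metric_chart i j x v w : W i x -> W j x ->
  pole_metric_at i x v w = pole_metric_at j x v w.
Proof.
move=> Wi Wj.
have dtau : differentiable (chart j \o param i) (F i x).
  by apply: smooth_on_differentiable (@smooth_transition i j) _; exists (E x).
have Dj a : 'D_a (F j) x = 'D_('D_a (F i) x) (chart j \o param i) (F i x).
  have [_ <-] := is_derive_comp (smooth_on_is_derive a (@smooth_pole_chart i) Wi) dtau.
  apply: near_eq_derive; near=> y.
  by rewrite /= /pole_chart /= paramK//; near: y; exact: near_pole_dom.
rewrite /pole_metric_at !Dj innerE; have [_ _ _ _ h] := hN.
exact: (h i j (E x) Wi Wj).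
Unshelve. all: by end_near. Qed.

(** The metric of N pulled back by exp_q to R^n. The preferred chart only selects a representative,
    by [pole_metric_chart]. *)
Definition pole_metric x v w : R := pole_metric_at (chart_at (E x)) x v w.
Local Notation G := pole_metric.

Lemma pole_metricE j x v w : W j x -> G x v w = pole_metric_at j x v w.
Proof. by move=> Wj; apply: pole_metric_chart => //; exact: dom_chart_at. Qed.

Lemma pole_dom_at x : W (chart_at (E x)) x.
Proof. exact: dom_chart_at. Qed.

Lemma pole_chartD j x v w : W j x -> 'D_(v + w) (F j) x = 'D_v (F j) x + 'D_w (F j) x.
Proof. by move=> Wx; apply: deriveDv; exact: smooth_on_differentiable (@smooth_pole_chart j) Wx. Qed.
Lemma pole_chartZ j x a v : W j x -> 'D_(a *: v) (F j) x = a *: 'D_v (F j) x.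
Proof. by move=> Wx; apply: deriveZv; exact: smooth_on_differentiable (@smooth_pole_chart j) Wx. Qed.

Lemma pole_metricC x v w : G x v w = G x w v.
Proof.
apply: inner_sym; apply: gram_sym; apply: pole_chart_codom; exact: pole_dom_at.
Qed.
Lemma pole_metricDl x v w z : G x (v + w) z = G x v z + G x w z.
Proof. by rewrite /pole_metric /pole_metric_at (pole_chartD v w (pole_dom_at x)) innerDl. Qed.
Lemma pole_metricZl x a v z : G x (a *: v) z = a * G x v z.
Proof. by rewrite /pole_metric /pole_metric_at (pole_chartZ a v (pole_dom_at x)) innerZl. Qed.
Lemma pole_metricDr x v w z : G x z (v + w) = G x z v + G x z w.
Proof. by rewrite pole_metricC pole_metricDl !(pole_metricC x z). Qed.
Lemma pole_metricZr x a v z : G x z (a *: v) = a * G x z v.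
Proof. by rewrite pole_metricC pole_metricZl (pole_metricC x z). Qed.
Lemma pole_metric_pos x v : v != 0 -> 0 < G x v v.
Proof.
move=> v0; apply: gram_pos; first by apply: pole_chart_codom; exact: pole_dom_at.
by apply: contraNneq v0 => /(pole_chart_inj (pole_dom_at x)) ->.
Qed.

Local Notation cov j := (cov_der (g j) (F j)).
Local Notation inn j x := (inner (g j (F j x))).

Section in_chart.
Variables (j : Defs.index N).
Let sF := @smooth_pole_chart j.

Lemma pole_chart_derivable x v : W j x -> derivable (F j) x v.
Proof. by move=> Wx; have [] := smooth_on_is_derive v sF Wx. Qed.
Lemma pole_chart_derivable2 x v w : W j x -> derivable ('D_v (F j)) x w.
Proof. by move=> Wx; have [] := smooth_on_is_derive w (smooth_on_derive v sF) Wx. Qed.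
Lemma pole_chart_derivable3 x v w a : W j x -> derivable ('D_w ('D_v (F j))) x a.
Proof.
by move=> Wx; have [] := smooth_on_is_derive a (smooth_on_derive w (smooth_on_derive v sF)) Wx.
Qed.
Lemma pole_chart_comm x v w : W j x -> 'D_v ('D_w (F j)) x = 'D_w ('D_v (F j)) x.
Proof. exact: (derive_comm _ _ (@open_pole_dom j) sF). Qed.
Lemma pole_chart_comm3 x v w a : W j x ->
  'D_v ('D_w ('D_a (F j))) x = 'D_w ('D_v ('D_a (F j))) x.
Proof. exact: (derive_comm _ _ (@open_pole_dom j) (smooth_on_derive a sF)). Qed.

Lemma is_derive_pole_inner x a Y Z : W j x -> derivable Y x a -> derivable Z x a ->
  is_derive x a (fun y => inn j y (Y y) (Z y))
    (inn j x (cov j a Y x) (Z x) + inn j x (Y x) (cov j a Z x)).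
Proof.
move=> Wx dY dZ.
exact: (is_derive_inner (F := F j) (@open_codom j) (@smooth_gram j) (@gram_sym j) (@gram_pos j)
  (pole_chart_codom Wx) (pole_chart_derivable Wx) dY dZ).
Qed.

Lemma pole_cov_sym x v w : W j x -> cov j v ('D_w (F j)) x = cov j w ('D_v (F j)) x.
Proof.
move=> Wx; apply: (cov_der_torsion (@open_codom j) (@smooth_gram j) (@gram_sym j) (@gram_pos j)).
  exact: pole_chart_codom.
exact: pole_chart_comm.
Qed.

Lemma derivable_pole_cov x v w a : W j x -> derivable (cov j v ('D_w (F j))) x a.
Proof.
move=> Wx.
apply: (derivable_cov_der (@open_codom j) (@smooth_gram j) (@gram_sym j) (@gram_pos j)).
- exact: near_pole_chart_codom.
- exact: pole_chart_derivable.
- exact: pole_chart_derivable2.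
- exact: pole_chart_derivable2.
- exact: pole_chart_derivable3.
Qed.

Lemma pole_cov_curvature x a b v : W j x ->
  cov j a (cov j b ('D_v (F j))) x - cov j b (cov j a ('D_v (F j))) x =
  curvature (g j) (F j x) ('D_a (F j) x) ('D_b (F j) x) ('D_v (F j) x).
Proof.
move=> Wx.
apply: (cov_der_curvature (@open_codom j) (@smooth_gram j) (@gram_sym j) (@gram_pos j)).
- exact: near_pole_chart_codom.
- by move=> c; exact: pole_chart_derivable.
- by move=> c; exact: pole_chart_derivable2.
- by move=> c d; exact: pole_chart_derivable2.
- by move=> c d; exact: pole_chart_derivable3.
- exact: pole_chart_comm.
- exact: pole_chart_comm3.
Qed.

Lemma pole_covDl x v w a : W j x ->
  cov j (v + w) ('D_a (F j)) x = cov j v ('D_a (F j)) x + cov j w ('D_a (F j)) x.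
Proof.
move=> Wx; rewrite !cov_der_def (pole_chartD v w Wx).
rewrite (GammaDl (@open_codom j) (@smooth_gram j) (@gram_sym j) (@gram_pos j) (pole_chart_codom Wx)).
rewrite (deriveDv v w (smooth_on_differentiable (smooth_on_derive a sF) Wx)).
exact: addrACA.
Qed.
Lemma pole_covZl x c w a : W j x ->
  cov j (c *: w) ('D_a (F j)) x = c *: cov j w ('D_a (F j)) x.
Proof.
move=> Wx; rewrite !cov_der_def (pole_chartZ c w Wx).
rewrite (GammaZl (@open_codom j) (@smooth_gram j) (@gram_sym j) (@gram_pos j) (pole_chart_codom Wx)).
rewrite (deriveZv w c (smooth_on_differentiable (smooth_on_derive a sF) Wx)).
by rewrite scalerDr.
Qed.

End in_chart.

Lemma is_derive_pole_metric j x a v w : W j x ->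
  is_derive x a (fun y => G y v w)
    (inn j x (cov j a ('D_v (F j)) x) ('D_w (F j) x) +
     inn j x ('D_v (F j) x) (cov j a ('D_w (F j)) x)).
Proof.
move=> Wx; apply: (near_eq_is_derive (f := fun y => pole_metric_at j y v w)).
  by near=> y; rewrite (@pole_metricE j)//; near: y; exact: near_pole_dom.
exact: (is_derive_pole_inner Wx (pole_chart_derivable2 Wx) (pole_chart_derivable2 Wx)).
Unshelve. all: by end_near. Qed.

Lemma ray_velocity j v t : W j (t *: v) ->
  velocity j (fun t => E (t *: v)) t = 'D_v (F j) (t *: v).
Proof.
move=> Wt; rewrite /velocity derive1E; apply: derive_val.
exact: is_derive_along_ray (smooth_on_is_derive v (@smooth_pole_chart j) Wt).
Qed.

Lemma near_ray j v t : W j (t *: v) -> \forall s \near t, W j (s *: v).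
Proof.
move=> Wt.
have c : {for t, continuous (fun s : R => s *: v)} by exact: scalel_continuous.
exact: c (near_pole_dom Wt).
Qed.

(** The velocity of the ray is the field ['D_v (F j)] with the constant direction [v], so the
    geodesic equation becomes an equation for a field along [F j]. *)
Lemma ray_geodesic j v t : W j (t *: v) -> cov j v ('D_v (F j)) (t *: v) = 0.
Proof.
move=> Wt; have [[_ /(_ j t Wt) [_ _ <-]] _ _] := hE v.
suff e : derive1 (velocity j (fun t => E (t *: v))) t = 'D_v ('D_v (F j)) (t *: v).
  by rewrite e cov_der_def -GammaE (ray_velocity Wt).
have -> : derive1 (velocity j (fun t => E (t *: v))) t =
    derive1 (fun s : R => 'D_v (F j) (s *: v)) t.
  rewrite !derive1E; apply: near_eq_derive; near=> s; apply: ray_velocity.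
  by near: s; exact: near_ray.
rewrite derive1E; apply: derive_val.
exact: is_derive_along_ray (smooth_on_is_derive v (smooth_on_derive v (@smooth_pole_chart j)) Wt).
Unshelve. all: by end_near. Qed.

Lemma exp0 : E 0 = q.
Proof. by have [_ <- _] := hE 0; rewrite scaler0. Qed.

(** The initial velocities prescribed by [is_exp] say that the differential of exp_q at 0 is the
    identity in the preferred chart at [q]. *)
Lemma pole_metric0 v w : G 0 v w = inner (g (chart_at q) (chart (chart_at q) q)) v w.
Proof.
have W0 : W (chart_at q) 0 by rewrite /pole_dom /= exp0; exact: dom_chart_at.
have D a : 'D_a (F (chart_at q)) 0 = a.
  have [_ _ /[1!(@ray_velocity (chart_at q) a 0)]] := hE a; rewrite scale0r //.
rewrite (pole_metricE _ _ W0) /pole_metric_at !D.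
by rewrite /pole_chart /= exp0.
Qed.

Lemma ray_speed v t : G (t *: v) v v = G 0 v v.
Proof.
pose sp s := G (s *: v) v v.
have : sp t = sp 0.
  apply: is_derive_0_is_cst => s.
  have Ws := pole_dom_at (s *: v).
  have := is_derive_along_ray (is_derive_pole_metric v v v Ws).
  by rewrite ray_geodesic// inner0l inner0r addr0.
by rewrite /sp scale0r.
Qed.

Lemma pole_metric_radial x : G x x x = G 0 x x.
Proof. by have := ray_speed x 1; rewrite scale1r. Qed.

Lemma pole_metric_expand x u w s : G x (s *: w + u) (s *: w + u) =
  G x u u + (2 * s) * G x u w + (s * s) * G x w w.
Proof.
rewrite pole_metricDl !pole_metricDr !pole_metricZl !pole_metricZr (pole_metricC _ w u).
by move: (G x u u) (G x u w) (G x w w) => a b c; ring.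
Qed.

(* Polarisation of [ray_speed] in the base point. *)
Lemma derive_pole_metric_radial v w t : t != 0 ->
  t * 'D_w (fun y => G y v v) (t *: v) = 2 * (G 0 v w - G (t *: v) v w).
Proof.
move=> t0; set u := t *: v.
have Wu := pole_dom_at u.
have dG a b : is_derive (0 : R) 1 (fun s : R => G (s *: w + u) a b) ('D_w (fun y => G y a b) u).
  have [dG _] := is_derive_pole_metric w a b Wu.
  exact: (is_derive_line (fun y => G y a b) u w _).1 (derivableP dG).
have L1 := is_derive_quadratic (dG u u) (dG u w) (dG w w).
have L2 := is_derive_quadratic (is_derive_cst (G 0 u u) (0 : R) 1)
  (is_derive_cst (G 0 u w) (0 : R) 1) (is_derive_cst (G 0 w w) (0 : R) 1).
have e : 'D_w (fun y => G y u u) u + 2 * G (0 *: w + u) u w = 0 + 2 * G 0 u w.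
  apply: (is_derive_ext_unique L1 L2) => s.
  by rewrite -!pole_metric_expand pole_metric_radial.
have e2 : 'D_w (fun y => G y u u) u = (t * t) * 'D_w (fun y => G y v v) u.
  rewrite (_ : (fun y => G y u u) = (t * t) \*: (fun y => G y v v)).
    by have [dG0 _] := is_derive_pole_metric w v v Wu; rewrite (deriveZ _ dG0).
  by apply/funext => y; rewrite /u pole_metricZl pole_metricZr mulrA.
move: e; rewrite e2 scale0r !add0r /u !pole_metricZl -/u => e.
by apply: (mulfI t0); rewrite mulrA -[X in X = _](addrK (2 * (t * G u v w))) e; ring.
Qed.

(** By symmetry of the second covariant derivatives, the derivative of G(s v)(v, w) in s is half the
    derivative of G(y)(v, v) along [w]. With [derive_pole_metric_radial] this shows that s (G(s
    v)(v, w) - G(0)(v, w)) has zero derivative, hence vanishes as it does at s = 0. *)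
Lemma ray_gauss v w t : G (t *: v) v w * t = G 0 v w * t.
Proof.
apply/subr0_eq.
rewrite [RHS](_ : 0 = G (0 *: v) v w * 0 - G 0 v w * 0); last by rewrite !mulr0 subrr.
apply: (is_derive_0_is_cst (f := fun s : R => G (s *: v) v w * s - G 0 v w * s)) => s.
have Ws := pole_dom_at (s *: v); set j := chart_at _ in Ws.
have hi : is_derive s 1 (id : R -> R) 1 by exact: is_derive_id.
have h1 := is_derive_along_ray (is_derive_pole_metric v v w Ws).
rewrite (ray_geodesic Ws) inner0l add0r (pole_cov_sym _ _ Ws) in h1.
have hD := is_derive_mul h1 hi.
have h2 := is_derive_mul (is_derive_cst (G 0 v w) s 1) hi.
have /is_derive_eq := is_deriveB hD h2; apply.
have [_ e] := is_derive_pole_metric w v v Ws.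
have e2 : 2 * inn j (s *: v) ('D_v (F j) (s *: v)) (cov j w ('D_v (F j)) (s *: v)) =
   'D_w (fun y => G y v v) (s *: v).
  rewrite e (inner_sym (cov j w ('D_v (F j)) (s *: v))); first by rewrite mulr_natl mulr2n.
  by apply: gram_sym; exact: pole_chart_codom.
have [s0|s0] := eqVneq s 0.
  by rewrite s0 /= /cst scale0r !mulr0 !mulr1 !add0r subrr.
have := derive_pole_metric_radial v w s0; rewrite -e2 /= /cst.
move: (inn j _ _ _) (G (s *: v) v w) (G 0 v w) => a b d h.
have {h}-> : a * s = d - b.
  have n2 : (2 : R) != 0 by rewrite pnatr_eq0.
  by apply: (mulfI n2); rewrite -h; ring.
by ring.
Qed.

Lemma gauss x w : G x x w = G 0 x w.
Proof. by have := ray_gauss x w 1; rewrite scale1r !mulr1. Qed.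

Lemma ray_gauss_orthogonal v w t : 0 < t -> G 0 v w = 0 -> G (t *: v) v w = 0.
Proof.
by move=> t0 e; have /eqP := ray_gauss v w t; rewrite e mul0r mulf_eq0 (gt_eqF t0) orbF => /eqP.
Qed.


Lemma pole_cov_expand j x u w s : W j x ->
  cov j (s *: w + u) ('D_(s *: w + u) (F j)) x =
  cov j u ('D_u (F j)) x + (2 * s) *: cov j u ('D_w (F j)) x
  + (s * s) *: cov j w ('D_w (F j)) x.
Proof.
move=> Wx.
have ex a : cov j (s *: w + u) ('D_a (F j)) x =
    s *: cov j w ('D_a (F j)) x + cov j u ('D_a (F j)) x.
  by rewrite (pole_covDl (s *: w) u a Wx) (pole_covZl s w a Wx).
exact: (expand_terms (ex (s *: w + u)) (pole_cov_sym w (s *: w + u) Wx)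
  (pole_cov_sym u (s *: w + u) Wx) (ex w) (ex u) (pole_cov_sym w u Wx)).
Qed.

(* The first derivative in the direction [w] of the geodesic equation of the
   rays: the Jacobi equation for the variation field [t D_w E]. *)
Lemma pole_jacobi j v w t : t != 0 -> W j (t *: v) ->
  t *: cov j w (cov j v ('D_v (F j))) (t *: v) = (- 2) *: cov j v ('D_w (F j)) (t *: v).
Proof.
move=> t0 Wt; set u := t *: v.
have dS a b : is_derive (0 : R) 1 (fun s : R => cov j a ('D_b (F j)) (s *: w + u))
    ('D_w (cov j a ('D_b (F j))) u).
  exact: (is_derive_line (cov j a ('D_b (F j))) u w _).1 (derivableP (derivable_pole_cov Wt)).
have L1 := is_derive_quadratic_mx (dS u u) (dS u w) (dS w w).
have L0 : is_derive (0 : R) 1 (cst (0 : 'rV[R]_n)) 0 by exact: is_derive_cst.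
have nW : \forall s \near (0 : R), W j (s *: w + u).
  have c : {for (0 : R), continuous (fun s : R => s *: w + u)}.
    by apply: cvgD; [exact: scalel_continuous|exact: cvg_cst].
  by apply: c; rewrite scale0r add0r; exact: near_pole_dom.
(* The vector [s *: w + u] is the velocity at time 1 of the ray through itself, so the expanded
   expression is the zero function of [s] near 0. *)
have e : 'D_w (cov j u ('D_u (F j))) u + 2 *: cov j u ('D_w (F j)) (0 *: w + u) = 0.
  case: L1 => _ <-; case: L0 => _ <-; apply: near_eq_derive.
  near=> s; have Ws : W j (s *: w + u) by near: s.
  rewrite -(pole_cov_expand u w s Ws).
  by have := @ray_geodesic j (s *: w + u) 1; rewrite scale1r => /(_ Ws).
have Ew : cov j u ('D_w (F j)) (0 *: w + u) = t *: cov j v ('D_w (F j)) u.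
  by rewrite scale0r add0r {1}/u (pole_covZl t v w Wt).
have Eu : 'D_w (cov j u ('D_u (F j))) u = (t * t) *: cov j w (cov j v ('D_v (F j))) u.
  rewrite (cov_der_def _ _ w) (ray_geodesic Wt).
  have UF := pole_chart_codom Wt.
  have G0 a : Gamma (g j) (F j u) a 0 = 0.
    have := GammaZr (@open_codom j) (@smooth_gram j) (@gram_sym j) (@gram_pos j) UF 0 a 0.
    by rewrite !scale0r.
  rewrite G0 addr0.
  have dv := derivable_pole_cov (v := v) (w := v) (a := w) Wt.
  rewrite -(deriveZ (t * t) dv); apply: near_eq_derive; near=> y.
  have Wy : W j y by near: y; exact: near_pole_dom.
  rewrite {1}/u (pole_covZl t v u Wy) (pole_cov_sym v u Wy) {1}/u (pole_covZl t v v Wy).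
  exact: scalerA.
move: e; rewrite Ew Eu => e; apply: (scalerI t0).
rewrite !scalerA; move/eqP: e; rewrite addr_eq0 => /eqP ->.
by rewrite scalerA -scaleNr; congr (_ *: _); rewrite mulrN mulrC.
Unshelve. all: by end_near. Qed.

Variable kappa : R.
Hypothesis hcurv : radial_curvature_le q (- kappa ^+ 2).

(** The Gauss lemma keeps [w] orthogonal to the ray and [pole_chart_inj] keeps its image nonzero, so
    the plane is a genuine one to which the radial bound applies; [curvature_antisym] then exchanges
    the last two arguments. *)
Lemma ray_curvature j v w t : v != 0 -> w != 0 -> 0 < t -> G 0 v w = 0 ->
  W j (t *: v) ->
  kappa ^+ 2 * G 0 v v * inn j (t *: v) ('D_w (F j) (t *: v)) ('D_w (F j) (t *: v)) <=
  inn j (t *: v) (curvature (g j) (F j (t *: v)) ('D_v (F j) (t *: v))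
    ('D_w (F j) (t *: v)) ('D_v (F j) (t *: v))) ('D_w (F j) (t *: v)).
Proof.
move=> v0 w0 t0 vw Wt; set x := t *: v; set X := 'D_v _ _; set Y := 'D_w _ _.
have UF := pole_chart_codom Wt.
have XY : inn j x X Y = 0.
  by rewrite -[RHS](ray_gauss_orthogonal t0 vw) (pole_metricE _ _ Wt).
have XX : inn j x X X = G 0 v v by rewrite -(ray_speed v t) (pole_metricE _ _ Wt).
have YY : 0 < inn j x Y Y.
  by have := pole_metric_pos x w0; rewrite (pole_metricE _ _ Wt).
have X0 : 0 < inn j x X X by rewrite XX; exact: pole_metric_pos.
have YX : inn j x Y X = 0 by rewrite (inner_sym Y X (gram_sym UF)).
have gq : geodesic (fun t => E (t *: v)) by have [] := hE v.
have := hcurv gq; rewrite scale0r exp0 => /(_ erefl t j Wt Y).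
rewrite (ray_velocity Wt) -/X.
have free : row_free (col_mx X Y).
  exact: orthogonal_row_free (lt0r_neq0 X0) (lt0r_neq0 YY) XY YX.
move=> /(_ free) /(sectional_curvature_le X0 YY XY); rewrite XX.
move=> h.
exact: (radial_terms (curvature_antisym (@open_codom j) (@smooth_gram j) (@gram_sym j)
  (@gram_pos j) X Y X Y UF) (inner_sym X _ (gram_sym UF)) h).
Qed.

Lemma is_derive_pole_cov j x a v w : W j x ->
  is_derive x a (fun y => 2 * inn j y (cov j v ('D_w (F j)) y) ('D_w (F j) y))
    (2 * (inn j x (cov j a (cov j v ('D_w (F j))) x) ('D_w (F j) x) +
       inn j x (cov j v ('D_w (F j)) x) (cov j a ('D_w (F j)) x))).
Proof.
move=> Wx.
have h := is_derive_pole_inner Wx (derivable_pole_cov (v := v) (w := w) (a := a) Wx)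
  (pole_chart_derivable2 (v := w) (w := a) Wx).
have /is_derive_eq := is_derive_mul (is_derive_cst (2 : R) x a) h; apply.
by rewrite mul0r add0r.
Qed.

Lemma derive_pole_metric_diag j x v w : W j x ->
  'D_v (fun y => G y w w) x = 2 * inn j x (cov j v ('D_w (F j)) x) ('D_w (F j) x).
Proof.
move=> Wx; have [_ ->] := is_derive_pole_metric v w w Wx.
rewrite (inner_sym ('D_w (F j) x) _ (gram_sym (pole_chart_codom Wx))).
by rewrite mulr_natl mulr2n.
Qed.

(* Hessian comparison: with [J = t D_w E] and [k = kappa |v|], the function
   [z = (|J|^2)' - 2 k |J|^2] along the ray satisfies [z 0 = 0] and
   [z' >= 2 |J' - k J|^2 >= 0]. *)
Lemma hessian_comparison_metric v w (k : R) : v != 0 -> w != 0 -> G 0 v w = 0 ->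
  k ^+ 2 = kappa ^+ 2 * G 0 v v ->
  2 * k * G v w w <= 2 * G v w w + 'D_v (fun y => G y w w) v.
Proof.
move=> v0 w0 vw k2.
pose gd x := 'D_v (fun y => G y w w) x.
pose z t := 2 * (t * G (t *: v) w w) + t * t * gd (t *: v) - 2 * k * (t * t * G (t *: v) w w).
have hi t : is_derive t 1 (id : R -> R) 1 by exact: is_derive_id.
have hG t : is_derive t 1 (fun s : R => G (s *: v) w w) (gd (t *: v)).
  have Wt := pole_dom_at (t *: v); rewrite /gd (derive_pole_metric_diag _ _ Wt).
  have [d e] := is_derive_pole_metric v w w Wt.
  by rewrite -(derive_pole_metric_diag _ _ Wt); exact: is_derive_along_ray (derivableP d).
pose gdd x := let j := chart_at (E x) in
  2 * (inn j x (cov j v (cov j v ('D_w (F j))) x) ('D_w (F j) x) +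
       inn j x (cov j v ('D_w (F j)) x) (cov j v ('D_w (F j)) x)).
have hgd t : is_derive t 1 (fun s : R => gd (s *: v)) (gdd (t *: v)).
  apply: is_derive_along_ray; have Wt := pole_dom_at (t *: v).
  apply: near_eq_is_derive (is_derive_pole_cov v v w Wt).
  near=> y; rewrite /gd (@derive_pole_metric_diag (chart_at (E (t *: v))))//.
  by near: y; exact: near_pole_dom.
pose z' t := 2 * (G (t *: v) w w + t * gd (t *: v))
  + ((t + t) * gd (t *: v) + t * t * gdd (t *: v))
  - 2 * k * ((t + t) * G (t *: v) w w + t * t * gd (t *: v)).
have hz t : is_derive t 1 z (z' t).
  have tt := is_derive_mul (hi t) (hi t).
  have h1 := is_derive_mul (is_derive_cst (2 : R) t 1) (is_derive_mul (hi t) (hG t)).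
  have h2 := is_derive_mul tt (hgd t).
  have h3 := is_derive_mul (is_derive_cst (2 * k : R) t 1) (is_derive_mul tt (hG t)).
  have /is_derive_eq := is_deriveB (is_deriveD h1 h2) h3; apply.
  by rewrite /cst /z'; move: (gdd _) (gd _) (G _ w w) => a b c /=; ring.
(* As [z 0 = 0], the value [z 1] equals [z' c] at an interior [c]; being positive, [c] is a time at
   which [pole_jacobi] and [ray_curvature] apply. *)
have [c /andP[c0 c1]] := mvt_open ltr01 (fun t _ => hz t).
rewrite subr0 mulr1.
have -> : z 0 = 0 by rewrite /z !mul0r !mulr0 addr0 subr0.
rewrite subr0 {1}/z !scale1r !mul1r => zE.
suff : 0 <= z' c by rewrite -zE subr_ge0 /gd.
have Wc := pole_dom_at (c *: v); set j := chart_at _ in Wc.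
have gE : gd (c *: v) = _ := derive_pole_metric_diag v w Wc.
have GE := pole_metricE w w Wc.
rewrite /z' gE GE /gdd -/j.
have hr := ray_curvature v0 w0 c0 vw Wc; rewrite -k2 in hr.
apply: (comparison_terms _ hr).
  have K := pole_cov_curvature v w v Wc.
  have E1 : cov j v (cov j v ('D_w (F j))) (c *: v) = cov j v (cov j w ('D_v (F j))) (c *: v).
    apply: cov_der_ext; near=> y; apply: pole_cov_sym; near: y; exact: near_pole_dom.
  rewrite E1; exact: jacobi_terms (pole_jacobi w (lt0r_neq0 c0) Wc) K.
have := posdef_ge0 (gram_pos (pole_chart_codom Wc))
  ((1 - k * c) *: 'D_w (F j) (c *: v) + c *: cov j v ('D_w (F j)) (c *: v)).
rewrite (inner_square_expand _ _ _ _ (gram_sym (pole_chart_codom Wc))).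
by [].
Unshelve. all: by end_near. Qed.

(** The radial field x -> D_x F is the gradient of r^2 / 2, and its covariant derivative along [w]
    at [v] is the first argument on the right. This is the Hessian bound at the endpoint of the ray,
    where G(0)(v, v) = r^2. *)
Lemma hessian_comparison j v w (k : R) : v != 0 -> w != 0 -> G 0 v w = 0 ->
  k ^+ 2 = kappa ^+ 2 * G 0 v v -> W j v ->
  k * inn j v ('D_w (F j) v) ('D_w (F j) v) <=
  inn j v ('D_w (F j) v + cov j w ('D_v (F j)) v) ('D_w (F j) v).
Proof.
move=> v0 w0 vw k2 Wv.
have h := hessian_comparison_metric v0 w0 vw k2.
rewrite (derive_pole_metric_diag v w Wv) (pole_metricE _ _ Wv) /pole_metric_at in h.
exact: hessian_terms h (pole_cov_sym v w Wv).
Qed.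

End pole_geometry.

(** * Closed hypersurfaces of the product *)

Lemma derive_sum_delta (R : realType) (n : nat) (W : normedModType R)
    (h : 'rV[R]_n -> W) (x v : 'rV[R]_n) : differentiable h x ->
  'D_v h x = \sum_k v 0 k *: 'D_(delta_mx 0 k) h x.
Proof.
move=> dh; rewrite deriveE// {1}(row_sum_delta v) linear_sum; apply: eq_bigr => k _.
by rewrite linearZ deriveE.
Qed.

Lemma is_derive_along_shift (R : realType) (V W : normedModType R) (f : V -> W)
    (x v : V) (s : R) (df : W) :
  is_derive (s *: v + x) v f df -> is_derive s 1 (fun t : R => f (t *: v + x)) df.
Proof.
rewrite addrC => /is_derive_along.
by under [X in is_derive s 1 X df -> _]eq_fun do rewrite addrC.
Qed.

Lemma derive_lsubmx (R : realType) (n m : nat) (W : normedModType R)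
    (h : 'rV[R]_n -> W) (c : W) (z v : 'rV[R]_(n + m)) :
  'D_v (fun y : 'rV[R]_(n + m) => h (lsubmx y) + c) z = 'D_(lsubmx v) h (lsubmx z).
Proof.
rewrite /derive; set g1 := fun t => t^-1 *: _; set g2 := fun t => t^-1 *: _.
suff -> : g1 = g2 by [].
apply/funext => t; rewrite /g1 /g2 /=.
have -> : lsubmx (t *: v + z) = t *: lsubmx v + lsubmx z by apply/rowP => i; rewrite !mxE.
by rewrite opprD addrACA subrr addr0.
Qed.

Section second_derivative_test.
Variables (R : realType) (f f' : R -> R) (d : R).
Hypothesis hf : \forall t \near (0 : R), is_derive (t : R) 1 f (f' t).
Hypothesis hf' : is_derive (0 : R) 1 f' d.
Hypothesis hmax : \forall t \near (0 : R), f t <= f 0.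

Lemma derive_at_local_max : f' 0 = 0.
Proof.
have [r /= r0 hr] : nbhs_ball (0 : R) (fun t : R => is_derive t 1 f (f' t) /\ f t <= f 0).
  by apply/nbhs_ballP; apply: filterI.
have inb t : t \in `](- r), r[ -> ball (0 : R) r t.
  by rewrite in_itv/= -ball_normE /= sub0r normrN ltr_norml.
have r00 : - r <= r by rewrite ge0_cp ?(ltW r0).
have zin : (0 : R) \in `](- r), r[ by rewrite in_itv/= oppr_lt0 r0.
have [|t /inb /hr[] //|_ e0] := @derive1_at_max _ f (- r) r 0 r00 _ zin _.
  by move=> t /inb /hr [[]].
by have [[_ <-] _] := hr _ (inb _ zin).
Qed.

(** If [d] were positive, [f'] would be positive just to the right of 0, where it vanishes, and the
    mean value theorem would make [f] exceed [f 0]. *)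
Lemma second_derive_at_local_max : d <= 0.
Proof.
have f0 := derive_at_local_max.
rewrite leNgt; apply/negP => d0.
have [dd e] := hf'.
have [r /= r0 hr] : nbhs_ball (0 : R) (fun t : R => is_derive t 1 f (f' t) /\ f t <= f 0).
  by apply/nbhs_ballP; apply: filterI.
have : \forall h \near (0 : R)^', 0 < h^-1 *: (f' (h *: 1 + 0) - f' 0).
  have /cvgr_gt : (h^-1 *: (f' (h *: 1 + 0) - f' 0)) @[h --> (0 : R)^'] --> d.
    by rewrite -e; exact: dd.
  exact.
move=> /nbhs_ballP [s /= s0 hs].
pose m := Num.min r s / 2.
have mrs : 0 < Num.min r s by rewrite lt_min r0.
have m0 : 0 < m by rewrite divr_gt0.
have mlt : m < Num.min r s by rewrite /m ltr_pdivrMr// ltr_pMr// ltr1n.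
have /andP[mr ms] : (m < r) && (m < s) by rewrite -lt_min.
have inb t : 0 <= t <= m -> ball (0 : R) r t.
  move=> /andP[t0 tm]; rewrite -ball_normE /= sub0r normrN ger0_norm//.
  exact: le_lt_trans mr.
have [|c /andP[c0 cm] ec] := @mvt_open R f f' 0 m m0.
  by move=> t /inb /hr [].
have [_ fm] : is_derive m 1 f (f' m) /\ f m <= f 0.
  by apply: hr; apply: inb; rewrite (ltW m0) lexx.
have cs : ball (0 : R) s c.
  by rewrite -ball_normE /= sub0r normrN gtr0_norm// (lt_trans cm).
have := hs c cs (lt0r_neq0 c0); rewrite f0 subr0 addr0 [c *: 1]mulr1.
rewrite [_ *: _]mulrC pmulr_lgt0 ?invr_gt0// => fc.
have : 0 < f m - f 0 by rewrite ec subr0 mulr_gt0.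
by rewrite subr_gt0 ltNge fm.
Qed.
End second_derivative_test.

(** While [P] has k < n rows, [B *m P^T] has a nonzero left kernel vector; it is orthogonal to those
    rows and is normalised to become a new row. *)
Lemma orthonormal_frame (R : realType) (n : nat) (B : 'M[R]_n) :
  B^T = B -> (forall v : 'rV[R]_n, v != 0 -> 0 < inner B v v) ->
  exists e : 'I_n -> 'rV[R]_n, forall a b, inner B (e a) (e b) = (a == b)%:R.
Proof.
move=> sB pB.
suff : forall k, (k <= n)%N -> exists P : 'M[R]_(k, n), P *m B *m P^T = 1%:M.
  move=> /(_ n (leqnn n)) [P hP]; exists (fun a => row a P) => a b.
  transitivity ((P *m B *m P^T) a b); last by rewrite hP mxE.
  rewrite inner_def -row_mul [LHS]mxE [RHS]mxE; apply: eq_bigr => k _.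
  by rewrite [in LHS]mxE; congr (_ * _); rewrite !mxE.
elim=> [_|k IH kn]; first by exists 0; apply/matrixP => -[].
have [P hP] := IH (ltnW kn).
have [v v0 vP] : exists2 v : 'rV[R]_n, v != 0 & v *m (B *m P^T) = 0.
  have : kermx (B *m P^T) != 0.
    rewrite kermx_eq0 /row_free neq_ltn (leq_ltn_trans (rank_leq_col _))//.
  move=> /rowV0Pn[v] /sub_kermxP vk v0; by exists v.
pose r := Num.sqrt (inner B v v).
have r0 : 0 < r by rewrite sqrtr_gt0 pB.
pose u := r^-1 *: v.
have uP : u *m B *m P^T = 0 by rewrite -mulmxA -scalemxAl vP scaler0.
have uu : u *m B *m u^T = 1%:M.
  have rr : r * r = inner B v v by rewrite -expr2 sqr_sqrtr// ltW// pB.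
  apply/matrixP => i j; rewrite !ord1 -inner_def innerZl innerZr -rr !mxE eqxx.
  by rewrite mulKf ?mulVf// lt0r_neq0.
have Pu : P *m B *m u^T = 0.
  by apply: trmx_inj; rewrite !trmx_mul trmxK sB trmx0 mulmxA uP.
have : col_mx u P *m B *m (col_mx u P)^T = 1%:M :> 'M[R]_(1 + k).
  by rewrite tr_col_mx mul_col_mx mul_col_row uu uP Pu hP -scalar_mx_block.
by move=> E; exists (col_mx u P).
Qed.

(** Expansion of |z - s|^2 >= 0, with [s] the orthogonal projection of [z] on the span of the
    family. *)
Lemma bessel (R : realType) (n : nat) (I : finType) (A : 'M[R]_n)
    (d : I -> 'rV[R]_n) (z : 'rV[R]_n) :
  A^T = A -> (forall v, 0 <= inner A v v) ->
  (forall a b, inner A (d a) (d b) = (a == b)%:R) ->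
  \sum_a inner A (d a) z ^+ 2 <= inner A z z.
Proof.
move=> sA pA dd; pose s := \sum_a inner A (d a) z *: d a.
have sd b : inner A s (d b) = inner A (d b) z.
  rewrite (inner_sym _ _ sA) inner_sumr (bigD1 b)//= innerZr dd eqxx mulr1 big1 ?addr0//.
  by move=> a ab; rewrite innerZr dd eq_sym (negbTE ab) mulr0.
have ss : inner A s s = \sum_a inner A (d a) z ^+ 2.
  by rewrite {2}/s inner_sumr; apply: eq_bigr => a _; rewrite innerZr sd expr2.
have sz : inner A s z = \sum_a inner A (d a) z ^+ 2.
  rewrite (inner_sym _ _ sA) /s inner_sumr; apply: eq_bigr => a _.
  by rewrite innerZr (inner_sym _ _ sA) expr2.
have := pA (z - s); rewrite innerBl !innerBr (inner_sym z s sA) sz ss subrr subr0 subr_ge0.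
exact.
Qed.

Section product_metric.
Variables (R : realType) (n : nat) (g : 'rV[R]_n -> 'M[R]_n).
Let Gp (x : 'rV[R]_(n + 1)) : 'M[R]_(n + 1) := block_mx (g (lsubmx x)) 0 0 1%:M.

Lemma inner_product_metric x (v w : 'rV[R]_(n + 1)) :
  inner (Gp x) v w = inner (g (lsubmx x)) (lsubmx v) (lsubmx w)
    + (rsubmx v) 0 0 * (rsubmx w) 0 0.
Proof.
rewrite !inner_def -{1}[v]hsubmxK -{1}[w]hsubmxK /Gp tr_row_mx mul_row_block mul_row_col.
rewrite !mulmx0 addr0 add0r mulmx1 mxE; congr (_ + _).
by rewrite mxE big_ord1 [X in _ * X]mxE.
Qed.

Lemma inner_product_horizontal x (v : 'rV[R]_(n + 1)) (b : 'rV[R]_n) :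
  inner (Gp x) v (row_mx b 0) = inner (g (lsubmx x)) (lsubmx v) b.
Proof. by rewrite inner_product_metric row_mxKl row_mxKr [X in _ * X]mxE mulr0 addr0. Qed.

Lemma inner_product_vertical x (v : 'rV[R]_(n + 1)) :
  inner (Gp x) v (row_mx 0 1%:M) = (rsubmx v) 0 0.
Proof.
by rewrite inner_product_metric row_mxKl row_mxKr inner0r add0r [X in _ * X]mxE mulr1.
Qed.

Lemma product_metric_unit x : g (lsubmx x) \in unitmx -> Gp x \in unitmx.
Proof. by rewrite !unitmxE det_ublock det1 mulr1. Qed.

(** In Koszul's formula for a horizontal third vector, the vertical block adds only constants to the
    coefficients being differentiated, and the remaining ones depend on the N-coordinates alone. *)
Lemma inner_christoffel_product x (v w : 'rV[R]_(n + 1)) (b : 'rV[R]_n) :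
  g (lsubmx x) \in unitmx ->
  inner (Gp x) (christoffel Gp x v w) (row_mx b 0) =
  inner (g (lsubmx x)) (christoffel g (lsubmx x) (lsubmx v) (lsubmx w)) b.
Proof.
move=> gu; have Gu := product_metric_unit gu.
rewrite !inner_def /christoffel !mulmxKV//.
rewrite tr_row_mx trmx0 -[X in X *m _]hsubmxK mul_row_col mulmx0 addr0.
congr ((_ *m _) 0 0); apply/rowP => k.
rewrite mxE [LHS]mxE [RHS]mxE.
have el : lsubmx (delta_mx 0 (lshift 1 k) : 'rV[R]_(n + 1)) = delta_mx 0 k.
  by apply/rowP => i; rewrite !mxE eq_shift.
have er : rsubmx (delta_mx 0 (lshift 1 k) : 'rV[R]_(n + 1)) = 0.
  by apply/rowP => i; rewrite !mxE eq_shift.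
have base (y1 y2 : 'rV[R]_(n + 1)) : (fun z : 'rV[R]_(n + 1) => bform (Gp z) y1 y2)
    = (fun z => bform (g (lsubmx z)) (lsubmx y1) (lsubmx y2) + (rsubmx y1) 0 0 * (rsubmx y2) 0 0).
  by apply/funext => z; rewrite -!innerE inner_product_metric.
have D y1 y2 y3 := @derive_lsubmx R n 1 R (fun y => bform (g y) (lsubmx y1) (lsubmx y2))
  ((rsubmx y1) 0 0 * (rsubmx y2) 0 0) x y3.
by rewrite !base !D el.
Qed.
End product_metric.

(** * The hypersurface at a point farthest from the vertical line over the pole *)

Section hypersurface.
Variables (R : realType) (n : nat) (N : riemannian R n) (q : N).
Variables (E : 'rV[R]_n -> N) (L : N -> 'rV[R]_n).
Hypothesis hN : is_riemannian N.
Hypothesis hE : @is_exp R n N q E.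
Hypothesis smE : @smooth_map R n n (euclidean R n) N E.
Hypothesis smL : @smooth_map R n n N (euclidean R n) L.
Hypothesis EK : cancel E L.
Hypothesis LK : cancel L E.
Variable kappa : R.
Hypothesis kappa0 : 0 < kappa.
Hypothesis hcurv : radial_curvature_le q (- kappa ^+ 2).
Variables (M : manifold R n) (f : M -> prod_riemannian N (real_line R)) (H : R).
Hypothesis hf : closed_hypersurface f.
Hypothesis hH : constant_mean_curvature f H.
Local Notation W := (pole_dom E).
Local Notation F := (pole_chart E).
Local Notation U := (@codom_chart R n N).
Local Notation g := (@gram R n N).
Local Notation G := (pole_metric E).
Local Notation cov j := (cov_der (g j) (F j)).
Local Notation inn j x := (inner (g j (F j x))).

(** The normal coordinates at the pole of the N-component of [f p]; the coordinate in R is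
    forgotten. *)
Definition height_log (p : M) : 'rV[R]_n := L (f p).1.
(** The value is r^2 itself, not its half; hence the factor 2 in [is_derive_half_dist2]. *)
Definition half_dist2 (p : M) : R := G 0 (height_log p) (height_log p).

Lemma continuous_half_dist2 : continuous half_dist2.
Proof.
have [_ _ _ [[cf _] _]] := hf.
move=> p; have cL : {for p, continuous height_log}.
  apply: (@continuous_comp _ _ _ (fun p => (f p).1) L); last exact: smL.1.
  apply: (@continuous_comp _ _ _ f fst); first exact: cf.
  exact: cvg_fst.
have -> : half_dist2 = (fun v => inner (g (chart_at q) (chart (chart_at q) q)) v v) \o height_log.
  by apply/funext => x; rewrite /half_dist2 (pole_metric0 hN hE smE).
apply: continuous_comp => //; apply: differentiable_continuous.
apply: differentiable_inner; first exact: differentiable_cst.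
  exact: (ex_diff (is_diff_def := is_diff_id _)).
exact: (ex_diff (is_diff_def := is_diff_id _)).
Qed.

Lemma exists_farthest : exists p, forall p', half_dist2 p' <= half_dist2 p.
Proof.
have [_ M0 cM _] := hf.
have [p _ hp] := compact_EVT_max M0 cM (continuous_subspaceT continuous_half_dist2).
by exists p => p'; apply: hp; rewrite inE.
Qed.

Section at_farthest.
Variables (p0 : M) (i : Defs.index M) (j : Defs.index N).
Hypothesis di : dom i p0.
Hypothesis dj : dom j (f p0).1.
Hypothesis hmax : forall p, half_dist2 p <= half_dist2 p0.

Let jj : Defs.index (prod_riemannian N (real_line R)) := (j, tt).
Let Fc : 'rV[R]_n -> 'rV[R]_(n + 1) := chart jj \o f \o param i.
Let x0 : 'rV[R]_n := chart i p0.
Let Om : set 'rV[R]_n := chart i @` (dom i `&` f @^-1` dom jj).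
Let A (y : 'rV[R]_n) : 'rV[R]_n := lsubmx (Fc y).
Let V (y : 'rV[R]_n) : 'rV[R]_n := height_log (param i y).

Let hM : is_manifold M. Proof. by case: hf. Qed.

Let paramiK p : dom i p -> param i (chart i p) = p.
Proof. by have [_ _ _ /(_ i)[_ _ h _ _] _] := hM; exact: h. Qed.

Lemma Om_x0 : Om x0.
Proof. by exists p0 => //; split=> //; split. Qed.

Lemma open_Om : open Om.
Proof.
have [_ _ _ /(_ i)[oi oci _ _ cpar] _] := hM.
have [_ _ _ [[cf _] _]] := hf.
have oj : open (dom jj).
  rewrite (_ : dom jj = fst @^-1` dom j); last by apply/seteqP; split=> [z []|z] //= ?; split.
  by apply: open_comp => [x _|]; [exact: cvg_fst|exact: open_dom].
rewrite openE => _ [p [dip djp] <-].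
have ci : codom_chart i (chart i p) by exists p.
have n1 : \forall y \near chart i p, codom_chart i y by exact: open_nbhs_nbhs.
have n2 : \forall y \near chart i p, dom jj (f (param i y)).
  apply: (continuous_comp (cpar _ ci) (cf _)).
  by rewrite /= (paramiK dip); exact: open_nbhs_nbhs (conj oj djp).
near=> y; have [p' dp' ey] : codom_chart i y by near: y.
exists p' => //; split=> //; rewrite /preimage /= -(paramiK dp') ey.
by near: y.
Unshelve. all: by end_near. Qed.

Lemma near_Om y : Om y -> \forall z \near y, Om z.
Proof. by move=> Oy; apply: open_nbhs_nbhs; split=> //; exact: open_Om. Qed.

Lemma smooth_Fc : smooth_on Om Fc.
Proof. by have [_ _ _ [[_ h] _]] := hf; exact: h. Qed.

Lemma A_V y : A y = F j (V y).
Proof. by rewrite /A /Fc /= row_mxKl /V /height_log /pole_chart /= LK. Qed.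

Lemma dom_V y : Om y -> W j (V y).
Proof. by case=> p [dp [/= djp _] <-]; rewrite /pole_dom /= /V /height_log LK paramiK. Qed.

Lemma is_derive_A y e : Om y -> is_derive y e A (lsubmx ('D_e Fc y)).
Proof.
move=> Oy; apply: (is_derive_linear (g := lsubmx)); first exact: continuous_lsubmx.
exact: smooth_on_is_derive smooth_Fc Oy.
Qed.

Lemma is_derive_DA y e a : Om y -> is_derive y a ('D_e A) (lsubmx ('D_a ('D_e Fc) y)).
Proof.
move=> Oy.
apply: (near_eq_is_derive (f := fun z => lsubmx ('D_e Fc z))).
  near=> z; apply/esym/derive_val; apply: is_derive_A; near: z; exact: near_Om.
apply: (is_derive_linear (g := lsubmx)); first exact: continuous_lsubmx.
exact: smooth_on_is_derive (smooth_on_derive e smooth_Fc) Oy.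
Unshelve. all: by end_near. Qed.

Lemma derivable_V y e : Om y -> derivable V y e.
Proof.
move=> Oy.
have UA : U j (A y) by rewrite A_V; exact: pole_chart_codom (dom_V Oy).
have [d _] := is_derive_comp (is_derive_A e Oy)
  (smooth_on_differentiable (smooth_log smL (j := j)) UA).
apply: near_eq_derivable d; near=> z.
rewrite /= A_V /pole_chart /= (paramK hN); last first.
  by apply: dom_V; near: z; exact: near_Om.
by rewrite EK.
Unshelve. all: by end_near. Qed.

Lemma derive_A y e : Om y -> 'D_e A y = 'D_('D_e V y) (F j) (V y).
Proof.
move=> Oy; rewrite (_ : A = F j \o V); last by apply/funext => z; rewrite A_V.
apply: derive_val; apply: is_derive_comp; first exact: derivableP (derivable_V Oy).
exact: smooth_on_differentiable (smooth_pole_chart smE (j := j)) (dom_V Oy).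
Qed.

(** The gradient of r^2 / 2 on N along the immersion: the radial vector of length r, read in the
    chart [j]. *)
Let P (y : 'rV[R]_n) : 'rV[R]_n := 'D_(V y) (F j) (V y).

Lemma is_derive_P y e : Om y -> is_derive y e P
  ('D_('D_e V y) (F j) (V y) + 'D_('D_e V y) ('D_(V y) (F j)) (V y)).
Proof.
move=> Oy; have Wy := dom_V Oy; have sF := smooth_pole_chart smE (j := j).
have dF x : W j x -> differentiable (F j) x by exact: smooth_on_differentiable sF.
(* The base point and the direction of the derivative both move with [z]; expanding the direction in
   the basis separates the two. *)
apply: (near_eq_is_derive (f := fun z => \sum_k V z 0 k *: 'D_(delta_mx 0 k) (F j) (V z))).
  near=> z; have Oz : Om z by near: z; exact: near_Om.
  exact/esym/(derive_sum_delta (V z) (dF _ (dom_V Oz))).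
have dV := derivableP (derivable_V (e := e) Oy).
have /is_derive_eq : is_derive y e (fun z => \sum_k V z 0 k *: 'D_(delta_mx 0 k) (F j) (V z))
   (\sum_k ('D_e V y 0 k *: 'D_(delta_mx 0 k) (F j) (V y)
      + V y 0 k *: 'D_('D_e V y) ('D_(delta_mx 0 k) (F j)) (V y))).
  apply: is_derive_sum_fin => k; apply: is_derive_scaler_fun.
    exact: (is_derive_mx _ _ _ _).2 dV 0 k.
  apply: is_derive_comp => //.
  exact: smooth_on_differentiable (smooth_on_derive _ sF) Wy.
apply; rewrite big_split /= -(derive_sum_delta _ (dF _ Wy)); congr (_ + _).
rewrite (pole_chart_comm hN smE _ _ Wy).
rewrite (derive_sum_delta _ (smooth_on_differentiable (smooth_on_derive _ sF) Wy)).
by apply: eq_bigr => k _; rewrite (pole_chart_comm hN smE _ _ Wy).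
Unshelve. all: by end_near. Qed.

Local Notation innA y := (inner (g j (A y))).

(** Differentiation gives 2 G(0)(V, D_e V), with the metric at the pole; the Gauss lemma replaces it
    by the metric at the point. *)
Lemma is_derive_half_dist2 y e : Om y ->
  is_derive y e (half_dist2 \o param i) (2 * innA y (P y) ('D_e A y)).
Proof.
move=> Oy; have Wy := dom_V Oy.
have dV := derivableP (derivable_V (e := e) Oy).
have C0 v w : G 0 v w = inner (g (chart_at q) (chart (chart_at q) q)) v w.
  exact: pole_metric0 hN hE smE v w.
rewrite (_ : half_dist2 \o param i = (fun z =>
  inner (g (chart_at q) (chart (chart_at q) q)) (V z) (V z))); last first.
  by apply/funext => z; rewrite -C0.
have /is_derive_eq := is_derive_inner_mx
  (is_derive_cst (g (chart_at q) (chart (chart_at q) q)) y e) dV dV; apply.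
rewrite -!C0 (pole_metricC E hN) -(gauss hN hE smE) (pole_metricE hN smE _ _ Wy).
rewrite (derive_A _ Oy) A_V /pole_metric_at (_ : inner 0 _ _ = 0).
  by rewrite add0r mulr_natl mulr2n.
by rewrite inner_def mulmx0 mul0mx mxE.
Qed.

Local Notation covA := (cov_der (g j) A).

(** The first and second derivative tests along a straight line of the chart [i]; the second
    derivative is expanded by metric compatibility. *)
Lemma farthest_conditions e : innA x0 (P x0) ('D_e A x0) = 0 /\
  innA x0 (covA e P x0) ('D_e A x0) + innA x0 (P x0) (covA e ('D_e A) x0) <= 0.
Proof.
have O0 := Om_x0.
pose d1 y := 2 * innA y (P y) ('D_e A y).
have UA : U j (A x0) by rewrite A_V; exact: pole_chart_codom (dom_V O0).
have [dA _] := is_derive_A e O0; have [ddA _] := is_derive_DA e e O0.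
have [dP _] := is_derive_P e O0.
have D2 := is_derive_inner (F := A) (open_codom hN (j := j)) (smooth_gram hN (j := j))
  (gram_sym hN (j := j)) (gram_pos hN (j := j)) UA dA dP ddA.
have D2' := is_derive_mul (is_derive_cst (2 : R) x0 e) D2.
have cl : {for (0 : R), continuous (fun t : R => t *: e + x0)}.
  by apply: cvgD; [exact: scalel_continuous|exact: cvg_cst].
have nO : \forall t \near (0 : R), Om (t *: e + x0).
  by apply: cl; rewrite scale0r add0r; exact: near_Om.
pose h t := half_dist2 (param i (t *: e + x0)).
have h0 : param i (0 *: e + x0) = p0 by rewrite scale0r add0r paramiK.
have h1 : \forall t \near (0 : R), is_derive (t : R) 1 h (d1 (t *: e + x0)).
  near=> t.
  have Ot : Om (t *: e + x0) by near: t.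
  exact: is_derive_along_shift (is_derive_half_dist2 e Ot).
have h2 := (is_derive_line _ _ _ _).1 D2'.
have h3 : \forall t \near (0 : R), h t <= h 0.
  by near=> t; rewrite /h h0; exact: hmax.
have e1 := derive_at_local_max h1 h3.
have e2 := second_derive_at_local_max h1 h2 h3.
split.
  move: e1; rewrite /d1 scale0r add0r => /eqP.
  by rewrite mulf_eq0 pnatr_eq0 /= => /eqP.
by move: e2; rewrite mul0r add0r /cst pmulr_rle0.
Unshelve. all: by end_near. Qed.

Lemma cov_radial e : covA e P x0 =
  'D_('D_e V x0) (F j) (V x0) + cov j ('D_e V x0) ('D_(V x0) (F j)) (V x0).
Proof.
have O0 := Om_x0; have [_ DP] := is_derive_P e O0.
by rewrite !cov_der_def DP (derive_A _ O0) A_V addrA.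
Qed.

(** The Hessian comparison bounds the first term of [farthest_conditions] from below. Its
    orthogonality hypothesis is the first-order condition, carried back to the pole by the Gauss
    lemma. *)
Lemma farthest_shape e (k : R) : V x0 != 0 -> k ^+ 2 = kappa ^+ 2 * G 0 (V x0) (V x0) ->
  k * innA x0 ('D_e A x0) ('D_e A x0) + innA x0 (P x0) (covA e ('D_e A) x0) <= 0.
Proof.
move=> V0 k2; have [orth le0] := farthest_conditions e.
have Wx := dom_V Om_x0.
apply: le_trans le0; rewrite lerD2r cov_radial (derive_A _ Om_x0) A_V.
have [->|w0] := eqVneq ('D_e V x0) 0; first by rewrite derive0 !inner0r mulr0.
apply: (hessian_comparison hN hE smE smL EK hcurv V0 w0 _ k2 Wx).
rewrite -(gauss hN hE smE) (pole_metricE hN smE _ _ Wx) /pole_metric_at.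
by move: orth; rewrite (derive_A _ Om_x0) A_V.
Qed.

Lemma second_form_radial e b :
  second_form (@gram _ _ (prod_riemannian N (real_line R)) jj) Fc x0 (row_mx b 0) e e =
  innA x0 (covA e ('D_e A) x0) b.
Proof.
have O0 := Om_x0; have UA : U j (A x0) by rewrite A_V; exact: pole_chart_codom (dom_V O0).
have gu : g j (lsubmx (Fc x0)) \in unitmx := posdef_unit (gram_pos hN UA).
rewrite /second_form -innerE innerDl (inner_christoffel_product _ _ _ gu).
rewrite inner_product_horizontal -innerDl.
rewrite cov_der_def.
have [_ ->] := is_derive_DA e e O0.
by have [_ ->] := is_derive_A e O0; rewrite GammaE.
Qed.

(** The first fundamental form of the immersion at [x0]. *)
Let B : 'M[R]_n := 'J Fc x0 *m @gram _ _ (prod_riemannian N (real_line R)) jj (Fc x0) *m ('J Fc x0)^T.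

Lemma derive_Fc v : 'D_v Fc x0 = v *m 'J Fc x0.
Proof. by apply: deriveEjacobian; exact: smooth_on_differentiable smooth_Fc Om_x0. Qed.

Local Notation gp := (@gram _ _ (prod_riemannian N (real_line R)) jj (Fc x0)).

Lemma inner_B v w : inner B v w = inner gp ('D_v Fc x0) ('D_w Fc x0).
Proof. by rewrite !derive_Fc !inner_def /B trmx_mul !mulmxA. Qed.

Lemma gp_sym : gp^T = gp.
Proof.
rewrite /= tr_block_mx !trmx0 trmx1 (gram_sym hN)//.
by rewrite -/(A x0) A_V; exact: pole_chart_codom (dom_V Om_x0).
Qed.

Lemma gp_pos (v : 'rV[R]_(n + 1)) : v != 0 -> 0 < inner gp v v.
Proof.
have UA : U j (A x0) by rewrite A_V; exact: pole_chart_codom (dom_V Om_x0).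
rewrite inner_product_metric => v0.
have [l0|l0] := eqVneq (lsubmx v) 0; last first.
  by rewrite ltr_wpDr ?(gram_pos hN)// -expr2 sqr_ge0.
rewrite l0 inner0l add0r -expr2 lt0r sqr_ge0 andbT sqrf_eq0.
apply: contraNneq v0 => r0; rewrite -[v]hsubmxK l0.
suff -> : rsubmx v = 0 by rewrite row_mx0.
by apply/rowP => k; rewrite !ord1 r0 mxE.
Qed.

Lemma B_pos v : v != 0 -> 0 < inner B v v.
Proof.
move=> v0; rewrite inner_B; apply: gp_pos; apply: contraNneq v0 => D0.
have [_ _ _ [_ imm]] := hf.
by apply/eqP; apply: (imm p0 i jj).
Qed.

Lemma B_sym : B^T = B.
Proof. by rewrite /B !trmx_mul trmxK gp_sym mulmxA. Qed.

Lemma mean_curvature_ge : (n%:R - 1) * kappa <= n%:R * `|H|.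
Proof.
have [e he] := orthonormal_frame B_sym B_pos.
have ort a b : inner gp ('D_(e a) Fc x0) ('D_(e b) Fc x0) = (a == b)%:R.
  by rewrite -inner_B.
have O0 := Om_x0; have Wx := dom_V O0.
have UA : U j (A x0) by rewrite A_V; exact: pole_chart_codom.
have DA v : lsubmx ('D_v Fc x0) = 'D_v A x0 by have [_ <-] := is_derive_A v O0.
pose tau a := rsubmx ('D_(e a) Fc x0) 0 0.
have tauE a : innA x0 ('D_(e a) A x0) ('D_(e a) A x0) = 1 - tau a ^+ 2.
  have o1 : inner gp ('D_(e a) Fc x0) ('D_(e a) Fc x0) = 1 by rewrite ort eqxx.
  by rewrite -o1 inner_product_metric DA -expr2 addrK.
(* Bessel's inequality for the vertical unit vector; this is the origin of n - 1 in place of n. *)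
have tau1 : \sum_a tau a ^+ 2 <= 1.
  have pge v : 0 <= inner gp v v by exact: posdef_ge0 gp_pos v.
  have := bessel (row_mx 0 1%:M) gp_sym pge ort.
  rewrite [X in _ <= X]inner_product_vertical row_mxKr mxE.
  by rewrite (eq_bigr (fun a => tau a ^+ 2))// => a _; rewrite inner_product_vertical.
have sumA : n%:R - 1 <= \sum_a innA x0 ('D_(e a) A x0) ('D_(e a) A x0).
  rewrite (eq_bigr _ (fun a _ => tauE a)) sumrB sumr_const card_ord.
  by rewrite lerD2l lerN2.
(* If the farthest point lies over the pole, so does all of M; the horizontal trace is then 0, which
   forces n - 1 <= 0 and makes the bound trivial. *)
have [V0|V0] := eqVneq (V x0) 0.
  have h0 : half_dist2 p0 = 0.
    rewrite /half_dist2 (_ : height_log p0 = V x0); last by rewrite /V paramiK.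
    by rewrite V0 (pole_metric0 hN hE smE) inner0l.
  have Vz y : V y = 0.
    apply/eqP; apply: contraT => Vy.
    have := pole_metric_pos hN smE smL EK 0 Vy.
    by rewrite ltNge -h0 (hmax (param i y)).
  have DA0 v : 'D_v A x0 = 0.
    rewrite (derive_A _ O0) (_ : V = cst 0) ?derive_cst ?derive0//.
    by apply/funext => y; exact: Vz.
  apply: (@le_trans _ _ 0); last by rewrite mulr_ge0.
  rewrite mulr_le0_ge0 ?(ltW kappa0)//; apply: le_trans sumA _.
  by rewrite big1// => a _; rewrite DA0 inner0l.
pose r := Num.sqrt (G 0 (V x0) (V x0)).
have GV := pole_metric_pos hN smE smL EK 0 V0.
have r0 : 0 < r by rewrite sqrtr_gt0.
have rr : r ^+ 2 = G 0 (V x0) (V x0) by rewrite sqr_sqrtr// ltW.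
have k2 : (kappa * r) ^+ 2 = kappa ^+ 2 * G 0 (V x0) (V x0) by rewrite exprMn rr.
have PP : innA x0 (P x0) (P x0) = r ^+ 2.
  by rewrite rr -(gauss hN hE smE) (pole_metricE hN smE _ _ Wx) A_V.
(* The normalised radial vector, which the first-order condition makes normal to M. *)
pose nu : 'rV[R]_(n + 1) := row_mx (r^-1 *: P x0) 0.
have nn : inner gp nu nu = 1.
  rewrite /nu inner_product_horizontal (row_mxKl (r^-1 *: P x0)) innerZl innerZr PP expr2.
  by rewrite mulKf ?mulVf ?lt0r_neq0.
have nt v : inner gp ('D_v Fc x0) nu = 0.
  rewrite /nu inner_product_horizontal DA innerZr (inner_sym _ _ (gram_sym hN UA)).
  by have [-> _] := farthest_conditions v; rewrite mulr0.
have djj : dom jj (f p0) by split.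
have := @hH p0 i jj di djj e nu; rewrite -innerE => /(_ ort nn nt) <-.
rewrite (eq_bigr (fun a => innA x0 (covA (e a) ('D_(e a) A) x0) (r^-1 *: P x0))); last first.
  by move=> a _; exact: second_form_radial.
(* Along the outward normal the second form is nonpositive, so its opposite is estimated. *)
rewrite -normrN; apply: le_trans (ler_norm _); rewrite -sumrN.
apply: (@le_trans _ _ (\sum_a kappa * innA x0 ('D_(e a) A x0) ('D_(e a) A x0))).
  by rewrite -mulr_sumr mulrC ler_pM2l.
apply: ler_sum => a _; rewrite innerZr (inner_sym _ _ (gram_sym hN UA)) -mulrN.
have := farthest_shape (e a) V0 k2; rewrite -lerBrDr sub0r => fs.
by rewrite [leRHS]mulrC ler_pdivlMr// mulrAC.
Qed.
End at_farthest.
End hypersurface.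

Lemma closed_hypersurface_mean_curvature (R : realType) (n : nat) (N : riemannian R n)
    (q : N) (kappa : R) (M : manifold R n)
    (f : M -> prod_riemannian N (real_line R)) (H : R) :
  is_riemannian N -> pole q -> 0 < kappa -> radial_curvature_le q (- kappa ^+ 2) ->
  closed_hypersurface f -> constant_mean_curvature f H ->
  (n%:R - 1) * kappa <= n%:R * `|H|.
Proof.
move=> hN [E [hE [smE [L [smL EK LK]]]]] k0 hc hf hH.
have [p0 hp] := exists_farthest hN hE smE smL hf.
have [[_ _ dM _ _] _ _ _] := hf.
exact: (mean_curvature_ge hN hE smE smL EK LK k0 hc hf hH (dM p0) (dom_chart_at hN _) hp).
Qed.

(** * Iterated integrals of continuous functions with compact support *)

(** On R^n this is compact support; an explicit radius is inherited unchanged by all slices. *)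
Definition bounded_support (R : realType) (V : normedModType R) (g : V -> R) : Prop :=
  exists2 r : R, 0 < r & forall x, r < `|x| -> g x = 0.

Definition Cc (R : realType) (V : normedModType R) (g : V -> R) : Prop :=
  continuous g /\ bounded_support g.

Lemma continuous_eps (R : realType) (V W : normedModType R) (f : V -> W) (x : V) :
  (forall e : R, 0 < e -> exists2 d : R, 0 < d &
     forall y, `|x - y| < d -> `|f x - f y| < e) -> {for x, continuous f}.
Proof.
move=> h; apply/cvgrPdist_lt => e e0; have [d d0 hd] := h e e0.
by apply/nbhs_ballP; exists d => // y; rewrite -ball_normE; exact: hd.
Qed.

Section row_norm.
Variables (R : realType) (m : nat).

(** The norm of rows is the sup norm, hence the maximum of the norms of the two blocks. *)
Lemma row_mx_norm_le (r t : R) (y : 'rV[R]_m) :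
  (`|row_mx (t%:M : 'M[R]_1) y| <= r) = (`|t| <= r) && (`|y| <= r).
Proof.
rewrite /Num.norm /= !mx_normrE.
apply/idP/andP => [/bigmax_leP[r0 h]|[ht /bigmax_leP[r0 hy]]].
  split.
    by have := h (0, lshift m 0) isT; rewrite /= row_mxEl mxE.
  apply/bigmax_leP; split=> // -[i k] _; rewrite (ord1 i).
  by have := h (0, rshift 1 k) isT; rewrite /= row_mxEr.
apply/bigmax_leP; split=> // -[i k] _; rewrite (ord1 i) /=.
case: (split_ordP k) => k' ->; last by rewrite row_mxEr; exact: (hy (0, k') isT).
by rewrite row_mxEl (ord1 k') mxE eqxx.
Qed.

Lemma row_mx_norm_ger (t : R) (y : 'rV[R]_m) : `|y| <= `|row_mx (t%:M : 'M[R]_1) y|.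
Proof.
by have := row_mx_norm_le `|row_mx (t%:M : 'M[R]_1) y| t y; rewrite lexx => /esym/andP[].
Qed.

Lemma row_mx_norm_gel (t : R) (y : 'rV[R]_m) : `|t| <= `|row_mx (t%:M : 'M[R]_1) y|.
Proof.
by have := row_mx_norm_le `|row_mx (t%:M : 'M[R]_1) y| t y; rewrite lexx => /esym/andP[].
Qed.

Lemma row_mx_subl (t t' : R) (y : 'rV[R]_m) :
  `|row_mx (t%:M : 'M[R]_1) y - row_mx (t'%:M : 'M[R]_1) y| = `|t - t'|.
Proof.
rewrite opp_row_mx add_row_mx subrr -[X in row_mx X]raddfB /=.
apply/eqP; rewrite eq_le row_mx_norm_le lexx normr0 normr_ge0 /=.
exact: row_mx_norm_gel.
Qed.

Lemma row_mx_subr (t : R) (y y' : 'rV[R]_m) :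
  `|row_mx (t%:M : 'M[R]_1) y - row_mx (t%:M : 'M[R]_1) y'| = `|y - y'|.
Proof.
rewrite opp_row_mx add_row_mx subrr -[X in row_mx X](raddf0 (@scalar_mx _ _)) /=.
apply/eqP; rewrite eq_le row_mx_norm_le lexx normr0 normr_ge0 /=.
exact: row_mx_norm_ger.
Qed.
End row_norm.

Section Cc_rV.
Variables (R : realType) (n : nat).
Implicit Types (g : 'rV[R]_n -> R).

Lemma closed_ball_rV_compact (r : R) : compact [set x : 'rV[R]_n | `|x| <= r].
Proof.
apply: bounded_closed_compact.
  by exists r; split=> [|s rs x /= /le_trans]; [exact: num_real|apply; exact: ltW].
apply: (@closed_comp _ _ (fun x : 'rV[R]_n => `|x|) [set t | t <= r]); last exact: closed_le.
by move=> x _; exact: norm_continuous.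
Qed.

(** Compactness of the ball of radius r + 1 handles [x] inside it. For [x] outside, a distance below
    1 leaves [y] where [g] vanishes as well. *)
Lemma Cc_unif_continuous g : Cc g -> forall e, 0 < e -> exists2 d, 0 < d &
  forall x y, `|x - y| < d -> `|g x - g y| < e.
Proof.
move=> [cg [r r0 hr]] e e0.
have e2 : 0 < e / 2 by rewrite divr_gt0.
have /compact_near_coveringP K := @closed_ball_rV_compact (r + 1).
have := K _ (nbhs (0 : R)) (fun d x => forall y, `|x - y| < d -> `|g x - g y| < e) _.
case=> [x _|s /= s0 hs].
  have : \forall y \near x, `|g x - g y| < e / 2 by exact: (cvgrPdist_lt _ _).1 (cg x) _ e2.
  move=> /nbhs_ballP [s /= s0 hs].
  exists (ball x (s / 2), ball (0 : R) (s / 2)).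
    by split; apply: nbhsx_ballx; rewrite divr_gt0.
  move=> [x' d] /= []; rewrite -!ball_normE /= sub0r normrN => xx' dd y x'y.
  have gx' : `|g x - g x'| < e / 2.
    by apply: hs; rewrite -ball_normE /= (lt_trans xx')// ltr_pdivrMr// ltr_pMr// ltr1n.
  have gy : `|g x - g y| < e / 2.
    apply: hs; rewrite -ball_normE /= -(subrKA x') (le_lt_trans (ler_normD _ _))//.
    by rewrite (splitr s) ltrD// (lt_trans x'y)// (le_lt_trans (ler_norm d)).
  rewrite -(subrKA (g x)) (le_lt_trans (ler_normD _ _))// (splitr e) ltrD//.
  by rewrite distrC.
have s1 : 0 < Num.min s 1 by rewrite lt_min s0 ltr01.
pose d := Num.min s 1 / 2.
have d0 : 0 < d by rewrite divr_gt0.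
have dlt : d < Num.min s 1 by rewrite /d ltr_pdivrMr// ltr_pMr// ltr1n.
have /andP[ds d1] : (d < s) && (d < 1) by rewrite -lt_min.
exists d => // x y xy.
have [xr|xr] := leP `|x| (r + 1).
  by apply: (hs d) => //; rewrite /= sub0r normrN gtr0_norm.
have yr : r < `|y|.
  rewrite -(ltrD2r 1) (lt_le_trans xr)// -lerBlDl (le_trans (lerB_dist _ _))//.
  by rewrite ltW// (lt_trans xy).
by rewrite !hr ?subrr ?normr0// (lt_trans _ xr)// ltrDl.
Qed.

Lemma CcD g h : Cc g -> Cc h -> Cc (fun x => g x + h x).
Proof.
move=> [cg [r r0 hr]] [ch [s s0 hs]]; split.
  by move=> x; apply: continuousD; [exact: cg|exact: ch].
exists (r + s); first exact: addr_gt0.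
by move=> x rs; rewrite hr ?hs ?addr0// (lt_trans _ rs) ?ltrDl ?ltrDr.
Qed.

Lemma CcM g h : continuous g -> Cc h -> Cc (fun x => g x * h x).
Proof.
move=> cg [ch [s s0 hs]]; split.
  by move=> x; apply: continuousM; [exact: cg|exact: ch].
by exists s => // x xs; rewrite hs// mulr0.
Qed.

Lemma Cc_cst0 : Cc (fun _ : 'rV[R]_n => 0 : R).
Proof. by split; [exact: cst_continuous|exists 1]. Qed.

Lemma CcZ a g : Cc g -> Cc (fun x => a * g x).
Proof. by move=> cg; apply: CcM => //; exact: cst_continuous. Qed.

Lemma Cc_sum (I : Type) (s : seq I) (P : pred I) (F : I -> 'rV[R]_n -> R) :
  (forall i, P i -> Cc (F i)) -> Cc (fun x => \sum_(i <- s | P i) F i x).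
Proof.
move=> hF; elim: s => [|i s IH].
  rewrite (_ : (fun x => _) = fun=> 0); first exact: Cc_cst0.
  by apply/funext => x; rewrite big_nil.
case Pi : (P i); last first.
  by rewrite (_ : (fun x => _) = (fun x => \sum_(i <- s | P i) F i x))//;
    apply/funext => x; rewrite big_cons Pi.
rewrite (_ : (fun x => _) = (fun x => F i x + \sum_(i <- s | P i) F i x)).
  by apply: CcD => //; exact: hF.
by apply/funext => x; rewrite big_cons Pi.
Qed.
End Cc_rV.

Section Cc_line.
Variable R : realType.
Local Notation mu := (@lebesgue_measure R).
Implicit Types (h : R -> R).

Lemma Cc_integrable h : Cc h -> mu.-integrable setT (EFin \o h).
Proof.
move=> [ch [r r0 hr]].
have -> : EFin \o h = (EFin \o h) \_ `[(- r), r].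
  apply/funext => t; rewrite patchE; case: ifPn => // /negP tr /=.
  rewrite hr// ltNge ler_norml; apply/negP => tin; apply: tr.
  by rewrite inE /= in_itv.
rewrite -integrable_mkcond//; apply: continuous_compact_integrable.
  exact: segment_compact.
exact: continuous_subspaceT.
Qed.

Lemma Cc_Rintegral_support h (r : R) : 0 <= r -> (forall t, r < `|t| -> h t = 0) ->
  \int[mu]_t h t = \int[mu]_(t in `[(- r), r]) h t.
Proof.
move=> r0 hr; rewrite [RHS]Rintegral_mkcond; apply: eq_Rintegral => t _.
rewrite patchE; case: ifPn => // /negP tr.
rewrite hr// ltNge ler_norml; apply/negP => tin; apply: tr.
by rewrite inE /= in_itv.
Qed.

Lemma Cc_Rintegral_bound h (r B : R) : Cc h -> 0 <= r -> (forall t, r < `|t| -> h t = 0) ->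
  (forall t, `|h t| <= B) -> `|\int[mu]_t h t| <= 2 * r * B.
Proof.
move=> hC r0 hr hB; rewrite (Cc_Rintegral_support r0 hr).
have mI : measurable ([set` `[(- r), r]%R] : set (measurableTypeR R)).
  exact: measurable_itv.
have hI : mu.-integrable `[(- r), r] (EFin \o h).
  by apply: integrableS (Cc_integrable hC).
apply: (le_trans (le_normr_Rintegral mI hI)).
have rr : - r <= r by rewrite ge0_cp.
apply: (@le_trans _ _ (\int[mu]_(t in `[(- r), r]) B)).
  apply: le_Rintegral => //.
    exact: integrable_norm hI.
  apply: continuous_compact_integrable; first exact: segment_compact.
  by apply: continuous_subspaceT; exact: cst_continuous.
rewrite Rintegral_cst//.
have -> : fine (mu `[(- r), r]) = 2 * r.
  rewrite lebesgue_measure_itv /= lte_fin; case: ifPn => [_|].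
    by rewrite /= opprK -mulr2n mulr_natl.
  rewrite -leNgt /= => rr'; have -> : r = 0; last by rewrite mulr0.
  by apply/eqP; rewrite eq_le r0 andbT -oppr_ge0 (le_trans r0 rr').
by rewrite mulrC.
Qed.

Lemma Cc_Rintegral_derive h dh : (forall t : R, is_derive t 1 h (dh t)) -> Cc dh ->
  bounded_support h -> \int[mu]_t dh t = 0.
Proof.
move=> hd [cdh [r r0 hr]] [s s0 hs].
(* On [-u, u] the whole integral of [dh] is captured, while [h] vanishes at both ends. *)
pose u := r + s.
have u0 : 0 < u by exact: addr_gt0.
rewrite (@Cc_Rintegral_support _ u) ?ltW//; last first.
  by move=> t ut; apply: hr; apply: lt_trans ut; rewrite ltrDl.
have ch t : {for t, continuous h}.
  by apply: differentiable_continuous; apply/derivable1_diffP; case: (hd t).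
have := @continuous_FTC2 R dh h (- u) u.
rewrite gt0_cp// => /(_ isT (continuous_subspaceT cdh)) E.
rewrite /Rintegral E.
- rewrite /= !hs ?subrr// ?normrN gtr0_norm// ltrDr//.
- split=> [t _|t|t]; first by case: (hd t).
  + by apply: cvg_at_right_filter; exact: ch.
  + by apply: cvg_at_left_filter; exact: ch.
- by move=> t _; rewrite derive1E; case: (hd t).
Qed.
End Cc_line.

(** Real-valued companion of [integral_rV], for which differences make sense; [integral_rV_EFin]
    identifies the two on [Cc]. *)
Fixpoint rV_integral (R : realType) (n : nat) : ('rV[R]_n -> R) -> R :=
  match n with
  | 0%N => fun g => g 0
  | m.+1 => fun g => \int[@lebesgue_measure R]_t
              rV_integral (fun y : 'rV[R]_m => g (row_mx (t%:M) y))
  end.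

Section rV_integral_theory.
Variable R : realType.
Local Notation mu := (@lebesgue_measure R).
Local Notation J := (@rV_integral R _).

Definition slice m (g : 'rV[R]_m.+1 -> R) (t : R) (y : 'rV[R]_m) : R :=
  g (row_mx (t%:M : 'M[R]_1) y).

Lemma slice_Cc m (g : 'rV[R]_m.+1 -> R) t : Cc g -> Cc (slice g t).
Proof.
move=> gC; split.
  move=> y; apply: continuous_eps => e e0.
  have [d d0 hd] := Cc_unif_continuous gC e0.
  exists d => // z yz.
  by apply: hd; rewrite row_mx_subr.
have [_ [r r0 hr]] := gC; exists r => // y ry; apply: hr.
exact: lt_le_trans (row_mx_norm_ger t y).
Qed.

Lemma slice_support m (g : 'rV[R]_m.+1 -> R) r t : (forall x, r < `|x| -> g x = 0) ->
  forall y, r < `|y| -> slice g t y = 0.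
Proof. by move=> hr y ry; apply: hr; exact: lt_le_trans (row_mx_norm_ger t y). Qed.

(** Uniform continuity makes nearby slices uniformly close, and the bound on [I], over a common
    support radius, turns this into continuity. [I] is abstract because the lemma is used inside the
    induction that establishes its hypotheses for the iterated integral. *)
Lemma slice_Cc_functional m (I : ('rV[R]_m -> R) -> R) :
  (forall g h, Cc g -> Cc h -> I (fun x => g x + h x) = I g + I h) ->
  (forall a g, Cc g -> I (fun x => a * g x) = a * I g) ->
  (forall (g : 'rV[R]_m -> R) (r B : R), Cc g -> 0 <= r ->
     (forall x, r < `|x| -> g x = 0) -> (forall x, `|g x| <= B) ->
     `|I g| <= (2 * r) ^+ m * B) ->
  forall g, Cc g -> Cc (fun t => I (slice (m := m) g t)).
Proof.
move=> ID IZ Ib g gC; have [_ [r r0 hr]] := gC; split.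
  move=> t; apply: continuous_eps => e e0.
  (* The summand 1 makes [K] positive and the final estimate strict. *)
  pose K := (2 * r) ^+ m + 1.
  have K0 : 0 < K by rewrite ltr_wpDl// exprn_ge0// mulr_ge0// ltW.
  have eK : 0 < e / K by rewrite divr_gt0.
  have [d d0 hd] := Cc_unif_continuous gC eK; exists d => // s ts.
  have st := slice_Cc t gC; have ss := slice_Cc s gC.
  have dC : Cc (fun y => slice g t y + -1 * slice g s y).
    by apply: CcD => //; exact: CcZ.
  have -> : I (slice g t) - I (slice g s) = I (fun y => slice g t y + -1 * slice g s y).
    by rewrite ID ?IZ ?mulN1r//; exact: CcZ.
  have : `|I (fun y => slice g t y + -1 * slice g s y)| <= (2 * r) ^+ m * (e / K).
    apply: Ib => //; first exact: ltW.
      by move=> y ry; rewrite !(slice_support _ hr)// mulr0 addr0.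
    by move=> y; rewrite mulN1r ltW//; apply: hd; rewrite row_mx_subl.
  move=> /le_lt_trans; apply.
  by rewrite mulrCA gtr_pMr// ltr_pdivrMr// mul1r ltrDl.
exists r => // t rt.
rewrite (_ : slice g t = fun=> 0 * 0); first by rewrite (IZ 0 (fun=> 0)) ?mul0r//; exact: Cc_cst0.
by apply/funext => y; rewrite mul0r; apply: hr; exact: lt_le_trans (row_mx_norm_gel t y).
Qed.

(* Linearity, positivity and continuity in the first variable have to be
   proved together, the last one being what makes the next integral finite. *)
Lemma rV_integral_aux n :
  [/\ forall g h : 'rV[R]_n -> R, Cc g -> Cc h -> J (fun x => g x + h x) = J g + J h,
      forall (a : R) (g : 'rV[R]_n -> R), Cc g -> J (fun x => a * g x) = a * J g,
      forall g h : 'rV[R]_n -> R, Cc g -> Cc h -> (forall x, g x <= h x) -> J g <= J h &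
      forall (g : 'rV[R]_n -> R) (r B : R), Cc g -> 0 <= r ->
        (forall x, r < `|x| -> g x = 0) -> (forall x, `|g x| <= B) ->
        `|J g| <= (2 * r) ^+ n * B].
Proof.
elim: n => [|m [JD JZ Jle Jb]].
  by split=> //= g r B _ _ _ hB; rewrite expr0 mul1r.
have Jslice g : Cc g -> Cc (fun t => J (slice (m := m) g t)) by exact: slice_Cc_functional.
have int g : Cc g -> mu.-integrable setT (EFin \o (fun t => J (slice (m := m) g t))).
  by move=> /Jslice /Cc_integrable.
split.
- move=> g h gC hC /=.
  rewrite -RintegralD//; [|exact: int gC|exact: int hC].
  by apply: eq_Rintegral => t _; rewrite -JD//; exact: slice_Cc.
- move=> a g gC /=.
  rewrite -RintegralZl//; last exact: int gC.
  by apply: eq_Rintegral => t _; rewrite -JZ//; exact: slice_Cc.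
- move=> g h gC hC gh /=.
  apply: le_Rintegral => //; [exact: int gC|exact: int hC|].
  by move=> t _; apply: Jle => [||y]; [exact: (slice_Cc t gC)|exact: (slice_Cc t hC)|exact: gh].
- move=> g r B gC r0 hr hB /=; rewrite exprS -mulrA.
  apply: Cc_Rintegral_bound => //; first exact: Jslice gC.
    move=> t rt; rewrite (_ : (fun y => _) = fun=> 0 * 0).
      by rewrite (JZ 0 (fun=> 0)) ?mul0r//; exact: Cc_cst0.
    by apply/funext => y; rewrite mul0r; apply: hr; exact: lt_le_trans (row_mx_norm_gel t y).
  move=> t; apply: Jb => //; first exact: (slice_Cc t gC).
  exact: slice_support.
Qed.

Section rV_integral_properties.
Variable n : nat.
Implicit Types g h : 'rV[R]_n -> R.
Lemma rV_integralD g h : Cc g -> Cc h -> J (fun x => g x + h x) = J g + J h.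
Proof. by have [+ _ _ _] := rV_integral_aux n; apply. Qed.
Lemma rV_integralZ a g : Cc g -> J (fun x => a * g x) = a * J g.
Proof. by have [_ + _ _] := rV_integral_aux n; apply. Qed.
Lemma le_rV_integral g h : Cc g -> Cc h -> (forall x, g x <= h x) -> J g <= J h.
Proof. by have [_ _ + _] := rV_integral_aux n; apply. Qed.
Lemma rV_integral_bound g (r B : R) : Cc g -> 0 <= r ->
  (forall x, r < `|x| -> g x = 0) -> (forall x, `|g x| <= B) ->
  `|J g| <= (2 * r) ^+ n * B.
Proof. by have [_ _ _ +] := rV_integral_aux n; apply. Qed.
Lemma rV_integral0 : J (fun _ : 'rV[R]_n => 0) = 0.
Proof.
have e := rV_integralZ 0 (Cc_cst0 R n).
rewrite -[RHS](mul0r (J (fun _ : 'rV[R]_n => 0))) -e.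
by congr J; apply/funext => x; rewrite mul0r.
Qed.
Lemma rV_integral_sum (I : Type) (s : seq I) (F : I -> 'rV[R]_n -> R) :
  (forall i, Cc (F i)) -> J (fun x => \sum_(i <- s) F i x) = \sum_(i <- s) J (F i).
Proof.
move=> hF; elim: s => [|i s IH].
  by rewrite big_nil -[RHS]rV_integral0; congr J; apply/funext => x; rewrite big_nil.
rewrite big_cons -IH -rV_integralD//; last exact: Cc_sum.
by congr J; apply/funext => x; rewrite big_cons.
Qed.
End rV_integral_properties.

Lemma slice_Cc_integral m (g : 'rV[R]_m.+1 -> R) : Cc g -> Cc (fun t => J (slice g t)).
Proof. by have [JD JZ _ Jb] := rV_integral_aux m; exact: slice_Cc_functional. Qed.

Lemma integral_rV_EFin n (g : 'rV[R]_n -> R) : Cc g ->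
  integral_rV (fun x => (g x)%:E) = (J g)%:E.
Proof.
elim: n g => [//|m IH] g gC /=.
transitivity (\int[mu]_(t in [set: R]) (J (slice g t))%:E)%E.
  by apply: eq_integral => t _; rewrite -IH//; exact: slice_Cc.
by rewrite /Rintegral fineK//; apply: integrable_fin_num => //; apply: Cc_integrable;
  exact: slice_Cc_integral.
Qed.

Definition C1c n (g : 'rV[R]_n -> R) : Prop :=
  [/\ forall x, differentiable g x, forall w, continuous ('D_w g) & bounded_support g].

Lemma C1c_Cc n (g : 'rV[R]_n -> R) : C1c g -> Cc g.
Proof. by move=> [dg _ sg]; split=> // x; exact: differentiable_continuous. Qed.

Lemma C1c_derive n (g : 'rV[R]_n -> R) w : C1c g -> Cc ('D_w g).
Proof.
move=> [dg cg [r r0 hr]]; split; first exact: cg.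
exists r => // x rx.
rewrite (near_eq_derive (g := cst 0)) ?derive_cst//.
have o : open [set y : 'rV[R]_n | r < `|y|].
  apply: (@open_comp _ _ (fun y : 'rV[R]_n => `|y|) [set t | r < t]); last exact: open_gt.
  by move=> y _; exact: norm_continuous.
by apply: filterS (open_nbhs_nbhs (conj o rx)) => y; exact: hr.
Qed.

Lemma row_mx_line m (h s t : R) (w y : 'rV[R]_m) :
  h *: row_mx (s%:M : 'M[R]_1) w + row_mx (t%:M : 'M[R]_1) y
  = row_mx ((h * s + t)%:M : 'M[R]_1) (h *: w + y).
Proof. by rewrite scale_row_mx add_row_mx scale_scalar_mx -raddfD. Qed.

Lemma derive_slice m (g : 'rV[R]_m.+1 -> R) t w y :
  'D_w (slice g t) y = 'D_(row_mx (0 : 'M[R]_1) w) g (row_mx (t%:M : 'M[R]_1) y).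
Proof.
rewrite /derive; set g1 := fun h => h^-1 *: _; set g2 := fun h => h^-1 *: _.
suff -> : g1 = g2 by [].
apply/funext => h; rewrite /g1 /g2 /slice /=; congr (_ *: (g _ - _)).
have := row_mx_line h 0 t w y; rewrite mulr0 add0r raddf0 => e; exact: esym e.
Qed.

Lemma derive_slice_first m (g : 'rV[R]_m.+1 -> R) t y :
  differentiable g (row_mx (t%:M : 'M[R]_1) y) ->
  is_derive t 1 (fun s => slice g s y)
    ('D_(row_mx (1%:M : 'M[R]_1) (0 : 'rV[R]_m)) g (row_mx (t%:M : 'M[R]_1) y)).
Proof.
move=> dg; set e1 := row_mx (1%:M : 'M[R]_1) (0 : 'rV[R]_m).
have E s : row_mx (s%:M : 'M[R]_1) y = s *: e1 + row_mx (0 : 'M[R]_1) y.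
  have := row_mx_line s 1 0 0 y; rewrite mulr1 addr0 scaler0 add0r raddf0 => e.
  exact: esym e.
rewrite (_ : (fun s => slice g s y) = fun s => g (row_mx (0 : 'M[R]_1) y + s *: e1)).
  apply: is_derive_along; rewrite addrC -E.
  by apply: derivableP; exact: diff_derivable.
by apply/funext => s; rewrite /slice E addrC.
Qed.

Lemma mvt_increment (f df : R -> R) (t h : R) : h != 0 ->
  (forall s : R, is_derive s 1 f (df s)) ->
  exists2 c, `|t - c| < `|h| & h^-1 * (f (h + t) - f t) = df c.
Proof.
move=> h0 hf; have [hn|hp|/eqP] := ltrgtP h 0; last by rewrite (negbTE h0).
- have ht : h + t < t by rewrite gtrDr.
  have [c /andP[c0 c1] e] := mvt_open ht (fun s _ => hf s).
  exists c; first by rewrite (ltr0_norm hn) gtr0_norm ?subr_gt0// ltrBlDr -ltrBlDl opprK addrC.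
  by rewrite -[f (h + t) - f t]opprB e; field.
- have ht : t < h + t by rewrite ltrDr.
  have [c /andP[c0 c1] e] := mvt_open ht (fun s _ => hf s).
  exists c; first by rewrite (gtr0_norm hp) distrC gtr0_norm ?subr_gt0// ltrBlDr.
  by rewrite e; field.
Qed.

(** The mean value theorem writes the difference quotient as the derivative at a point nearer than
    |h|; by uniform continuity it converges uniformly, on a bounded support. *)
Lemma is_derive_slice_integral m (g : 'rV[R]_m.+1 -> R) (t : R) : C1c g ->
  is_derive t 1 (fun s => J (slice g s))
    (J (slice ('D_(row_mx (1%:M : 'M[R]_1) (0 : 'rV[R]_m)) g) t)).
Proof.
move=> gC; set e1 := row_mx (1%:M : 'M[R]_1) (0 : 'rV[R]_m); have [dg _ [r r0 hr]] := gC.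
have gCc := C1c_Cc gC; have dC := C1c_derive e1 gC.
suff : (h^-1 *: (((fun s => J (slice g s)) \o shift t) (h *: 1) - J (slice g t)))
    @[h --> (0 : R)^'] --> J (slice ('D_e1 g) t).
  by move=> cv; split; [apply/cvg_ex; exists (J (slice ('D_e1 g) t))|exact: cvg_lim cv].
apply/cvgrPdist_lt => e e0.
have [_ [s s0 hs]] := dC.
pose u := r + s.
have u0 : 0 < u by exact: addr_gt0.
pose K := (2 * u) ^+ m + 1.
have K0 : 0 < K by rewrite ltr_wpDl// exprn_ge0// mulr_ge0// ltW.
have eK : 0 < e / K by rewrite divr_gt0.
have [d d0 hd] := Cc_unif_continuous dC eK.
apply/nbhs_ballP; exists d => // h; rewrite -ball_normE /= sub0r normrN => hd' h0.
rewrite [h *: 1]mulr1 /GRing.scale /=.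
pose q y := slice ('D_e1 g) t y + -1 * (h^-1 * (slice g (h + t) y + -1 * slice g t y)).
have c1 := slice_Cc t dC; have c2 := slice_Cc (h + t) gCc; have c3 := slice_Cc t gCc.
have qC : Cc q by apply: CcD => //; apply: CcZ; apply: CcZ; apply: CcD => //; exact: CcZ.
have -> : J (slice ('D_e1 g) t) - h^-1 * (J (slice g (h + t)) - J (slice g t)) = J q.
  rewrite /q rV_integralD//; last by apply: CcZ; apply: CcZ; apply: CcD => //; exact: CcZ.
  rewrite rV_integralZ; last by apply: CcZ; apply: CcD => //; exact: CcZ.
  rewrite rV_integralZ; last by apply: CcD => //; exact: CcZ.
  by rewrite rV_integralD ?rV_integralZ ?mulN1r//; exact: CcZ.
have : `|J q| <= (2 * u) ^+ m * (e / K).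
  apply: rV_integral_bound => //; first exact: ltW.
    move=> y uy; rewrite /q !(slice_support _ hr) ?(slice_support _ hs)//.
    - by rewrite !mulr0 addr0 !mulr0 addr0.
    - by apply: lt_trans uy; rewrite ltrDr.
    - by apply: lt_trans uy; rewrite ltrDl.
    - by apply: lt_trans uy; rewrite ltrDl.
  move=> y; rewrite /q !mulN1r.
  have [c ct ->] := mvt_increment t h0 (fun s => derive_slice_first (dg (row_mx (s%:M) y))).
  by rewrite ltW// hd// row_mx_subl (lt_trans ct).
move=> /le_lt_trans; apply.
by rewrite mulrCA gtr_pMr// ltr_pdivrMr// mul1r ltrDl.
Qed.

Lemma slice_C1c m (g : 'rV[R]_m.+1 -> R) t : C1c g -> C1c (slice g t).
Proof.
move=> gC; have [dg cg _] := gC; split.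
- move=> y; apply: (differentiable_comp (f := fun y => row_mx (t%:M : 'M[R]_1) y)) => //.
  apply: differentiable_mx => i k.
  case: (split_ordP k) => k' ->.
    rewrite (_ : (fun y => _) = cst (t%:M i k')); first exact: differentiable_cst.
    by apply/funext => z; rewrite row_mxEl.
  rewrite (_ : (fun y => _) = (fun y : 'rV[R]_m => y i k')); first exact: differentiable_coord.
  by apply/funext => z; rewrite row_mxEr.
- move=> w; rewrite (_ : 'D_w (slice g t) = slice ('D_(row_mx (0 : 'M[R]_1) w) g) t).
    by have [] := slice_Cc t (C1c_derive (row_mx (0 : 'M[R]_1) w) gC).
  by apply/funext => y; exact: derive_slice.
- by have [] := slice_Cc t (C1c_Cc gC).
Qed.

(** The first coordinate direction uses differentiation under the inner integral; the others follow
    slice by slice from the induction hypothesis. *)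
Lemma rV_integral_derive n : forall (g : 'rV[R]_n -> R) v, C1c g -> J ('D_v g) = 0.
Proof.
elim: n => [|m IH] g v gC.
  by rewrite /= (_ : v = 0) ?derive0//; apply/rowP => -[].
have gd : J ('D_(row_mx (1%:M : 'M[R]_1) (0 : 'rV[R]_m)) g) = 0.
  apply: (@Cc_Rintegral_derive R (fun t => J (slice g t))).
  - by move=> t; exact: is_derive_slice_integral.
  - exact: slice_Cc_integral (C1c_derive _ gC).
  - by have [] := slice_Cc_integral (C1c_Cc gC).
have gw w : J ('D_(row_mx (0 : 'M[R]_1) w) g) = 0.
  rewrite /=; transitivity (\int[mu]_(t in [set: R]) (0 : R)); last by rewrite /Rintegral integral0.
  apply: eq_Rintegral => t _.
  rewrite -[RHS](IH (slice g t) w (slice_C1c t gC)).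
  by congr J; apply/funext => y; rewrite derive_slice.
have [dg _ _] := gC.
pose a : R := (lsubmx (v : 'rV[R]_(1 + m))) 0 0.
have ev : v = a *: row_mx (1%:M : 'M[R]_1) 0 + row_mx (0 : 'M[R]_1) (rsubmx (v : 'rV[R]_(1 + m))).
  have := row_mx_line a 1 0 0 (rsubmx (v : 'rV[R]_(1 + m))).
  rewrite mulr1 addr0 scaler0 add0r raddf0 => e; apply: esym; apply: (etrans e).
  by rewrite -[RHS](@hsubmxK _ _ 1 m); congr row_mx; rewrite [RHS]mx11_scalar.
rewrite (_ : 'D_v g = fun x => a * 'D_(row_mx (1%:M : 'M[R]_1) 0) g x
   + 'D_(row_mx (0 : 'M[R]_1) (rsubmx (v : 'rV[R]_(1 + m)))) g x).
  rewrite rV_integralD; [|by apply: CcZ; exact: C1c_derive|exact: C1c_derive].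
  by rewrite rV_integralZ ?gd ?gw ?mulr0 ?addr0//; exact: C1c_derive.
by apply/funext => x; rewrite {1}ev deriveDv// deriveZv.
Qed.
(** By continuity [h] stays above [h t / 2] on an interval around [t], whose length gives a positive
    lower bound. *)
Lemma Cc_Rintegral_gt0 (h : R -> R) (t : R) : Cc h -> (forall s, 0 <= h s) -> 0 < h t ->
  0 < \int[mu]_s h s.
Proof.
move=> hC h0 ht.
have e0 : 0 < h t / 2 by rewrite divr_gt0.
have [ch _] := hC.
have : \forall s \near t, `|h t - h s| < h t / 2 by exact: (cvgrPdist_lt _ _).1 (ch t) _ e0.
move=> /nbhs_ballP [d /= d0 hd].
pose I : set R := [set` `[(t - d / 2), (t + d / 2)]%R].
have d2 : 0 < d / 2 by rewrite divr_gt0.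
have mI : measurable (I : set (measurableTypeR R)) by exact: measurable_itv.
have hI : mu.-integrable I (EFin \o h) by apply: integrableS (Cc_integrable hC).
have cI : mu.-integrable I (EFin \o (fun _ : R => h t / 2)).
  apply: continuous_compact_integrable; first exact: segment_compact.
  by apply: continuous_subspaceT; exact: cst_continuous.
apply: (@lt_le_trans _ _ (\int[mu]_(s in I) (h t / 2))).
  have E : fine (mu `[(t - d / 2), (t + d / 2)]) = d.
    rewrite lebesgue_measure_itv /= lte_fin ifT; last by lra.
    by rewrite /=; lra.
  by rewrite Rintegral_cst// mulr_gt0// /I E.
apply: (@le_trans _ _ (\int[mu]_(s in I) h s)).
  apply: le_Rintegral => // s; rewrite /I /= in_itv /= => /andP[s1 s2].
  have : `|h t - h s| < h t / 2.
    by apply: hd; rewrite -ball_normE /= ltr_norml; apply/andP; split; lra.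
  by rewrite ltr_norml => /andP[_ ?]; lra.
rewrite Rintegral_mkcond; apply: le_Rintegral => //.
- have -> : EFin \o (h \_ I) = (EFin \o h) \_ I.
    by apply/funext => s; rewrite /= !patchE; case: ifP.
  by rewrite -integrable_mkcond.
- exact: Cc_integrable.
- by move=> s _; rewrite patchE; case: ifP.
Qed.

Lemma rV_integral_gt0 n (g : 'rV[R]_n -> R) x : Cc g -> (forall y, 0 <= g y) -> 0 < g x ->
  0 < J g.
Proof.
elim: n g x => [g x _ _|m IH g x gC g0 gx]; first by rewrite (_ : x = 0)//; apply/rowP => -[].
pose t : R := (lsubmx (x : 'rV[R]_(1 + m))) 0 0.
apply: (@Cc_Rintegral_gt0 _ t); first exact: slice_Cc_integral gC.
  move=> s; rewrite -(rV_integral0 m).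
  by apply: le_rV_integral => [||y]; [exact: Cc_cst0|exact: (slice_Cc s gC)|exact: g0].
apply: (IH (slice g t) (rsubmx (x : 'rV[R]_(1 + m)))) => [|y|]; first exact: slice_Cc.
  exact: g0.
suff -> : slice g t (rsubmx (x : 'rV[R]_(1 + m))) = g x by [].
rewrite /slice (_ : (t%:M : 'M[R]_1) = lsubmx (x : 'rV[R]_(1 + m))).
  by congr g; exact: (@hsubmxK R 1 1 m x).
by rewrite [RHS]mx11_scalar.
Qed.
End rV_integral_theory.

(** * Functions of class C^k *)

(** k-fold Frechet differentiability, without continuity of the last derivatives; this is why C^1
    facts are drawn from [Ck 2]. *)
Fixpoint Ck (R : realType) (V : normedModType R) (k : nat) (f : V -> R) : Prop :=
  match k with
  | 0%N => True
  | k'.+1 => (forall x, differentiable f x) /\ forall v, Ck k' ('D_v f)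
  end.

Section Ck_theory.
Variables (R : realType) (V : normedModType R).
Implicit Types (f g u : V -> R) (k : nat).

Lemma Ck_intro k f (df : V -> V -> R) : (forall x, differentiable f x) ->
  (forall v x, 'D_v f x = df v x) -> (forall v, Ck k (df v)) -> Ck k.+1 f.
Proof.
by move=> d e h; split=> // v; rewrite (_ : 'D_v f = df v)//; apply/funext => x.
Qed.

Lemma Ck_pred k f : Ck k.+1 f -> Ck k f.
Proof. by elim: k f => // k IH f [d h]; split=> // v; apply: IH; exact: h. Qed.

Lemma Ck_differentiable k f x : Ck k.+1 f -> differentiable f x.
Proof. by case=> + _; apply. Qed.

Lemma Ck_is_derive k f x v : Ck k.+1 f -> is_derive x v f ('D_v f x).
Proof. by move=> /Ck_differentiable d; apply: derivableP; exact: diff_derivable. Qed.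

Lemma Ck_cst k (a : R) : Ck k (fun _ : V => a).
Proof.
elim: k a => // k IH a; apply: (Ck_intro (df := fun _ _ => 0)) => [x|v x|v] //.
exact: derive_cst.
Qed.

Lemma CkD k f g : Ck k f -> Ck k g -> Ck k (fun x => f x + g x).
Proof.
elim: k f g => // k IH f g cf cg.
apply: (Ck_intro (df := fun v x => 'D_v f x + 'D_v g x)) => [x|v x|v].
- by apply: differentiableD; apply: Ck_differentiable; [exact: cf|exact: cg].
- have hf := Ck_is_derive x v cf; have hg := Ck_is_derive x v cg.
  exact: (@derive_val _ _ _ _ _ _ _ (is_deriveD hf hg)).
- by apply: IH; [case: cf => _ + |case: cg => _ +]; apply.
Qed.

Lemma CkM k f g : Ck k f -> Ck k g -> Ck k (fun x => f x * g x).
Proof.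
elim: k f g => // k IH f g cf cg.
apply: (Ck_intro (df := fun v x => f x * 'D_v g x + g x * 'D_v f x)) => [x|v x|v].
- by apply: differentiableM; apply: Ck_differentiable; [exact: cf|exact: cg].
- have hf := Ck_is_derive x v cf; have hg := Ck_is_derive x v cg.
  exact: (@derive_val _ _ _ _ _ _ _ (is_deriveM hf hg)).
- have pf := Ck_pred cf; have pg := Ck_pred cg.
  by apply: CkD; apply: IH => //; [case: cg => _ + |case: cf => _ +]; apply.
Qed.

Lemma CkZ k (a : R) f : Ck k f -> Ck k (fun x => a * f x).
Proof. by apply: CkM; exact: Ck_cst. Qed.

Lemma CkN k f : Ck k f -> Ck k (fun x => - f x).
Proof.
by move=> /(CkZ (-1)); rewrite (_ : (fun x => -1 * f x) = fun x => - f x)//;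
  apply/funext => x; rewrite mulN1r.
Qed.

Lemma CkB k f g : Ck k f -> Ck k g -> Ck k (fun x => f x - g x).
Proof. by move=> cf cg; apply: (CkD cf); exact: CkN. Qed.

Lemma Ck_sum k (I : Type) (s : seq I) (F : I -> V -> R) :
  (forall i, Ck k (F i)) -> Ck k (fun x => \sum_(i <- s) F i x).
Proof.
move=> cF; elim: s => [|i s IH].
  rewrite (_ : (fun x => _) = fun=> 0); first exact: Ck_cst.
  by apply/funext => x; rewrite big_nil.
rewrite (_ : (fun x => _) = fun x => F i x + \sum_(i <- s) F i x); first exact: CkD.
by apply/funext => x; rewrite big_cons.
Qed.

Lemma is_derive_chain f (phi : R -> R) (dphi : R) x v df :
  is_derive x v f df -> is_derive (f x) 1 phi dphi ->
  is_derive x v (fun y => phi (f y)) (dphi * df).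
Proof.
move=> hf hphi; have dphi' : differentiable phi (f x).
  by apply/derivable1_diffP; case: hphi.
apply: (is_derive_eq (is_derive_comp hf dphi')).
have -> : df = df *: (1 : R) by rewrite /GRing.scale /= mulr1.
rewrite deriveZv//; have -> : 'D_1 phi (f x) = dphi by case: hphi.
by rewrite /GRing.scale /= mulr1 mulrC.
Qed.

(** [phi] is differentiated only at values of [u], which admits inverses and logarithms; the
    hypothesis on [dphi] is the one that an induction on [k] provides. *)
Lemma Ck_chain k u (phi dphi : R -> R) :
  (forall x, is_derive (u x) 1 phi (dphi (u x))) ->
  Ck k (fun x => dphi (u x)) -> Ck k.+1 u -> Ck k.+1 (fun x => phi (u x)).
Proof.
move=> hphi cd cu.
apply: (Ck_intro (df := fun v x => dphi (u x) * 'D_v u x)) => [x|v x|v].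
- apply: differentiable_comp; first exact: Ck_differentiable cu.
  by apply/derivable1_diffP; case: (hphi x).
- exact: (@derive_val _ _ _ _ _ _ _ (is_derive_chain (Ck_is_derive x v cu) (hphi x))).
- by apply: CkM => //; case: cu => _; apply.
Qed.

Lemma Ck_inv k f : (forall x, f x != 0) -> Ck k f -> Ck k (fun x => (f x)^-1).
Proof.
move=> f0; elim: k f f0 => // k IH f f0 cf.
apply: (Ck_chain (phi := fun t => t^-1) (dphi := fun t => - (t ^-1 * t^-1))) (cf).
- move=> x; have fx := f0 x; have h : is_derive (f x) 1 (@id R) 1 by exact: is_derive_id.
  apply: (is_derive_eq (is_deriveV fx h)).
  by rewrite /GRing.scale /= mulr1 -exprVn expr2.
- have ci : Ck k (fun x => (f x)^-1) by apply: IH => //; exact: Ck_pred cf.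
  by apply: CkN; exact: CkM.
Qed.

Lemma Ck_expR k f : Ck k f -> Ck k (fun x => expR (f x)).
Proof.
elim: k f => // k IH f cf.
apply: (Ck_chain (phi := expR) (dphi := expR)) (cf).
by apply: IH; exact: Ck_pred.
Qed.

Lemma Ck_ln k f : (forall x, 0 < f x) -> Ck k f -> Ck k (fun x => ln (f x)).
Proof.
move=> f0; case: k => // k cf.
apply: (Ck_chain (phi := @ln R) (dphi := fun t => t^-1)) (cf).
  by move=> x; exact: is_derive1_ln.
by apply: Ck_inv; [move=> x; rewrite gt_eqF|exact: Ck_pred cf].
Qed.
End Ck_theory.

Lemma is_derive_inv (R : realType) (s : R) : s != 0 ->
  is_derive s 1 (fun t : R => t^-1) (- s ^- 2).
Proof.
move=> s0; have h : is_derive s 1 (@id R) 1 by exact: is_derive_id.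
by apply: (is_derive_eq (is_deriveV s0 h)); rewrite /GRing.scale /= mulr1.
Qed.

Section expinv.
Variable R : realType.
Implicit Types (k : nat) (z : R).

(** The flat function exp (- 1 / z) times z^(-k), extended by 0. Derivatives stay in the span of the
    family, so one induction gives smoothness. *)
Definition expinv k z : R := if 0 < z then z^-1 ^+ k * expR (- z^-1) else 0.

Lemma bump_ge0 k z : 0 <= expinv k z.
Proof.
rewrite /expinv; case: ifP => // z0.
by rewrite mulr_ge0 ?expR_ge0// exprn_ge0// invr_ge0 ltW.
Qed.

(** From t^(k + 2) / (k + 2)! <= exp t at t = 1 / z. A quadratic bound is what makes the derivative
    at 0 exist and vanish. *)
Lemma bump_le k z : expinv k z <= (k.+2)`!%:R * z ^+ 2.
Proof.
rewrite /expinv; case: ifP => [z0|_]; last by rewrite mulr_ge0 ?sqr_ge0.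
have t0 : 0 < z^-1 by rewrite invr_gt0.
have h : z^-1 ^+ k.+2 / (k.+2)`!%:R <= expR z^-1.
  by apply: le_trans (expR_ge1Dxn _ (ltW t0)); rewrite ler_wpDl.
have f0 : 0 < (k.+2)`!%:R :> R by rewrite ltr0n fact_gt0.
rewrite expRN ler_pdivrMr ?expR_gt0//.
have -> : z^-1 ^+ k = (k.+2)`!%:R * z ^+ 2 * (z^-1 ^+ k.+2 / (k.+2)`!%:R).
  by rewrite !exprS; field; rewrite !gt_eqF.
by rewrite ler_wpM2l// mulr_ge0 ?sqr_ge0// ltW.
Qed.

Lemma is_derive_bump k z :
  is_derive z 1 (expinv k) (expinv k.+2 z - k%:R * expinv k.+1 z).
Proof.
have [z0|z0|z0] := ltrgtP z 0.
- rewrite /expinv ltNge ltW// mulr0 subr0.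
  apply: (@near_eq_is_derive _ _ _ (cst 0)).
    by near=> t; rewrite /expinv ltNge ltW//; near: t; exact: lt_nbhsl.
- rewrite /expinv z0.
  apply: (@near_eq_is_derive _ _ _ (fun t : R => t^-1 ^+ k * expR (- t^-1))).
    by near=> t; rewrite /expinv ifT//; near: t; exact: lt_nbhsr.
  have hi : is_derive z 1 (fun t : R => t^-1) (- z ^- 2).
    by apply: is_derive_inv; rewrite gt_eqF.
  pose s := z^-1.
  have hX : is_derive s 1 (fun t : R => t ^+ k) (k%:R * s ^+ k.-1).
    rewrite (_ : (fun t : R => t ^+ k) = (@id R) ^+ k); last first.
      by apply/funext => t; rewrite exprfctE.
    by apply: (is_derive_eq (is_deriveX k (is_derive_id s 1))); rewrite /GRing.scale /= mulr1.
  have hN : is_derive s 1 (fun t : R => - t) (- 1).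
    exact: is_deriveN.
  have hE := is_derive_chain hN (is_derive_expR (- s)).
  apply: (is_derive_eq (is_derive_chain hi (is_deriveM hX hE))).
  rewrite /GRing.scale /= -/s -exprVn -/s.
  case: k {hX} => [|k]; first by rewrite !expr0 !mul0r mulr0 addr0 subr0; ring.
  by rewrite /= !exprS; ring.
- rewrite z0 {2 3}/expinv ltxx mulr0 subr0.
  suff : (h^-1 *: ((expinv k \o shift 0) (h *: 1) - expinv k 0)) @[h --> (0 : R)^'] --> (0 : R).
    by move=> cv; split; [apply/cvg_ex; exists 0|exact: cvg_lim cv].
  apply/cvgrPdist_lt => e e0.
  pose C : R := (k.+2)`!%:R.
  have C0 : 0 < C by rewrite ltr0n fact_gt0.
  apply/nbhs_ballP; exists (e / C); first by rewrite /= divr_gt0.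
  move=> h; rewrite -ball_normE /= !sub0r !normrN ltr_pdivlMr// => he h0.
  rewrite [h *: 1]mulr1 addr0 {2}/expinv ltxx subr0 /GRing.scale /=.
  rewrite normrM normfV (ger0_norm (bump_ge0 k h)).
  have hp : 0 < `|h| by rewrite normr_gt0.
  rewrite mulrC ltr_pdivrMr// (le_lt_trans (bump_le k h))// -[h ^+ 2]real_normK ?num_real//.
  by rewrite expr2 mulrA ltr_pM2r// mulrC.
Unshelve. all: by end_near. Qed.
End expinv.

Lemma Ck_bump (R : realType) (V : normedModType R) j k (f : V -> R) :
  Ck k f -> Ck k (fun x => expinv j (f x)).
Proof.
elim: k j f => // k IH j f cf.
apply: (Ck_chain (phi := expinv j) (dphi := fun z => expinv j.+2 z - j%:R * expinv j.+1 z)) (cf).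
  by move=> x; exact: is_derive_bump.
have cp := Ck_pred cf.
by apply: CkB; [exact: IH|apply: CkZ; exact: IH].
Qed.

Section Ck_rV.
Variables (R : realType) (n : nat).
Implicit Type f : 'rV[R]_n -> R.

Lemma derive_coord (x v : 'rV[R]_n) i : 'D_v (fun y : 'rV[R]_n => y 0 i) x = v 0 i.
Proof.
have := (is_derive_mx (fun y : 'rV[R]_n => y) x v v).2 (is_derive_id x v) 0 i.
by move=> h; exact: (@derive_val _ _ _ _ _ _ _ h).
Qed.

Lemma Ck_coord k i : Ck k (fun x : 'rV[R]_n => x 0 i).
Proof.
case: k => // k; apply: (Ck_intro (df := fun v _ : 'rV[R]_n => v 0 i)) => [x|v x|v].
- exact: differentiable_coord.
- exact: derive_coord.
- exact: Ck_cst.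
Qed.

Lemma Ck_smooth_on f : (forall k, Ck k f) -> smooth_on setT f.
Proof.
suff h s : forall f, Ck (size s).+1 f ->
    forall x, differentiable (foldr (fun v g y => 'D_v g y) f s) x.
  by move=> cf s x _; exact: h.
elim/last_ind: s => [g [dg _]//|s v IH g].
by rewrite size_rcons foldr_rcons => -[_ cg] x; apply: IH; exact: cg.
Qed.

Lemma smooth_on_Ck k f : smooth_on setT f -> Ck k f.
Proof.
elim: k f => // k IH f sf; split=> [x|v].
  exact: (smooth_on_differentiable sf).
by apply: IH; exact: smooth_on_derive _ sf.
Qed.

Lemma Ck_C1c f : Ck 2 f -> bounded_support f -> C1c f.
Proof.
move=> [df cf] sf; split=> // w x; apply: differentiable_continuous.
by have [+ _] := cf w; apply.
Qed.

Lemma Ck_continuous k f : Ck k.+1 f -> continuous f.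
Proof. by move=> [df _] x; exact: differentiable_continuous. Qed.
End Ck_rV.

(** * Integration on the hyperboloid *)

(** Multiplying [B] by the triangular [L] on the right, then on the left, exposes its Schur
    complements of size 1 and of size n; both products have the determinant of [B]. *)
Lemma det_one_sub_outer (R : realType) (n : nat) (a : R) (x : 'rV[R]_n) :
  \det (1%:M - a *: (x^T *m x)) = 1 - a * (x *m x^T) 0 0.
Proof.
pose u := a *: x^T.
pose L : 'M[R]_(1 + n) := block_mx 1%:M 0 (- u) 1%:M.
pose B : 'M[R]_(1 + n) := block_mx 1%:M x u 1%:M.
have dL : \det L = 1 by rewrite det_lblock !det1 mulr1.
have e1 : B *m L = block_mx (1%:M - x *m u) x 0 1%:M.
  by rewrite mulmx_block !mulmx1 !mul1mx !mulmx0 !add0r mulmxN subrr.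
have e2 : L *m B = block_mx 1%:M x 0 (1%:M - u *m x).
  by rewrite mulmx_block !mulmx1 !mul1mx !mul0mx !addr0 mulNmx addNr addrC.
have := congr1 determinant e1; have := congr1 determinant e2.
rewrite !det_mulmx dL mulr1 mul1r !det_ublock !det1 mulr1 mul1r => -> E.
have -> : a *: (x^T *m x) = u *m x by rewrite scalemxAl.
by rewrite E det_mx11 /u -scalemxAr !mxE mulr1n.
Qed.

Section hyperbolic.
Variables (R : realType) (n : nat) (kappa : R).
Hypothesis k0 : 0 < kappa.
Implicit Types (x : 'rV[R]_n) (f u : 'rV[R]_n -> R).

Local Notation W := (hyperbolic_space n kappa).
Local Notation J := (@rV_integral R n).

Definition sqn x : R := \sum_k x 0 k ^+ 2.
(** With x_0 the height on the hyperboloid, [radius2] is (kappa x_0)^2; hence [log_radius] is ln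
    (kappa x_0) and [vol_density] is 1 / (kappa x_0). *)
Definition radius2 x : R := 1 + kappa ^+ 2 * sqn x.
Definition log_radius x : R := ln (radius2 x) / 2.
Definition vol_density x : R := expR (- log_radius x).

Lemma sqnE x : (x *m x^T) 0 0 = sqn x.
Proof. by rewrite mxE; apply: eq_bigr => k _; rewrite mxE expr2. Qed.

Lemma sqn_ge0 x : 0 <= sqn x.
Proof. by apply: sumr_ge0 => k _; exact: sqr_ge0. Qed.

Lemma radius2_ge1 x : 1 <= radius2 x.
Proof. by rewrite lerDl mulr_ge0 ?sqn_ge0// sqr_ge0. Qed.

Lemma radius2_gt0 x : 0 < radius2 x.
Proof. exact: lt_le_trans ltr01 (radius2_ge1 x). Qed.

Lemma rho_gt0 x : 0 < vol_density x. Proof. exact: expR_gt0. Qed.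

Lemma expR_ell x : expR (2 * log_radius x) = radius2 x.
Proof. by rewrite /log_radius mulrC divfK// lnK// posrE radius2_gt0. Qed.

Lemma rho_sqr x : vol_density x ^+ 2 = (radius2 x)^-1.
Proof. by rewrite /vol_density -expRM_natl mulrN expRN expR_ell. Qed.

Lemma hyperbolic_det x : Num.sqrt (\det (@gram _ _ W tt x)) = vol_density x.
Proof.
rewrite /= det_one_sub_outer sqnE.
have -> : 1 - (kappa ^- 2 + sqn x)^-1 * sqn x = vol_density x ^+ 2.
  rewrite rho_sqr /radius2; have k1 : kappa != 0 by rewrite gt_eqF.
  have := radius2_gt0 x; rewrite /radius2 => T0.
  have E : kappa ^- 2 + sqn x = (1 + kappa ^+ 2 * sqn x) / kappa ^+ 2 by field.
  by rewrite E; field; rewrite k1 gt_eqF.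
by rewrite sqrtr_sqr gtr0_norm// rho_gt0.
Qed.

(** The Sherman-Morrison inverse of a rank-one perturbation of the identity. *)
Lemma hyperbolic_invmx x :
  invmx (@gram _ _ W tt x) = 1%:M + kappa ^+ 2 *: (x^T *m x).
Proof.
rewrite /=; set G := _ - _; set X := x^T *m x.
have XX : X *m X = sqn x *: X.
  by rewrite /X mulmxA -(mulmxA x^T) [x *m x^T]mx11_scalar sqnE mul_mx_scalar -scalemxAl.
have GX : G *m (1%:M + kappa ^+ 2 *: X) = 1%:M.
  rewrite /G -/X sqnE mulmxDr mulmx1 mulmxBl mul1mx -!scalemxAr -!scalemxAl XX.
  rewrite !scalerA -addrA -[RHS]addr0; congr (_ + _).
  rewrite -scalerBl -scaleNr -scalerDl; apply/eqP; rewrite scaler_eq0; apply/orP; left.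
  have k1 : kappa != 0 by rewrite gt_eqF.
  have := radius2_gt0 x; rewrite /radius2 => T0.
  have -> : kappa ^- 2 + sqn x = (1 + kappa ^+ 2 * sqn x) / kappa ^+ 2 by field.
  by apply/eqP; field; rewrite k1 gt_eqF.
have uG : G \in unitmx by have [] := mulmx1_unit GX.
by rewrite -[RHS](mulKmx uG) GX mulmx1.
Qed.

Definition pderiv f k x : R := 'D_(delta_mx 0 k) f x.
Definition radial_deriv f x : R := \sum_k x 0 k * pderiv f k x.

Lemma hyperbolic_grad f x : @grad_sqnorm _ _ W f x =
  \sum_k pderiv f k x ^+ 2 + kappa ^+ 2 * radial_deriv f x ^+ 2.
Proof.
rewrite /grad_sqnorm hyperbolic_invmx; set d := \row_k _.
have dk k : d 0 k = pderiv f k x by rewrite mxE.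
have E : (x *m d^T) 0 0 = radial_deriv f x.
  by rewrite mxE; apply: eq_bigr => k _; rewrite !mxE.
have E' : d *m x^T = (radial_deriv f x)%:M.
  rewrite [LHS]mx11_scalar; congr (_%:M); rewrite mxE.
  by apply: eq_bigr => k _; rewrite !mxE mulrC.
have -> : \sum_k pderiv f k x ^+ 2 = (d *m d^T) 0 0.
  by rewrite sqnE; apply: eq_bigr => k _; rewrite dk.
transitivity ((d *m (1%:M + kappa ^+ 2 *: (x^T *m x)) *m d^T) 0 0) => [//|].
rewrite mulmxDr mulmx1 mulmxDl [LHS]mxE; congr (_ + _).
by rewrite -scalemxAr -scalemxAl mxE mulmxA E' mul_scalar_mx -scalemxAl mxE E expr2.
Qed.

Lemma closed_support_bounded (h : 'rV[R]_n -> R) :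
  compact (closed_support h) -> bounded_support h.
Proof.
move=> /compact_bounded [M [_ hM]].
have M1 : M < `|M| + 1 by rewrite (le_lt_trans (ler_norm M))// ltrDl.
exists (`|M| + 1) => [|x xM]; first by rewrite ltr_pwDr.
apply/eqP/negPn/negP => hx; have := hM _ M1 x (@subset_closure _ [set y | h y != 0] x hx).
by rewrite /= leNgt xM.
Qed.

Lemma bounded_closed_support (h : 'rV[R]_n -> R) :
  bounded_support h -> compact (closed_support h).
Proof.
move=> [r r0 hr]; apply: subclosed_compact (@closed_ball_rV_compact R n r) _.
  exact: closed_closure.
rewrite /closed_support closureE; apply: smallest_sub; last first.
  by move=> x /= hx; rewrite leNgt; apply: contra_neqN hx => /hr.
apply: (@closed_comp _ _ (fun x : 'rV[R]_n => `|x|) [set t | t <= r]); last exact: closed_le.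
by move=> x _; exact: norm_continuous.
Qed.

Lemma Ck_radius2 k : Ck k radius2.
Proof.
apply: CkD; first exact: Ck_cst.
by apply: CkZ; apply: Ck_sum => i; apply: CkM; exact: Ck_coord.
Qed.

Lemma Ck_ell k : Ck k log_radius.
Proof.
rewrite (_ : log_radius = fun x => 2^-1 * ln (radius2 x)).
  by apply: CkZ; apply: Ck_ln; [exact: radius2_gt0|exact: Ck_radius2].
by apply/funext => x; rewrite /log_radius mulrC.
Qed.

Lemma Ck_rho k : Ck k vol_density.
Proof. by apply: Ck_expR; apply: CkN; exact: Ck_ell. Qed.

Lemma Cc_density u : Cc u -> Cc (fun x => u x * vol_density x).
Proof.
move=> cu; rewrite (_ : (fun x => _) = fun x => vol_density x * u x).
  by apply: CcM => //; exact: Ck_continuous (Ck_rho 1).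
by apply/funext => x; rewrite mulrC.
Qed.

Lemma hyperbolic_chart_integral (i : Defs.index W) u : Cc u ->
  @chart_integral _ _ W i u = (J (fun x => u x * vol_density x))%:E.
Proof.
move=> cu; case: i; rewrite /chart_integral -integral_rV_EFin; last exact: Cc_density.
congr integral_rV; apply/funext => x; rewrite hyperbolic_det.
rewrite indicE mem_set; first by rewrite mul1r.
by exists x.
Qed.

(** The chart is global, so the one-member family [u] attains the supremum; for any other family the
    integrals add up to that of a sum bounded by [u]. *)
Lemma hyperbolic_integral u : Cc u -> (forall x, 0 <= u x) ->
  @riem_integral _ _ W u = (J (fun x => u x * vol_density x))%:E.
Proof.
move=> cu u0; apply/eqP; rewrite eq_le; apply/andP; split.
- apply: ge_ereal_sup => s [k [c [h [hC hu ->]]]].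
  have hCc a : Cc (h a).
    by have [ch _ /closed_support_bounded sh _] := hC a; split.
  under eq_bigr => a _ do rewrite hyperbolic_chart_integral//.
  rewrite sumEFin lee_fin -rV_integral_sum; last by move=> a; exact: Cc_density.
  apply: le_rV_integral; [by apply: Cc_sum => a _; exact: Cc_density|exact: Cc_density|].
  by move=> x; rewrite -mulr_suml ler_pM2r ?rho_gt0//; exact: hu.
- apply: ereal_sup_ubound; exists 1, (fun=> tt), (fun=> u); split.
  + move=> _; split=> //; first by have [] := cu.
    by apply: bounded_closed_support; have [] := cu.
  + by move=> x; rewrite big_ord1.
  + by rewrite big_ord1 hyperbolic_chart_integral.
Qed.

End hyperbolic.

(** The empty family competes in the supremum with the value 0. *)
Lemma riem_integral_ge0 (R : realType) (n : nat) (W : riemannian R n) (u : W -> R) :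
  (forall p, 0 <= u p) -> (0 <= riem_integral u)%E.
Proof.
move=> u0; apply: ereal_sup_ubound.
exists 0, (fun i : 'I_0 => False_rect _ (notF (valP i))), (fun _ _ => 0); split.
- by case.
- by move=> p; rewrite big_ord0.
- by rewrite big_ord0.
Qed.

(** * Lower bound for the fundamental tone *)

Lemma sum_delta (R : pzRingType) (n : nat) (i0 : 'I_n) (a : 'I_n -> R) :
  \sum_k (k == i0)%:R * a k = a i0.
Proof.
rewrite (bigD1 i0)//= eqxx mul1r big1 ?addr0// => k /negbTE ->.
by rewrite mul0r.
Qed.

Section test_functions.
Variables (R : realType) (n : nat) (kappa : R).
Hypothesis k0 : 0 < kappa.
Implicit Types (x : 'rV[R]_n) (f u : 'rV[R]_n -> R).

Local Notation W := (hyperbolic_space n kappa).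
Local Notation J := (@rV_integral R n).
Local Notation rho := (vol_density kappa).
Local Notation ell := (log_radius kappa).
Local Notation grad f := (@grad_sqnorm _ _ W f).

Lemma hyperbolic_test f : @test_function _ _ W f <-> (forall k, Ck k f) /\ bounded_support f.
Proof.
split=> [[sf cf]|[cf sf]]; split.
- move=> k; apply: smooth_on_Ck => s x _.
  by apply: (sf tt s x); exists x.
- exact: closed_support_bounded.
- move=> i s x _; exact: (Ck_smooth_on cf).
- exact: bounded_closed_support.
Qed.

Lemma test_C1c f : @test_function _ _ W f -> C1c f.
Proof. by move=> /hyperbolic_test[cf sf]; exact: Ck_C1c. Qed.

Lemma Cc_sqr f : Cc f -> Cc (fun x => f x ^+ 2).
Proof.
move=> cf; rewrite (_ : (fun x => _) = fun x => f x * f x).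
  by apply: CcM => //; case: cf.
by apply/funext => x; rewrite expr2.
Qed.

Lemma Cc_grad f : C1c f -> Cc (grad f).
Proof.
move=> cf; rewrite (_ : grad f = fun x =>
  \sum_k pderiv f k x ^+ 2 + kappa ^+ 2 * radial_deriv f x ^+ 2).
  apply: CcD; first by apply: Cc_sum => k _; apply: Cc_sqr; exact: C1c_derive.
  apply: CcZ; apply: Cc_sqr; apply: Cc_sum => k _; apply: CcM; last exact: C1c_derive.
  exact: Ck_continuous (Ck_coord R 1 k).
by apply/funext => x; exact: hyperbolic_grad.
Qed.

Lemma grad_ge0 f x : 0 <= grad f x.
Proof.
rewrite hyperbolic_grad// addr_ge0//; first by apply: sumr_ge0 => k _; exact: sqr_ge0.
by rewrite mulr_ge0 ?sqr_ge0.
Qed.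

Lemma hyperbolic_mass f : Cc f -> @mass _ _ W f = (J (fun x => f x ^+ 2 * rho x))%:E.
Proof.
move=> cf; apply: hyperbolic_integral => //; first exact: Cc_sqr.
by move=> x; exact: sqr_ge0.
Qed.

Lemma hyperbolic_energy f : C1c f -> @energy _ _ W f = (J (fun x => grad f x * rho x))%:E.
Proof.
move=> cf; apply: hyperbolic_integral => //; first exact: Cc_grad.
by move=> x; exact: grad_ge0.
Qed.

Definition dotp (v x : 'rV[R]_n) : R := \sum_k x 0 k * v 0 k.

Lemma dotp_delta k x : dotp (delta_mx 0 k) x = x 0 k.
Proof.
rewrite /dotp -[RHS](sum_delta k (fun j => x 0 j)); apply: eq_bigr => j _.
by rewrite mxE eqxx /= mulrC.
Qed.

Lemma is_derive_radius2 (x v : 'rV[R]_n) :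
  is_derive x v (radius2 kappa) (2 * kappa ^+ 2 * dotp v x).
Proof.
have h k : is_derive x v (fun y : 'rV[R]_n => y 0 k ^+ 2) (2 * (x 0 k * v 0 k)).
  have hc : is_derive x v (fun y : 'rV[R]_n => y 0 k) (v 0 k).
    exact: (is_derive_mx (fun y : 'rV[R]_n => y) x v v).2 (is_derive_id x v) 0 k.
  rewrite (_ : (fun y => _) = (fun y : 'rV[R]_n => y 0 k) * (fun y : 'rV[R]_n => y 0 k)).
    apply: (is_derive_eq (is_deriveM hc hc)).
    by rewrite /GRing.scale /= mulr_natl mulr2n.
  by apply/funext => y; rewrite expr2.
have hs := is_derive_sum_fin h.
rewrite (_ : radius2 kappa = fun y => 1 + kappa ^+ 2 * (\sum_k y 0 k ^+ 2))//.
have hz := is_derive_chain (phi := fun t => 1 + kappa ^+ 2 * t) (dphi := kappa ^+ 2) hs.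
apply: (is_derive_eq (hz _)); last by rewrite -mulr_sumr /dotp; ring.
have ht := is_deriveD (is_derive_cst (1 : R) (\sum_k x 0 k ^+ 2) (1 : R))
  (is_deriveZ (kappa ^+ 2) (is_derive_id (\sum_k x 0 k ^+ 2) (1 : R))).
by apply: (is_derive_eq ht); rewrite add0r /GRing.scale /= mulr1.
Qed.

Lemma is_derive_ell (x v : 'rV[R]_n) :
  is_derive x v ell (kappa ^+ 2 * rho x ^+ 2 * dotp v x).
Proof.
have T0 := radius2_gt0 kappa x.
have hl := is_derive_chain (is_derive_radius2 x v) (is_derive1_ln T0).
have := is_deriveZ (2^-1) hl.
rewrite (_ : _ \*: _ = ell); last by apply/funext => y; rewrite /log_radius /= mulrC.
move=> h; apply: (is_derive_eq h).
by rewrite rho_sqr// /GRing.scale /=; field; rewrite gt_eqF.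
Qed.

Lemma is_derive_radial (phi : R -> R) dphi (x v : 'rV[R]_n) :
  is_derive (ell x) 1 phi dphi ->
  is_derive x v (fun y => phi (ell y)) (dphi * (kappa ^+ 2 * rho x ^+ 2 * dotp v x)).
Proof. by move=> h; exact: is_derive_chain (is_derive_ell x v) h. Qed.

Lemma is_derive_rho (x v : 'rV[R]_n) :
  is_derive x v rho (- rho x * (kappa ^+ 2 * rho x ^+ 2 * dotp v x)).
Proof.
apply: (is_derive_radial (phi := fun t => expR (- t))).
have h := is_derive_chain (is_deriveN (is_derive_id (ell x) (1 : R))) (is_derive_expR (- ell x)).
by apply: (is_derive_eq h); rewrite mulrN1.
Qed.

(** * The Busemann field and the spectral lower bound *)

Section lower_bound.
Variable i0 : 'I_n.

(* [ln (kappa * horo) / kappa] is a Busemann function, and [horo_grad] its Riemannian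
   gradient: it has norm 1 and divergence [(n - 1) * kappa]. *)
Definition horo x : R := expR (ell x) / kappa - x 0 i0.
Definition horo_grad k x : R := kappa * x 0 k - (k == i0)%:R / (kappa * horo x).

Lemma kappa_rho_horo x : kappa * rho x * horo x = 1 - kappa * rho x * x 0 i0.
Proof.
rewrite /horo mulrBr; congr (_ - _).
have -> : expR (ell x) = (rho x)^-1 by rewrite /vol_density expRN invrK.
have := rho_gt0 kappa x; move: (rho x) => r r0.
by field; rewrite !gt_eqF.
Qed.

Lemma kappa_sqn x : kappa ^+ 2 * sqn x = rho x ^- 2 - 1.
Proof. by rewrite rho_sqr// invrK /radius2 addrC addKr. Qed.

Lemma horo_gt0 x : 0 < horo x.
Proof.
have r0 := rho_gt0 kappa x.
have : 0 < kappa * rho x * horo x; last by rewrite pmulr_rgt0// mulr_gt0.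
rewrite kappa_rho_horo subr_gt0 -[_ * x 0 i0]mulrAC.
have [x0|x0] := leP (x 0 i0) 0.
  by apply: le_lt_trans ltr01; rewrite -mulrA mulrCA mulr_le0_ge0// ?ltW// mulr_gt0.
rewrite -(ltr_pXn2r (n := 2)) ?nnegrE ?mulr_ge0// ?ltW// expr1n.
have : x 0 i0 ^+ 2 <= sqn x by rewrite /sqn (bigD1 i0)//= lerDl sumr_ge0// => k _; exact: sqr_ge0.
rewrite -(ler_pM2l (x := kappa ^+ 2)) ?exprn_gt0// kappa_sqn => h.
have : kappa ^+ 2 * x 0 i0 ^+ 2 < rho x ^- 2 by apply: le_lt_trans h _; rewrite ltrBlDr ltrDl.
have r2 : 0 < rho x ^+ 2 by rewrite exprn_gt0.
move=> h2; have : kappa ^+ 2 * x 0 i0 ^+ 2 * rho x ^+ 2 < rho x ^- 2 * rho x ^+ 2.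
  by rewrite ltr_pM2r.
rewrite mulVf ?gt_eqF//.
by apply: le_lt_trans; rewrite le_eqVlt; apply/orP; left; apply/eqP; ring.
Qed.

Lemma Ck_horo k : Ck k horo.
Proof.
apply: CkB; last exact: Ck_coord.
rewrite (_ : (fun x => _) = fun x => kappa^-1 * expR (ell x)).
  by apply: CkZ; apply: Ck_expR; exact: Ck_ell.
by apply/funext => x; rewrite mulrC.
Qed.

Lemma Ck_horo_grad m k : Ck m (horo_grad k).
Proof.
apply: CkB; first by apply: CkZ; exact: Ck_coord.
apply: CkM; first exact: Ck_cst.
apply: Ck_inv; last by apply: CkZ; exact: Ck_horo.
by move=> x; rewrite mulf_neq0// gt_eqF// horo_gt0.
Qed.

Lemma is_derive_horo (x v : 'rV[R]_n) :
  is_derive x v horo (kappa * rho x * dotp v x - v 0 i0).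
Proof.
have hc : is_derive x v (fun y : 'rV[R]_n => y 0 i0) (v 0 i0).
  exact: (is_derive_mx (fun y : 'rV[R]_n => y) x v v).2 (is_derive_id x v) 0 i0.
have he := is_derive_radial v (is_derive_expR (ell x)).
have hz := is_deriveZ kappa^-1 he.
have := is_deriveB hz hc.
rewrite (_ : _ \*: _ - _ = horo); last by apply/funext => y; rewrite /horo /= mulrC.
move=> h; apply: (is_derive_eq h); congr (_ - _).
have -> : expR (ell x) = (rho x)^-1 by rewrite /vol_density expRN invrK.
have := rho_gt0 kappa x; move: (rho x) (dotp v x) => r d r0.
by rewrite /GRing.scale /=; field; rewrite !gt_eqF.
Qed.

(** The Euclidean divergence of [vol_density] times a field is [vol_density] times the Riemannian
    divergence of that field. *)
Definition horo_field k x : R := rho x * horo_grad k x.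

Lemma Ck_horo_field m k : Ck m (horo_field k).
Proof. by apply: CkM; [exact: Ck_rho|exact: Ck_horo_grad]. Qed.

Lemma is_derive_horo_field k x : is_derive x (delta_mx 0 k) (horo_field k)
  (- kappa ^+ 2 * rho x ^+ 3 * x 0 k * horo_grad k x
   + rho x * (kappa + (k == i0)%:R * (kappa * rho x * x 0 k - 1) / (kappa * horo x ^+ 2))).
Proof.
have s0 := horo_gt0 x.
have hr := is_derive_rho x (delta_mx 0 k); have hh := is_derive_horo x (delta_mx 0 k).
have hc : is_derive x (delta_mx 0 k) (fun y : 'rV[R]_n => y 0 k) 1.
  have := (is_derive_mx (fun y : 'rV[R]_n => y) x (delta_mx 0 k) (delta_mx 0 k)).2
    (is_derive_id x _) 0 k.
  by rewrite mxE !eqxx.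
have hi : is_derive x (delta_mx 0 k) (fun y => (horo y)^-1)
    (- (horo x) ^- 2 * (kappa * rho x * dotp (delta_mx 0 k) x - (delta_mx 0 k : 'rV[R]_n) 0 i0)).
  have sn : horo x != 0 by rewrite gt_eqF.
  have hv : is_derive (horo x) 1 (fun t : R => t^-1) (- (horo x) ^- 2).
    exact: is_derive_inv.
  exact: is_derive_chain hh hv.
have hg : is_derive x (delta_mx 0 k) (horo_grad k) (kappa - (k == i0)%:R / kappa *
    (- (horo x) ^- 2 * (kappa * rho x * dotp (delta_mx 0 k) x - (delta_mx 0 k : 'rV[R]_n) 0 i0))).
  have := is_deriveB (is_deriveZ kappa hc) (is_deriveZ ((k == i0)%:R / kappa) hi).
  rewrite (_ : _ - _ = horo_grad k).
    by move=> h; apply: (is_derive_eq h); rewrite /GRing.scale /= mulr1.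
  by apply/funext => y; rewrite /horo_grad invfM mulrA.
apply: (is_derive_eq (is_deriveM hr hg)).
rewrite dotp_delta mxE eqxx /= (eq_sym i0 k) /GRing.scale /=.
move: (horo_grad k x) (rho x) (horo x) (x 0 k) s0 => g r s y s0.
by case: (k == i0); rewrite /=; field; rewrite !gt_eqF.
Qed.

Lemma horo_field_div x :
  \sum_k 'D_(delta_mx 0 k) (horo_field k) x = (n%:R - 1) * kappa * rho x.
Proof.
have s0 := horo_gt0 x; have r0 := rho_gt0 kappa x.
have E k : 'D_(delta_mx 0 k) (horo_field k) x =
    - kappa ^+ 3 * rho x ^+ 3 * x 0 k ^+ 2 + rho x * kappa
    + (k == i0)%:R * (kappa * rho x ^+ 3 * x 0 k / horo x
         + rho x * (kappa * rho x * x 0 k - 1) / (kappa * horo x ^+ 2)).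
  rewrite (@derive_val _ _ _ _ _ _ _ (is_derive_horo_field k x)) /horo_grad.
  by case: (k == i0); rewrite /=; field; rewrite !gt_eqF.
rewrite (eq_bigr _ (fun k _ => E k)) !big_split /= sum_delta -mulr_sumr sumr_const card_ord.
rewrite -[\sum_i _]/(sqn x) -mulr_natl.
have := kappa_rho_horo x; have := kappa_sqn x.
move: (rho x) (horo x) (sqn x) (x 0 i0) r0 s0 => r s Q y r0 s0 eQ es.
have -> : - kappa ^+ 3 * r ^+ 3 * Q = - kappa * r ^+ 3 * (kappa ^+ 2 * Q) by ring.
(* The hyperboloid relations eliminate the coordinate and the squared norm, leaving a rational
   identity in [r] and [s]. *)
have -> : y = (1 - kappa * r * s) / (kappa * r) by rewrite es; field; rewrite !gt_eqF.
by rewrite eQ; field; rewrite !gt_eqF.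
Qed.

Lemma grad_lower f x (a : R) : 0 <= @grad_sqnorm _ _ W f x
  + 2 * a * (\sum_k pderiv f k x * horo_grad k x) + a ^+ 2.
Proof.
have s0 := horo_gt0 x; have r0 := rho_gt0 kappa x.
rewrite hyperbolic_grad//.
set A := radial_deriv f x; set D := pderiv f i0 x; set S := \sum_k pderiv f k x ^+ 2.
set e := (kappa * horo x)^-1.
(* [b] is the differential of the Busemann function whose gradient is [horo_grad]; [h] is the
   squared norm, in the inverse metric, of the covector df + a b. *)
pose b k := e * (kappa * rho x * x 0 k - (k == i0)%:R).
pose v k := pderiv f k x + a * b k.
have h : 0 <= \sum_k v k ^+ 2 + kappa ^+ 2 * (\sum_k x 0 k * v k) ^+ 2.
  rewrite addr_ge0//; first by apply: sumr_ge0 => k _; exact: sqr_ge0.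
  by rewrite mulr_ge0 ?sqr_ge0.
have e1 : \sum_k pderiv f k x * horo_grad k x = kappa * A - e * D.
  rewrite /D -(sum_delta i0 (fun k => pderiv f k x)) mulr_sumr /A /radial_deriv mulr_sumr -sumrB.
  by apply: eq_bigr => k _; rewrite /horo_grad /e; ring.
have e2 : \sum_k x 0 k * v k = A + a * e * (kappa * rho x * sqn x - x 0 i0).
  rewrite -(sum_delta i0 (fun k => x 0 k)) /sqn mulr_sumr -sumrB mulr_sumr -big_split /=.
  by apply: eq_bigr => k _; rewrite /v /b; ring.
have e3 : \sum_k v k ^+ 2 = S + 2 * a * e * (kappa * rho x * A - D)
    + a ^+ 2 * e ^+ 2 * (kappa ^+ 2 * rho x ^+ 2 * sqn x - 2 * kappa * rho x * x 0 i0 + \sum_k (k == i0)%:R * (1 : R)).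
  rewrite -(sum_delta i0 (fun k => x 0 k)) /D -(sum_delta i0 (fun k => pderiv f k x)) /sqn /S /A.
  rewrite /radial_deriv !mulr_sumr -!sumrB -!big_split /= !mulr_sumr -!big_split /=.
  apply: eq_bigr => k _; rewrite /v /b.
  by case: (k == i0); rewrite /=; ring.
move: h; rewrite e1 e2 e3 sum_delta => /le_trans; apply; rewrite le_eqVlt; apply/orP; left; apply/eqP.
have := kappa_rho_horo x; have := kappa_sqn x.
rewrite /e; clear e1 e2 e3; clearbody A D S.
move: (rho x) (horo x) (sqn x) (x 0 i0) r0 s0 => r s Q y r0 s0 eQ es.
have -> : y = (1 - kappa * r * s) / (kappa * r) by rewrite es; field; rewrite !gt_eqF.
have -> : Q = (r ^- 2 - 1) / kappa ^+ 2 by rewrite -eQ; field; rewrite !gt_eqF.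
by field; rewrite !gt_eqF.
Qed.

Lemma energy_lower f : Ck 2 f -> bounded_support f ->
  ((n%:R - 1) * kappa / 2) ^+ 2 * J (fun x => f x ^+ 2 * rho x) <= J (fun x => grad f x * rho x).
Proof.
move=> c2f sf; set c := (n%:R - 1) * kappa / 2.
have cf := Ck_C1c c2f sf.
have [df _ _] := cf.
pose F k x := f x ^+ 2 * horo_field k x.
have cF k : C1c (F k).
  apply: Ck_C1c; first by apply: CkM; [exact: CkM|exact: Ck_horo_field].
  by have [r r0 hr] := sf; exists r => // x rx; rewrite /F hr// expr2 !mul0r.
have J0 : J (fun x => \sum_k 'D_(delta_mx 0 k) (F k) x) = 0.
  rewrite rV_integral_sum; last by move=> k; exact: C1c_derive.
  by apply: big1 => k _; exact: rV_integral_derive.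
have cm : Cc (fun x => f x ^+ 2 * rho x) by apply: Cc_density; apply: Cc_sqr; exact: C1c_Cc.
have ce : Cc (fun x => grad f x * rho x) by apply: Cc_density; exact: Cc_grad.
have cd : Cc (fun x => \sum_k 'D_(delta_mx 0 k) (F k) x).
  by apply: Cc_sum => k _; exact: C1c_derive.
(* Adding [c] times the vanishing integral of the divergence makes the inequality hold pointwise. *)
rewrite -rV_integralZ// -[leRHS]addr0 -[X in _ + X](mulr0 c) -J0 -rV_integralZ// -rV_integralD//; last exact: CcZ.
apply: le_rV_integral; [exact: CcZ|by apply: CcD => //; exact: CcZ|] => x.
have E : \sum_k 'D_(delta_mx 0 k) (F k) x = 2 * f x * rho x * (\sum_k pderiv f k x * horo_grad k x)
    + f x ^+ 2 * (2 * c * rho x).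
  have -> : 2 * c * rho x = (n%:R - 1) * kappa * rho x by rewrite /c; field.
  rewrite -horo_field_div !mulr_sumr -big_split /=; apply: eq_bigr => k _.
  have hf : is_derive x (delta_mx 0 k) f (pderiv f k x).
    by apply: derivableP; exact: diff_derivable.
  have hw := Ck_is_derive x (delta_mx 0 k) (Ck_horo_field 1 k).
  have hff := is_deriveM hf hf.
  have -> : F k = (f * f) * horo_field k.
    by apply/funext => y; rewrite /F expr2.
  rewrite (@derive_val _ _ _ _ _ _ _ (is_deriveM hff hw)) /GRing.scale /= /horo_field.
  have -> : (f * f) x = f x * f x by [].
  by ring.
rewrite E; have h := grad_lower f x (c * f x); have r0 := rho_gt0 kappa x.
rewrite -subr_ge0; have := mulr_ge0 h (ltW r0).
move=> /le_trans; apply; rewrite le_eqVlt; apply/orP; left; apply/eqP.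
by move: (\sum_k _) (grad f x) => S G; ring.
Qed.

Lemma tone_lower :
  ((((n%:R - 1) * kappa / 2) ^+ 2)%:E <= fundamental_tone W)%E.
Proof.
set c2 := ((n%:R - 1) * kappa / 2) ^+ 2.
apply: le_ereal_inf_tmp => r [phi [a [b [[test cauchy] ha hb nz ->]]]].
have tC k : Ck 2 (phi k) by have [+ _] := (hyperbolic_test (phi k)).1 (test k); apply.
have tS k : bounded_support (phi k) by have [] := (hyperbolic_test (phi k)).1 (test k).
have tC1 k : C1c (phi k) by exact: Ck_C1c.
have tCc k : Cc (phi k) by exact: C1c_Cc.
pose M k := J (fun x => phi k x ^+ 2 * rho x).
have eM k : mass (phi k) = (M k)%:E by exact: hyperbolic_mass.
have a0 : (0 <= a)%E.
  apply: cvge_ge ha; near=> k.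
  by apply: riem_integral_ge0 => p; exact: grad_ge0.
have b0 : (0 <= b)%E.
  apply: cvge_ge hb; near=> k.
  by apply: riem_integral_ge0 => p; exact: sqr_ge0.
have [K hK] := cauchy 1 ltr01.
(* Finiteness of [b]: u^2 <= 2 v^2 + 2 (u - v)^2 compares every late mass with that of [phi K], the
   Cauchy condition being used with tolerance 1. *)
have bM : (b <= (2 * M K + 2 * 1)%:E)%E.
  apply: cvge_le hb; near=> k.
  have Kk : (K <= k)%N by near: k; exact: nbhs_infty_ge.
  have := hK k K Kk (leqnn K); set d := fun p => _ => hd.
  have dC : Cc d.
    rewrite (_ : d = fun x => phi k x + -1 * phi K x); first by apply: CcD => //; exact: CcZ.
    by apply/funext => x; rewrite mulN1r.
  have : (mass d < 1%:E)%E.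
    apply: le_lt_trans hd; rewrite leeDl//.
    by apply: riem_integral_ge0 => p; exact: grad_ge0.
  rewrite hyperbolic_mass// eM lte_fin lee_fin => hd1.
  have cr u : Cc u -> Cc (fun x => u x ^+ 2 * rho x) by move=> cu; apply: Cc_density; exact: Cc_sqr.
  apply: (@le_trans _ _ (2 * M K + 2 * J (fun x => d x ^+ 2 * rho x))); last first.
    by rewrite lerD2l ler_pM2l// ltW.
  rewrite /M -!rV_integralZ//; try exact: cr.
  rewrite -rV_integralD//; try (apply: CcZ; exact: cr).
  apply: le_rV_integral; [exact: cr|apply: CcD; apply: CcZ; exact: cr|].
  move=> x; rewrite !mulrA -mulrDl ler_pM2r ?rho_gt0// /d.
  have := sqr_ge0 (phi k x - 2 * phi K x).
  by move: (phi k x) (phi K x) => u v; nra.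
have bfin : b \is a fin_num by rewrite ge0_fin_numE// (le_lt_trans bM)// ltry.
have ab : (c2%:E * b <= a)%E.
  have h : (fun k => c2%:E * mass (phi k))%E @ \oo --> (c2%:E * b)%E by exact: cvgeZl.
  rewrite -(cvg_lim _ h)// -(cvg_lim _ ha)//; apply: lee_lim.
  - by apply/cvg_ex; exists (c2%:E * b)%E.
  - by apply/cvg_ex; exists a.
  - near=> k; rewrite eM /= (hyperbolic_energy (tC1 k)) -EFinM lee_fin.
    exact: energy_lower.
move: b0 bfin nz ab; case: b {hb bM} => // s; rewrite lee_fin => s0 _ nz ab.
(* If the mass tends to 0, nonvanishing of the norm forces [a > 0], and the quotient is +oo. *)
have [es|sn] := eqVneq s 0.
  rewrite es inve0 gt0_muley ?leey//.
  by rewrite lt_neqAle a0 andbT eq_sym; apply/eqP => ea; apply: nz; rewrite es ea adde0.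
have sp : 0 < s by rewrite lt_neqAle eq_sym sn.
by rewrite inver (negbTE sn) lee_pdivlMr.
Unshelve. all: by end_near. Qed.
End lower_bound.
End test_functions.

(** * Upper bound for the fundamental tone *)

(* With [psi = exp (- 1 / u)], [u = 1 - lam * (t - tau0) ^ 2] and [alpha = 1 / u], the factor of
   [1 - delta] is [psi'' / psi] and [D] is [psi' / psi]; both blow up at the ends of the support of
   [psi], where [psi'' / psi >= D ^ 2 / 2 - 100 * lam] takes over. *)
Lemma bump_inequality (R : realType) (alpha lam delta A G D eps : R) :
  0 < lam -> 0 <= delta -> 0 <= A -> D ^+ 2 = 4 * lam * (alpha ^+ 4 - alpha ^+ 3) ->
  delta * 2 <= 1 -> delta * (2 * A) <= 1 -> 200 * lam <= eps ->
  delta * (2 * (A + G)) <= eps ->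
  0 <= (1 - delta) * (lam * (4 * alpha ^+ 4 - 12 * alpha ^+ 3 + 6 * alpha ^+ 2))
       + A * delta * D + (eps - G * delta).
Proof.
move=> l0 d0 A0 eD d2 dA le_eps dG.
set P := D ^+ 2; set Q := lam * _.
have P0 : 0 <= P by exact: sqr_ge0.
(* The quartic 2 alpha^4 - 10 alpha^3 + 6 alpha^2 + 100 is positive, by completing squares twice;
   this fixes the constant 100. *)
have hQ : P / 2 - 100 * lam <= Q.
  rewrite -subr_ge0.
  have -> : Q - (P / 2 - 100 * lam) = lam * (2 * (alpha ^+ 2 - 5 / 2 * alpha - 2) ^+ 2
      + (3 / 2 * (alpha - 20 / 3) ^+ 2 + 76 / 3)).
    by rewrite /P /Q eD; field.
  have := sqr_ge0 (alpha ^+ 2 - 5 / 2 * alpha - 2); have := sqr_ge0 (alpha - 20 / 3).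
  move: (_ ^+ 2) (_ ^+ 2) => s t s0 t0; rewrite mulr_ge0 ?ltW//; lra.
have hD : - (1 + P) <= 2 * D.
  by have := sqr_ge0 (1 + D); rewrite /P => h; rewrite -subr_ge0 (_ : _ - _ = (1 + D) ^+ 2)//; ring.
have AD0 : 0 <= A * delta by rewrite mulr_ge0.
have h1 : (1 - delta) * (P / 2 - 100 * lam) <= (1 - delta) * Q.
  by apply: ler_wpM2l => //; lra.
have h2 : A * delta * (- (1 + P)) <= A * delta * (2 * D) by apply: ler_wpM2l.
(* Since delta <= 1/2, at least P / 4 survives, and A delta <= 1/2 spends at most that much. The
   terms 100 * lam and delta * (A + G) cost at most eps / 2 each. *)
have h3 := ler_wpM2r P0 d2; have h4 := ler_wpM2r P0 dA.
have h5 : 0 <= delta * lam by rewrite mulr_ge0// ltW.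
clearbody Q P; clear hQ hD eD.
lra.
Qed.

Section profile.
Variables (R : realType) (m lam tau0 : R).
Implicit Types t : R.

(** Positive on an interval of half-width 1 / sqrt lam around [tau0]; a small [lam] gives a slowly
    varying bump. *)
Definition cutoff t : R := 1 - lam * (t - tau0) ^+ 2.
Definition cutoff1 t : R := - (2 * lam) * (t - tau0).
Definition psi t : R := expinv 0 (cutoff t).
Definition psi1 t : R := expinv 2 (cutoff t) * cutoff1 t.
Definition psi2 t : R :=
  (expinv 4 (cutoff t) - 2 * expinv 3 (cutoff t)) * cutoff1 t ^+ 2 - 2 * lam * expinv 2 (cutoff t).
Definition profile t : R := expR (- (m * t)) * psi t.
Definition profile1 t : R := expR (- (m * t)) * (psi1 t - m * psi t).
Definition profile2 t : R :=
  expR (- (m * t)) * (psi2 t - 2 * m * psi1 t + m ^+ 2 * psi t).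

Lemma is_derive_sub_cst t : is_derive t 1 (fun s : R => s - tau0) 1.
Proof.
apply: (is_derive_eq (is_deriveB (is_derive_id t (1 : R)) (is_derive_cst tau0 t (1 : R)))).
by rewrite subr0.
Qed.

Lemma is_derive_cutoff t : is_derive t 1 cutoff (cutoff1 t).
Proof.
have h1 := is_derive_sub_cst t.
have h := is_deriveB (is_derive_cst (1 : R) t (1 : R)) (is_deriveZ lam (is_deriveM h1 h1)).
rewrite (_ : cutoff = cst 1 - lam \*: ((fun s => s - tau0) * (fun s => s - tau0))).
  by apply: (is_derive_eq h); rewrite /cutoff1 /GRing.scale /=; ring.
by apply/funext => s; rewrite /cutoff expr2.
Qed.

Lemma is_derive_cutoff1 t : is_derive t 1 cutoff1 (- (2 * lam)).
Proof.
apply: (is_derive_eq (is_deriveZ (- (2 * lam)) (is_derive_sub_cst t))).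
by rewrite /GRing.scale /= mulr1.
Qed.

Lemma is_derive_bump_cutoff k t : is_derive t 1 (fun s => expinv k (cutoff s))
  ((expinv k.+2 (cutoff t) - k%:R * expinv k.+1 (cutoff t)) * cutoff1 t).
Proof. exact: is_derive_chain (is_derive_cutoff t) (is_derive_bump k (cutoff t)). Qed.

Lemma is_derive_psi t : is_derive t 1 psi (psi1 t).
Proof.
by apply: (is_derive_eq (is_derive_bump_cutoff 0 t)); rewrite mul0r subr0.
Qed.

Lemma is_derive_psi1 t : is_derive t 1 psi1 (psi2 t).
Proof.
apply: (is_derive_eq (is_deriveM (is_derive_bump_cutoff 2 t) (is_derive_cutoff1 t))).
by rewrite /psi2 /GRing.scale /=; ring.
Qed.

Lemma is_derive_expM t : is_derive t 1 (fun s => expR (- (m * s))) (- m * expR (- (m * t))).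
Proof.
have h : is_derive t 1 (fun s : R => - (m * s)) (- m).
  by apply: (is_derive_eq (is_deriveN (is_deriveZ m (is_derive_id t (1 : R)))));
    rewrite /GRing.scale /= mulr1.
by apply: (is_derive_eq (is_derive_chain h (is_derive_expR _))); rewrite mulrC.
Qed.

Lemma is_derive_profile t : is_derive t 1 profile (profile1 t).
Proof.
apply: (is_derive_eq (is_deriveM (is_derive_expM t) (is_derive_psi t))).
by rewrite /profile1 /GRing.scale /=; ring.
Qed.

Lemma is_derive_profile1 t : is_derive t 1 profile1 (profile2 t).
Proof.
have h := is_deriveB (is_derive_psi1 t) (is_deriveZ m (is_derive_psi t)).
apply: (is_derive_eq (is_deriveM (is_derive_expM t) h)).
have -> : (psi1 - m \*: psi) t = psi1 t - m * psi t by [].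
by rewrite /profile2 /GRing.scale /=; ring.
Qed.

Lemma profile_outside t : cutoff t <= 0 -> profile t = 0.
Proof. by move=> h; rewrite /profile /psi /expinv ltNge h mulr0. Qed.

Lemma profile_ge0 t : 0 <= profile t.
Proof. by rewrite mulr_ge0 ?expR_ge0// bump_ge0. Qed.

(* The Laplacian of [profile \o ell] is [kappa ^ 2] times the first two terms, where [m = (n - 1) / 2]
   and [delta = exp (- 2 * ell)]. *)
Lemma profile_subsolution (delta eps t : R) : 0 < lam -> 0 <= m -> 0 <= delta ->
  200 * lam <= eps ->
  (0 < cutoff t -> [/\ delta * 2 <= 1, delta * (2 * (2 * m + 1)) <= 1 &
     delta * (2 * ((2 * m + 1) + (m ^+ 2 + m))) <= eps]) ->
  0 <= (1 - delta) * profile2 t + (2 * m + delta) * profile1 t + (m ^+ 2 + eps) * profile t.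
Proof.
move=> l0 m0 d0 le_eps hd; set E := expR (- (m * t)).
(* Conjugating by exp (- m t) cancels the drift 2 m: the remaining first-order term carries the
   small factor [delta]. *)
have -> : (1 - delta) * profile2 t + (2 * m + delta) * profile1 t + (m ^+ 2 + eps) * profile t
    = E * ((1 - delta) * psi2 t + (2 * m + 1) * delta * psi1 t + (eps - (m ^+ 2 + m) * delta) * psi t).
  by rewrite /profile2 /profile1 /profile -/E; ring.
apply: mulr_ge0; first exact: expR_ge0.
have [c0|c0] := leP (cutoff t) 0.
  by rewrite /psi2 /psi1 /psi /expinv ltNge c0 !(mulr0, mul0r, subr0, addr0).
have [d2 dA dG] := hd c0.
rewrite /psi2 /psi1 /psi /expinv c0.
set al := (cutoff t)^-1; set e := expR (- al); set c1 := cutoff1 t.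
have al0 : al != 0 by rewrite invr_eq0 gt_eqF.
have ec : c1 ^+ 2 = 4 * lam * (1 - al^-1).
  by rewrite /al invrK /c1 /cutoff1 /cutoff; ring.
have eD : (al ^+ 2 * c1) ^+ 2 = 4 * lam * (al ^+ 4 - al ^+ 3).
  by rewrite exprMn ec; field.
have A0 : 0 <= 2 * m + 1 by lra.
have := mulr_ge0 (expR_ge0 (- al)) (bump_inequality l0 d0 A0 eD d2 dA le_eps dG).
rewrite -/e ec => /le_trans; apply; rewrite le_eqVlt; apply/orP; left; apply/eqP.
by rewrite expr0; clearbody e al c1; clear -al0; field.
Qed.
End profile.

(** A sum of the three thresholds that 1 / delta has to exceed; as all are nonnegative, the sum
    replaces their maximum. *)
Definition delta_bound (R : realType) (m eps : R) : R :=
  2 + 2 * (2 * m + 1) + 2 * ((2 * m + 1) + (m ^+ 2 + m)) / eps.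

Section delta_bound.
Variables (R : realType) (m eps : R).
Hypotheses (m0 : 0 <= m) (eps0 : 0 < eps).

Let X_ge0 : 0 <= 2 * ((2 * m + 1) + (m ^+ 2 + m)) / eps.
Proof.
by rewrite divr_ge0 ?(ltW eps0)// mulr_ge0//; have := sqr_ge0 m; have := m0; lra.
Qed.

Lemma delta_bound_ge0 : 0 <= delta_bound m eps.
Proof. by have := X_ge0; have := m0; rewrite /delta_bound; lra. Qed.

Lemma delta_bounds (T : R) : 0 < T -> delta_bound m eps <= T ->
  [/\ T^-1 * 2 <= 1, T^-1 * (2 * (2 * m + 1)) <= 1 &
     T^-1 * (2 * ((2 * m + 1) + (m ^+ 2 + m))) <= eps].
Proof.
move=> T0; have := X_ge0; have := m0.
rewrite /delta_bound !ler_pdivrMl// !mulr1 -ler_pdivrMr//.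
by move: (_ / eps) => X ? ? ?; split; lra.
Qed.
End delta_bound.

Section upper_bound.
Variables (R : realType) (n : nat) (kappa : R) (i0 : 'I_n).
Hypothesis k0 : 0 < kappa.
Implicit Types (x : 'rV[R]_n).

Local Notation W := (hyperbolic_space n kappa).
Local Notation J := (@rV_integral R n).
Local Notation rho := (vol_density kappa).
Local Notation ell := (log_radius kappa).
Local Notation grad f := (@grad_sqnorm _ _ W f).
Local Notation m := ((n%:R - 1) / 2 : R).

Section radial_profile.
Variables (lam tau0 eps : R).
Hypotheses (l0 : 0 < lam) (le_eps : 200 * lam <= eps).
Local Notation B := (delta_bound m eps).
Hypothesis tau0B : tau0 = B + lam^-1 + 1.

Local Notation F := (profile m lam tau0).
Local Notation F1 := (profile1 m lam tau0).
Local Notation F2 := (profile2 m lam tau0).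
Local Notation f := (fun x : 'rV[R]_n => F (ell x)).

Let m0 : 0 <= m.
Proof. by rewrite divr_ge0// subr_ge0 ler1n (leq_ltn_trans _ (ltn_ord i0)). Qed.

Let eps0 : 0 < eps. Proof. by apply: lt_le_trans le_eps; apply: mulr_gt0 => //; rewrite ltr0n. Qed.

Let B_ge0 : 0 <= B. Proof. exact: delta_bound_ge0. Qed.

(** From s^2 < 1 / lam and s <= s^2 + 1/4, a bound without square roots. *)
Lemma cutoff_gt0 t : 0 < cutoff lam tau0 t -> `|t - tau0| < lam^-1 + 1.
Proof.
rewrite /cutoff subr_gt0 => h.
have h2 : (t - tau0) ^+ 2 < lam^-1 by rewrite -(ltr_pM2l l0) mulfV ?gt_eqF.
move: h2; rewrite -real_normK ?num_real//; move: (`|_|) => s h2.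
have := sqr_ge0 (s - 2^-1).
rewrite (_ : (s - 2^-1) ^+ 2 = s ^+ 2 - s + 4^-1); last by field.
lra.
Qed.

Lemma Ck_cutoff k : Ck k (fun x => cutoff lam tau0 (ell x)).
Proof.
have h : Ck k (fun x => ell x - tau0) by apply: CkB; [exact: Ck_ell|exact: Ck_cst].
apply: CkB; first exact: Ck_cst.
by apply: CkZ; rewrite /=; under [X in Ck _ X]eq_fun do rewrite expr2; exact: CkM.
Qed.

Lemma Ck_expell k : Ck k (fun x => expR (- (m * ell x))).
Proof. by apply: Ck_expR; apply: CkN; apply: CkZ; exact: Ck_ell. Qed.

Lemma Ck_profile k : Ck k f.
Proof. by apply: CkM; [exact: Ck_expell|apply: Ck_bump; exact: Ck_cutoff]. Qed.

Lemma Ck_profile1 k : Ck k (fun x => F1 (ell x)).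
Proof.
apply: CkM; first exact: Ck_expell.
apply: CkB; last by apply: CkZ; apply: Ck_bump; exact: Ck_cutoff.
apply: CkM; first by apply: Ck_bump; exact: Ck_cutoff.
by apply: CkZ; apply: CkB; [exact: Ck_ell|exact: Ck_cst].
Qed.

Lemma rV_norm_le_sqn x : `|x| <= 1 + sqn x.
Proof.
rewrite [`|x|]mx_normrE; apply/bigmax_leP; split; first by rewrite addr_ge0// sqn_ge0.
move=> [i k] _ /=; rewrite (ord1 i).
have h : x 0 k ^+ 2 <= sqn x.
  by rewrite /sqn (bigD1 k)//= lerDl sumr_ge0// => j _; exact: sqr_ge0.
move: h; rewrite -real_normK ?num_real//; move: (`|_|) => s h.
have := sqr_ge0 (s - 2^-1).
rewrite (_ : (s - 2^-1) ^+ 2 = s ^+ 2 - s + 4^-1); last by field.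
lra.
Qed.

Lemma profile_bounded_support : bounded_support f.
Proof.
pose b := tau0 + (lam^-1 + 1); exists (1 + expR (2 * b) / kappa ^+ 2).
  by rewrite addr_gt0// divr_gt0 ?expR_gt0// exprn_gt0.
move=> x hx; apply: profile_outside; rewrite leNgt; apply/negP => /cutoff_gt0.
rewrite ltr_norml => /andP[_ h].
have lb : ell x < b by rewrite /b -ltrBlDl.
have : expR (2 * ell x) < expR (2 * b) by rewrite ltr_expR ltr_pM2l.
rewrite expR_ell /radius2 => h1.
have h2 : kappa ^+ 2 * sqn x < expR (2 * b) by apply: lt_trans h1; rewrite ltrDr.
have k2 : 0 < kappa ^+ 2 by rewrite exprn_gt0.
have h3 : sqn x < expR (2 * b) / kappa ^+ 2 by rewrite ltr_pdivlMr// mulrC.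
have := lt_le_trans hx (rV_norm_le_sqn x).
by rewrite ltrD2l => /(lt_trans h3); rewrite ltxx.
Qed.

Lemma profile_test : @test_function _ _ W f.
Proof.
by apply/hyperbolic_test; split; [exact: Ck_profile|exact: profile_bounded_support].
Qed.

(** [tau0] is placed so that the cutoff lives where [ell x] exceeds the threshold; there 1 / delta =
    exp (2 * ell x) >= 1 + 2 * ell x exceeds it too. *)
Lemma profile_delta x : 0 < cutoff lam tau0 (ell x) ->
  [/\ rho x ^+ 2 * 2 <= 1, rho x ^+ 2 * (2 * (2 * m + 1)) <= 1 &
     rho x ^+ 2 * (2 * ((2 * m + 1) + (m ^+ 2 + m))) <= eps].
Proof.
move=> /cutoff_gt0; rewrite ltr_norml => /andP[h _].
have hB : B <= ell x by move: h; rewrite tau0B; lra.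
rewrite rho_sqr//; apply: delta_bounds => //; first exact: radius2_gt0.
apply: (le_trans hB); rewrite -expR_ell//; apply: le_trans (expR_ge1Dx _).
by rewrite mulr_natl mulr2n addrA lerDr addr_ge0// (le_trans B_ge0).
Qed.

Lemma derive_profile k x : pderiv f k x = F1 (ell x) * (kappa ^+ 2 * rho x ^+ 2 * x 0 k).
Proof.
have h := is_derive_radial (delta_mx 0 k) (is_derive_profile m lam tau0 (ell x)).
by rewrite /pderiv (@derive_val _ _ _ _ _ _ _ h) dotp_delta.
Qed.

Lemma kappa_rho_sqn x : kappa ^+ 2 * rho x ^+ 2 * sqn x = 1 - rho x ^+ 2.
Proof.
rewrite mulrAC kappa_sqn// mulrBl mul1r mulVf// expf_neq0// gt_eqF//; exact: rho_gt0.
Qed.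

Lemma grad_profile x : grad f x = F1 (ell x) ^+ 2 * (kappa ^+ 2 * (1 - rho x ^+ 2)).
Proof.
rewrite hyperbolic_grad// /radial_deriv.
have -> : \sum_k pderiv f k x ^+ 2 = (F1 (ell x) * kappa ^+ 2 * rho x ^+ 2) ^+ 2 * sqn x.
  by rewrite /sqn mulr_sumr; apply: eq_bigr => k _; rewrite derive_profile; ring.
have -> : \sum_k x 0 k * pderiv f k x = F1 (ell x) * kappa ^+ 2 * rho x ^+ 2 * sqn x.
  by rewrite /sqn mulr_sumr; apply: eq_bigr => k _; rewrite derive_profile; ring.
rewrite -kappa_rho_sqn; have := kappa_rho_sqn x; have r0 := rho_gt0 kappa x.
move: (F1 _) (rho x) (sqn x) r0 => a r Q r0 e.
have -> : Q = (1 - r ^+ 2) / (kappa ^+ 2 * r ^+ 2) by rewrite -e; field; rewrite !gt_eqF.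
by field; rewrite !gt_eqF.
Qed.

(* [h (ell x) * x] is the coordinate field of [f * grad f] times the volume density. *)
Let h t := kappa ^+ 2 * (expR (- t) * (F t * F1 t)).
Let h1 t := kappa ^+ 2 * (expR (- t) * (F1 t ^+ 2 + F t * F2 t - F t * F1 t)).

Let is_derive_h (t : R) : is_derive t 1 h (h1 t).
Proof.
have hN : is_derive t 1 (fun s : R => - s) (- 1) by exact: is_deriveN.
have hE := is_derive_chain hN (is_derive_expR (- t)).
have hF := is_derive_profile m lam tau0 t.
have hF1 := is_derive_profile1 m lam tau0 t.
have hh := is_deriveZ (kappa ^+ 2) (is_deriveM hE (is_deriveM hF hF1)).
apply: (is_derive_eq hh).
have -> : (F * F1) t = F t * F1 t by [].
by rewrite /h1 /GRing.scale /=; ring.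
Qed.

(** The divergence of f grad f is |grad f|^2 + f Delta f and has integral 0; the subsolution
    inequality is multiplied by f >= 0 and added to it pointwise. *)
Lemma profile_energy_le :
  J (fun x => grad f x * rho x) <= (m ^+ 2 + eps) * kappa ^+ 2 * J (fun x => f x ^+ 2 * rho x).
Proof.
pose V k x := h (ell x) * x 0 k.
have sf := profile_bounded_support.
have cf : C1c f by apply: Ck_C1c => //; exact: Ck_profile.
have cV k : C1c (V k).
  apply: Ck_C1c.
    apply: CkM; last exact: Ck_coord.
    apply: CkZ; apply: CkM; first exact: Ck_rho.
    by apply: CkM; [exact: Ck_profile|exact: Ck_profile1].
  by have [r r0 hr] := sf; exists r => // x rx; rewrite /V /h hr// mul0r !mulr0 mul0r.
have J0 : J (fun x => \sum_k 'D_(delta_mx 0 k) (V k) x) = 0.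
  rewrite rV_integral_sum; last by move=> k; exact: C1c_derive.
  by apply: big1 => k _; exact: rV_integral_derive.
have cm : Cc (fun x => f x ^+ 2 * rho x).
  by apply: Cc_density; apply: Cc_sqr; exact: C1c_Cc.
have ce : Cc (fun x => grad f x * rho x) by apply: Cc_density; exact: Cc_grad.
have cd : Cc (fun x => \sum_k 'D_(delta_mx 0 k) (V k) x).
  by apply: Cc_sum => k _; exact: C1c_derive.
rewrite -rV_integralZ// -[leRHS]addr0 -J0 -rV_integralD//; last exact: CcZ.
apply: le_rV_integral; [by []|by apply: CcD => //; exact: CcZ|] => x.
have E : \sum_k 'D_(delta_mx 0 k) (V k) x = n%:R * h (ell x) + h1 (ell x) * (1 - rho x ^+ 2).
  rewrite -kappa_rho_sqn /sqn [_ * \sum_k _]mulr_sumr mulr_sumr.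
  have -> : n%:R * h (ell x) = \sum_(k < n) h (ell x) by rewrite sumr_const card_ord mulr_natl.
  rewrite -big_split /=; apply: eq_bigr => k _.
  have hc : is_derive x (delta_mx 0 k) (fun y : 'rV[R]_n => y 0 k) 1.
    have := (is_derive_mx (fun y : 'rV[R]_n => y) x (delta_mx 0 k) (delta_mx 0 k)).2
      (is_derive_id x _) 0 k.
    by rewrite mxE !eqxx.
  have hr := is_derive_radial (delta_mx 0 k) (is_derive_h (ell x)).
  rewrite (@derive_val _ _ _ _ _ _ _ (is_deriveM hr hc)) dotp_delta /GRing.scale /=.
  by ring.
rewrite E grad_profile /h /h1 -/(rho x).
have r0 := rho_gt0 kappa x.
have d0 : 0 <= rho x ^+ 2 by exact: sqr_ge0.
have key := profile_subsolution l0 m0 d0 le_eps (@profile_delta x).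
have kr : 0 <= kappa ^+ 2 * rho x * F (ell x).
  by rewrite mulr_ge0 ?profile_ge0// mulr_ge0 ?ltW// exprn_gt0.
rewrite -subr_ge0; have := mulr_ge0 kr key.
move=> /le_trans; apply; rewrite le_eqVlt; apply/orP; left; apply/eqP.
by move: (F _) (F1 _) (F2 _) => a b c; field.
Qed.

Lemma profile_mass_gt0 : 0 < J (fun x => f x ^+ 2 * rho x).
Proof.
have t0 : 0 <= tau0.
  by rewrite tau0B addr_ge0// addr_ge0// invr_ge0 ltW.
(* Solves 1 + kappa^2 s^2 = exp (2 * tau0), so that [ell x] is the centre [tau0] of the cutoff. *)
pose s := Num.sqrt ((expR (2 * tau0) - 1) / kappa ^+ 2).
pose x : 'rV[R]_n := s *: delta_mx 0 i0.
have xk k : x 0 k = (k == i0)%:R * s by rewrite !mxE eqxx /= mulrC.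
have Qx : sqn x = s ^+ 2.
  rewrite /sqn -(sum_delta i0 (fun=> s ^+ 2)); apply: eq_bigr => k _.
  by rewrite xk; case: (k == i0); rewrite /=; ring.
have ex : ell x = tau0.
  have s2 : s ^+ 2 = (expR (2 * tau0) - 1) / kappa ^+ 2.
    rewrite sqr_sqrtr// divr_ge0 ?sqr_ge0// subr_ge0.
    by apply: le_trans (expR_ge1Dx _); rewrite lerDl mulr_ge0.
  have : expR (2 * ell x) = expR (2 * tau0).
    by rewrite expR_ell// /radius2 Qx s2; field; rewrite gt_eqF.
  by move=> /expR_inj; apply: mulfI; rewrite pnatr_eq0.
have cf : Cc f by apply: C1c_Cc; apply: Ck_C1c; [exact: Ck_profile|exact: profile_bounded_support].
apply: (@rV_integral_gt0 _ _ _ x).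
- by apply: Cc_density; exact: Cc_sqr.
- by move=> y; rewrite mulr_ge0 ?sqr_ge0// ltW// rho_gt0.
- rewrite mulr_gt0 ?rho_gt0// exprn_gt0// ex /profile mulr_gt0 ?expR_gt0//.
  by rewrite /psi /expinv /cutoff subrr expr0n /= mulr0 subr0 ltr01 mulr_gt0 ?expR_gt0// expr0 ltr01.
Qed.
End radial_profile.

Lemma grad_sqnorm0 f : (forall x, f x = 0) -> forall x, grad f x = 0.
Proof.
move=> f0 x; have -> : f = cst 0 by apply/funext.
have d0 k : pderiv (cst 0 : 'rV[R]_n -> R) k x = 0 by exact: derive_cst.
rewrite hyperbolic_grad// /radial_deriv big1 => [|k _]; last by rewrite d0 expr0n.
by rewrite big1 => [|k _]; [rewrite expr0n mulr0 addr0|rewrite d0 mulr0].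
Qed.

Lemma tone_upper : (fundamental_tone W <= ((m * kappa) ^+ 2)%:E)%E.
Proof.
apply/lee_addgt0Pr => e e0.
(* Chosen so that (m^2 + eps) kappa^2 = (m kappa)^2 + e. *)
pose eps := e / kappa ^+ 2.
have eps0 : 0 < eps by rewrite divr_gt0// exprn_gt0.
pose lam := eps / 200.
have l0 : 0 < lam by apply: divr_gt0 => //; rewrite ltr0n.
have le_eps : 200 * lam <= eps by rewrite mulrC divfK ?lexx ?pnatr_eq0.
pose tau0 := delta_bound m eps + lam^-1 + 1.
pose f x := profile m lam tau0 (ell x).
have tf : @test_function _ _ W f by exact: profile_test.
have cf : C1c f by exact: test_C1c tf.
have cfc := C1c_Cc cf.
pose M := J (fun x => f x ^+ 2 * rho x).
pose E := J (fun x => grad f x * rho x).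
have M0 : 0 < M by exact: profile_mass_gt0 l0 le_eps _.
have EM : E <= (m ^+ 2 + eps) * kappa ^+ 2 * M by exact: profile_energy_le.
have E0 : 0 <= E.
  rewrite -(rV_integral0 R n); apply: le_rV_integral.
  - exact: Cc_cst0.
  - by apply: Cc_density; exact: Cc_grad.
  - by move=> x; rewrite mulr_ge0 ?grad_ge0// ltW// rho_gt0.
apply: (@le_trans _ _ (E / M)%:E); last first.
  rewrite -EFinD lee_fin ler_pdivrMr// (le_trans EM)// ler_pM2r//.
  rewrite le_eqVlt; apply/orP; left; apply/eqP.
  by rewrite /eps; field; rewrite gt_eqF.
(* A constant sequence represents the test function in the completion: its differences have zero
   mass and energy. *)
apply: ereal_inf_lbound; exists (fun=> f), E%:E, M%:E; split.
- split=> // d d0; exists 0 => j k _ _ /=.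
  set g := fun p => _; have g0 x : g x = 0 by rewrite /g subrr.
  have Z u : (forall x : 'rV[R]_n, u x = 0) -> @riem_integral _ _ W u = 0%E.
    move=> u0; have -> : u = fun=> 0 by apply/funext.
    rewrite hyperbolic_integral//; last exact: Cc_cst0.
    by congr EFin; rewrite -[RHS](rV_integral0 R n); congr J; apply/funext => x; rewrite mul0r.
  rewrite /mass /energy !Z ?adde0 ?lte_fin//; first by move=> x; exact: grad_sqnorm0.
  by move=> x; rewrite g0 expr0n.
- by rewrite (_ : (fun=> _) = fun=> E%:E); [exact: cvg_cst|apply/funext => k; exact: hyperbolic_energy].
- by rewrite (_ : (fun=> _) = fun=> M%:E); [exact: cvg_cst|apply/funext => k; exact: hyperbolic_mass].
- by rewrite -EFinD => -[] /eqP; rewrite gt_eqF// ltr_wpDr.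
- by rewrite inver (gt_eqF M0).
Qed.

Lemma hyperbolic_fundamental_tone :
  fundamental_tone W = (((n%:R - 1) * kappa / 2) ^+ 2)%:E.
Proof.
apply/eqP; rewrite eq_le (tone_lower k0 i0) andbT.
by rewrite (_ : (n%:R - 1) * kappa / 2 = m * kappa) ?tone_upper// mulrAC.
Qed.
End upper_bound.

Theorem theorem1p1 (R : realType) (n : nat) (hn : (0 < n)%N)
    (N : riemannian R n) (q : N) (kappa : R)
    (hN : is_riemannian N) (hcomplete : complete_riemannian N)
    (hpole : pole q) (hkappa : 0 < kappa)
    (hcurv : radial_curvature_le q (- kappa ^+ 2)) :
  [/\ forall (M : manifold R n) (f : M -> prod_riemannian N (real_line R))
        (H : R),
        closed_hypersurface f -> constant_mean_curvature f H ->
        ((2 / n%:R)%:E * sqrte (fundamental_tone (hyperbolic_space n kappa))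
           <= `|H|%:E)%E,
      ((2 / n%:R)%:E * sqrte (fundamental_tone (hyperbolic_space n kappa))
         = ((n%:R - 1) * kappa / n%:R)%:E)%E &
      (((n%:R - 1) * kappa / n%:R)%:E
         <= inf_mean_curvature (prod_riemannian N (real_line R)))%E].
Proof.
have tone : ((2 / n%:R)%:E * sqrte (fundamental_tone (hyperbolic_space n kappa))
    = ((n%:R - 1) * kappa / n%:R)%:E)%E.
  have c0 : 0 <= (n%:R - 1) * kappa / 2.
    by rewrite divr_ge0// mulr_ge0 ?(ltW hkappa)// subr_ge0 ler1n.
  (* Positivity of [n] supplies the coordinate axis that the Busemann function singles out. *)
  rewrite (hyperbolic_fundamental_tone (Ordinal hn) hkappa) /= sqrtr_sqr ger0_norm// -EFinM.
  by congr EFin; field; rewrite pnatr_eq0 -lt0n.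
have bound (M : manifold R n) (f : M -> prod_riemannian N (real_line R)) (H : R) :
    closed_hypersurface f -> constant_mean_curvature f H ->
    ((((n%:R - 1) * kappa / n%:R)%:E : \bar R) <= `|H|%:E)%E.
  move=> cf cH; rewrite lee_fin ler_pdivrMr ?ltr0n// [leRHS]mulrC.
  exact: closed_hypersurface_mean_curvature hN hpole hkappa hcurv cf cH.
split=> //; first by move=> M f H cf cH; rewrite tone; exact: bound cf cH.
by apply: le_ereal_inf_tmp => c [M [f [H [cf cH ->]]]]; exact: bound cf cH.
Qed.
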